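(* Let $V:[0,\infty)\to\mathbb{R}$ be a measurable function with $\sup_{x\ge 0}\int_x^{x+1}|V(t)|\,dt<\infty$. If $$\lim_{x\to\infty}\int_x^{x+1}|V(t)|\,dt=0,$$ then $V$ is regular with $\sigma_{\mathrm{ess}}(L_V)=[0,\infty)$.
   Context: $L_V$ is the self-adjoint half-line Schrödinger operator $L_Vf=-f''+Vf$ on $L^2((0,\infty))$ with Dirichlet condition at $0$, with domain $\{f\in L^2((0,\infty)) : f\in W^{2,1}_{\mathrm{loc}}([0,\infty)),\ -f''+Vf\in L^2((0,\infty)),\ f(0)=0\}$. The branch of the square root is $\operatorname{Re}\sqrt{-z}>0$ for $z\in\mathbb{C}\setminus[0,\infty)$. For $V$ with $\sup_{x\ge0}\int_x^{x+1}|V|<\infty$, the set $\mathsf{E}=\sigma_{\mathrm{ess}}(L_V)\subset\mathbb{R}$ is closed, bounded below, unbounded above and not polar (not of zero logarithmic capacity), so $\Omega=\mathbb{C}\setminus\mathsf{E}$ has a Green function $G_{\mathsf{E}}(z,z_0)$. A point $x\in\mathsf{E}$ is Dirichlet-regular if $\lim_{z\to x,\,z\in\Omega}G_{\mathsf{E}}(z,z_0)=0$. The positive harmonic functions on $\Omega$ which are bounded on bounded subsets of $\Omega$ and tend to $0$ at every Dirichlet-regular point of $\mathsf{E}$ are all positive multiples of one function; the Martin function $M_{\mathsf{E}}$ is the one normalized by $\lim_{z\to-\infty}M_{\mathsf{E}}(z)/\sqrt{-z}=1$ (for such $V$ this limit is positive before normalization). The real constant $a_{\mathsf{E}}$ is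 determined by the expansion, valid for such $V$ and every $\delta>0$, $M_{\mathsf{E}}(z)=\operatorname{Re}\left(\sqrt{-z}+\frac{a_{\mathsf{E}}}{2\sqrt{-z}}\right)+o(|z|^{-1/2})$ as $z\to\infty$, $\arg z\in[\delta,2\pi-\delta]$. The potential $V$ is called regular if $a_{\mathsf{E}}=\lim_{x\to\infty}\frac1x\int_0^xV(t)\,dt$. *)

(* Defs.v *)
From HB Require Import structures.
From mathcomp Require Import all_boot all_order all_algebra.
From mathcomp Require Import complex.
From mathcomp Require Import all_classical all_reals all_analysis.

Set Implicit Arguments.
Unset Strict Implicit.
Unset Printing Implicit Defensive.

Import Order.TTheory GRing.Theory Num.Theory.
Import numFieldNormedType.Exports.

Local Open Scope classical_set_scope.
Local Open Scope ring_scope.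
Local Open Scope complex_scope.

(* The topology of the complex plane is the one of the modulus; R[i] is
   registered as a normed space over itself because the libraries only do this
   for its alias R[i]^o. *)
HB.instance Definition _ (R : rcfType) := NormedModule.copy R[i] R[i]^o.

Section HalfLineOperators.
Context {R : realType}.
Local Notation mu := (@lebesgue_measure R).
Local Notation halfline := (`]0%R, +oo[%classic : set R).

Definition normc2_integral (f : R -> R[i]) : \bar R :=
  (\int[mu]_(x in halfline) (Normc.normc (f x) ^+ 2)%:E)%E.

(* Elements of the complex Hilbert space L^2((0, oo)) are represented by
   functions on R, of which only the restriction to (0, oo) matters, and are
   compared with [ae_eq mu halfline]. *)
Definition L2_halfline (f : R -> R[i]) : Prop :=
  [/\ measurable_fun halfline (@complex.Re R \o f),
      measurable_fun halfline (@complex.Im R \o f) &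
      (normc2_integral f < +oo)%E].

(* A linear operator T in L^2((0, oo)) is given by its graph: [T f g] means
   that f represents an element of the domain of T and g represents its image. *)
Definition graph := (R -> R[i]) -> (R -> R[i]) -> Prop.

(* T - z is a bijection from the domain of T onto L^2 with bounded inverse;
   (T - z) f = h is written T f = h + z f. *)
Definition resolvent_set (T : graph) : set R[i] :=
  [set z | exists K : R, forall h, L2_halfline h ->
    exists f, [/\ T f (fun x => h x + z * f x),
      forall f', T f' (fun x => h x + z * f' x) -> ae_eq mu halfline f' f &
      (normc2_integral f <= K%:E * normc2_integral h)%E]].

Definition spectrum (T : graph) : set R[i] := ~` resolvent_set T.

Definition eigenfunction (T : graph) (z : R[i]) (f : R -> R[i]) : Prop :=
  T f (fun x => z * f x).

Definition eigenvalue_of_operator (T : graph) (z : R[i]) : Prop :=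
  exists2 f, eigenfunction T z f & ~ ae_eq mu halfline f (fun=> 0).

Definition finite_multiplicity (T : graph) (z : R[i]) : Prop :=
  exists (n : nat) (e : 'I_n -> R -> R[i]), forall f, eigenfunction T z f ->
    exists c : 'I_n -> R[i],
      ae_eq mu halfline f (fun x => \sum_(i < n) c i * e i x).

Definition discrete_spectrum (T : graph) : set R[i] :=
  [set z | [/\ isolated (spectrum T) z, eigenvalue_of_operator T z &
               finite_multiplicity T z]].

Definition essential_spectrum (T : graph) : set R[i] :=
  spectrum T `\` discrete_spectrum T.

Definition locally_integrable_0 (g : R -> R[i]) : Prop :=
  forall b : R, 0 <= b ->
    mu.-integrable `[0, b] (EFin \o (@complex.Re R \o g)) /\
    mu.-integrable `[0, b] (EFin \o (@complex.Im R \o g)).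

Definition cintegral (a b : R) (g : R -> R[i]) : R[i] :=
  (\int[mu]_(t in `[a, b]) complex.Re (g t)) +i*
  (\int[mu]_(t in `[a, b]) complex.Im (g t)).

(* f is locally absolutely continuous on [0, oo) with derivative g a.e., i.e.
   f is the continuous representative of an element of W^{1,1}_loc([0, oo)) with
   weak derivative g. *)
Definition weak_derivative (f g : R -> R[i]) : Prop :=
  locally_integrable_0 g /\
  forall x : R, 0 <= x -> f x = f 0 + cintegral 0 x g.

(* f'' stands for the second weak derivative of f in W^{2,1}_loc([0, oo)), so
   that f is its continuous representative and f 0 is its boundary value. *)
Definition schroedinger (V : R -> R) : graph := fun f g =>
  [/\ L2_halfline f, L2_halfline g, f 0 = 0 &
    exists f' f'' : R -> R[i],
      [/\ weak_derivative f f', weak_derivative f' f'' &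
          ae_eq mu halfline g (fun x => - f'' x + (V x)%:C * f x)]].

End HalfLineOperators.

Section PotentialTheory.
Context {R : realType}.
Implicit Types (u M G h : R[i] -> R) (E Omega : set R[i]) (z : R[i]).

Definition xslice u z : R -> R := fun t => u (t +i* complex.Im z).
Definition yslice u z : R -> R := fun t => u (complex.Re z +i* t).
Definition dx u : R[i] -> R := fun z => derive1 (xslice u z) (complex.Re z).
Definition dy u : R[i] -> R := fun z => derive1 (yslice u z) (complex.Im z).

Definition C1_on Omega u : Prop := forall z, Omega z ->
  [/\ derivable (xslice u z) (complex.Re z) 1,
      derivable (yslice u z) (complex.Im z) 1,
      {for z, continuous (dx u)} & {for z, continuous (dy u)}].

Definition harmonic_on Omega u : Prop :=
  [/\ C1_on Omega u, C1_on Omega (dx u), C1_on Omega (dy u) &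
      forall z, Omega z -> dx (dx u) z + dy (dy u) z = 0].

Definition nonneg_log_pole Omega z0 G : Prop :=
  (forall z, Omega z -> z != z0 -> 0 <= G z) /\
  exists2 h, harmonic_on Omega h &
    forall z, Omega z -> z != z0 -> G z = h z - ln (Normc.normc (z - z0)).

(* The Green function with pole z0 is the smallest nonnegative function
   harmonic on Omega \ {z0} with singularity - log |z - z0| at z0.
   Its value at z0, which should be +oo, is not used. *)
Definition green_function Omega z0 G : Prop :=
  nonneg_log_pole Omega z0 G /\
  forall G', nonneg_log_pole Omega z0 G' ->
    forall z, Omega z -> z != z0 -> G z <= G' z.

Definition dirichlet_regular E (x : R[i]) : Prop :=
  E x /\ forall z0, ~ E z0 ->
    exists2 G, green_function (~` E) z0 G &
      G z @[z --> within (~` E) (nbhs x)] --> (0 : R).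

(* [sqrtc] is the principal square root: 'Re (sqrtc w) > 0 unless w is real
   and nonpositive, so sqrtc (- z) is the required branch of sqrt(-z) off
   [0, oo). *)
Definition martin_function E M : Prop :=
  [/\ harmonic_on (~` E) M,
      forall z, ~ E z -> 0 < M z,
      forall r : R, exists K : R, forall z,
        ~ E z -> Normc.normc z <= r -> M z <= K,
      forall x, dirichlet_regular E x ->
        M z @[z --> within (~` E) (nbhs x)] --> (0 : R) &
      M ((- t)%:C) / complex.Re (sqrtc t%:C) @[t --> +oo] --> (1 : R)].

(* The z with arg z in [delta, 2 pi - delta]. *)
Definition sector (delta : R) : set R[i] :=
  [set z | exists r theta : R, [/\ 0 < r, delta <= theta <= 2 * pi - delta &
             z = (r * cos theta) +i* (r * sin theta)]].

Definition martin_expansion M (a : R) : Prop :=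
  forall delta : R, 0 < delta -> forall eps : R, 0 < eps ->
  exists A : R, forall z, sector delta z -> A <= Normc.normc z ->
    `| M z - complex.Re (sqrtc (- z) + a%:C / (2 * sqrtc (- z))) |
      <= eps * (Num.sqrt (Normc.normc z))^-1.

Definition martin_constant E (a : R) : Prop :=
  exists2 M, martin_function E M & martin_expansion M a.

End PotentialTheory.

Definition regular_potential {R : realType} (V : R -> R) : Prop :=
  exists2 a : R, martin_constant (essential_spectrum (schroedinger V)) a &
    x^-1 * \int[@lebesgue_measure R]_(t in `[0, x]) V t @[x --> +oo] --> a.

(* Main.v *)
Require Import Defs.
From mathcomp Require Import all_boot all_order all_algebra.
From mathcomp Require Import complex ring lra.
From mathcomp Require Import all_classical all_reals all_analysis measurable_realfun.

(** The potential is small in the mean at infinity, so far away the operator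
    L f = - f'' + V f is a small perturbation of - f''. Its essential spectrum is
    therefore [0, oo), that of the free operator. The Martin function of the
    complement of [0, oo) is exactly Re sqrt (- z), which gives the constant a = 0
    ([martin_constant_halfline]); and the averages of V tend to 0 because the
    integral of |V| grows by an arbitrarily small amount per unit length far out
    ([average_cvg0]). Hence V is regular.

    The essential spectrum is found by estimating solutions of the differential
    equation, with no general theory of self-adjoint operators. An element f of
    the domain and (L - z) f = h are replaced by the real and imaginary parts u, v
    of f, which solve a real linear system ([schroedinger_zP]); L^2 norms are limits
    of integrals over [0, n]. The smallness of V in the mean is enough because on
    every unit interval the maximum of |u| is controlled by the L^2 norms of u and h
    ([local_estimate]), so that the integral of |V| u^2 is at most the mean of |V|
    times such norms.

    Three facts determine the essential spectrum ([essential_spectrum_decaying]).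

    - Every lambda >= 0 is in the spectrum ([no_bounded_inverse]): truncated waves
      cos(k t) and sin(k t), k^2 = lambda, far away from the origin, are data for
      which no bounded inverse can exist. In particular no point of [0, oo) is
      isolated in the spectrum.

    - Off [0, oo) a point z that is not an eigenvalue is in the resolvent set. It
      suffices to bound the solutions of the Dirichlet problems on [0, n] uniformly
      in n, as a compactness argument then yields a square integrable solution on
      the half-line ([resolvent_of_apriori]). For non-real z the bound is the
      Wronskian identity for u and v ([nonreal_bound]), and there are no
      eigenvalues; for z = E < 0 it follows from the energy estimate far out
      ([tail_estimate], [dirichlet_bound_real]).

    - A negative eigenvalue is simple, since its eigenfunctions are multiples of one
      solution of the initial value problem, and it is isolated, since the
      eigenfunctions of two nearby eigenvalues are both orthogonal and close to
      each other ([eigenvalue_isolated_real]). So it is in the discrete spectrum.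

    Since V is only locally integrable, solutions are absolutely continuous
    functions; product rule, Gronwall's inequality and existence for linear systems
    are proved in this setting first ([acM], [gronwall], [linear_system_exists]). *)

Set Implicit Arguments.
Unset Strict Implicit.
Unset Printing Implicit Defensive.

Import Order.TTheory GRing.Theory Num.Theory.
Import numFieldNormedType.Exports.

Local Open Scope classical_set_scope.
Local Open Scope ring_scope.
Local Open Scope complex_scope.

(** * Integrals and primitives on the half-line *)

Section AbsolutelyContinuous.
Context {R : realType}.
Local Notation mu := (@lebesgue_measure R).
Local Notation J a b f := (Rintegral mu `[a, b]%classic f).
Implicit Types (f g h F G : R -> R) (a b c x : R).

(** ** Locally integrable and locally absolutely continuous functions *)

Definition lint f := forall b, 0 <= b -> mu.-integrable `[0, b] (EFin \o f).

Definition lcont F := forall b, 0 <= b -> {within `[0, b], continuous F}.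

(** F is locally absolutely continuous on the closed half-line with derivative f
    almost everywhere. All differential equations below are read in this sense,
    because the potential is only locally integrable. *)
Definition ac F f := lint f /\ forall x, 0 <= x -> F x = F 0 + J 0 x f.

Lemma lintW f a b : lint f -> 0 <= a -> mu.-integrable `[a, b] (EFin \o f).
Proof.
move=> lf a0; have [ab|ba] := leP a b.
  apply: integrableS (lf b (le_trans a0 ab)) => //.
  by apply: subset_itvr; rewrite bnd_simp.
by rewrite set_itv_ge ?bnd_simp -?ltNge//; exact: integrable_set0.
Qed.

Arguments lintW {f a b}.

Lemma lint_meas f a b : lint f -> 0 <= a -> measurable_fun `[a, b] f.
Proof. by move=> lf a0; apply/measurable_EFinP; apply: (measurable_int mu); exact: lintW. Qed.

Lemma lintD f g : lint f -> lint g -> lint (fun t => f t + g t).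
Proof.
move=> lf lg b b0.
exact: (integrableD (mu := mu) _ (lf b b0) (lg b b0)).
Qed.

Lemma lintN f : lint f -> lint (fun t => - f t).
Proof. by move=> lf b b0; have := integrableN (lf b b0). Qed.

Lemma lintB f g : lint f -> lint g -> lint (fun t => f t - g t).
Proof. by move=> lf lg; apply: lintD => //; apply: lintN. Qed.

Lemma lintZ k f : lint f -> lint (fun t => k * f t).
Proof.
move=> lf b b0.
exact: (integrableZl (mu := mu) _ k (lf b b0)).
Qed.

Lemma lint_norm f : lint f -> lint (fun t => `|f t|).
Proof. by move=> lf b b0; have := integrable_norm (lf b b0). Qed.

Lemma lcont_cst k : lcont (fun=> k).
Proof. by move=> b b0 x; apply: cst_continuous. Qed.

Lemma lcontD f g : lcont f -> lcont g -> lcont (fun t => f t + g t).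
Proof. by move=> cf cg b b0 x; apply: cvgD; [exact: cf | exact: cg]. Qed.

Lemma lcontN f : lcont f -> lcont (fun t => - f t).
Proof. by move=> cf b b0 x; apply: cvgN; exact: cf. Qed.

Lemma lcontB f g : lcont f -> lcont g -> lcont (fun t => f t - g t).
Proof. by move=> cf cg; apply: lcontD => //; exact: lcontN. Qed.

Lemma lcontM f g : lcont f -> lcont g -> lcont (fun t => f t * g t).
Proof. by move=> cf cg b b0 x; apply: cvgM; [exact: cf | exact: cg]. Qed.

Lemma lcontX f n : lcont f -> lcont (fun t => f t ^+ n).
Proof.
move=> cf; elim: n => [|n IH]; first by under eq_fun do rewrite expr0; exact: lcont_cst.
by under eq_fun do rewrite exprS; exact: lcontM.
Qed.

Lemma lcont_norm f : lcont f -> lcont (fun t => `|f t|).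
Proof. by move=> cf b b0 x; apply: cvg_norm; exact: cf. Qed.

Lemma lcont_bounded f b : lcont f -> 0 <= b ->
  exists2 M, 0 <= M & forall t, 0 <= t <= b -> `|f t| <= M.
Proof.
move=> cf b0.
have [c _ cmax] := EVT_max b0 (lcont_norm cf b0).
by exists `|f c| => // t tb; apply: cmax; rewrite in_itv.
Qed.

Lemma lcont_meas f b : lcont f -> 0 <= b -> measurable_fun `[0, b] f.
Proof.
by move=> cf b0; apply: subspace_continuous_measurable_fun => //; exact: cf.
Qed.

Lemma lintM f G : lint f -> lcont G -> lint (fun t => f t * G t).
Proof.
move=> lf cG b b0; have [M M0 GM] := lcont_bounded cG b0.
apply: (integrableMl (mu := mu) (h := G) _ (lf b b0)) => //.
  exact: lcont_meas.
exists M; split; first by rewrite realE M0.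
by move=> x Mx t /=; rewrite in_itv/= => tb; apply/ltW/(le_lt_trans _ Mx)/GM.
Qed.

Lemma lintMl f G : lint f -> lcont G -> lint (fun t => G t * f t).
Proof. by move=> lf cG; under eq_fun do rewrite mulrC; exact: lintM. Qed.

Lemma lint_cst k : lint (fun=> k).
Proof.
move=> b b0; apply: continuous_compact_integrable; first exact: segment_compact.
by move=> x; apply: cst_continuous.
Qed.

Lemma lcont_lint f : lcont f -> lint f.
Proof. by move=> cf; have := lintM (lint_cst 1) cf; under eq_fun do rewrite mul1r. Qed.

(** ** Integrals over compact intervals *)

Lemma J_D f g a b : lint f -> lint g -> 0 <= a ->
  J a b (fun t => f t + g t) = J a b f + J a b g.
Proof. by move=> lf lg a0; apply: RintegralD => //; exact: lintW. Qed.

Lemma J_B f g a b : lint f -> lint g -> 0 <= a ->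
  J a b (fun t => f t - g t) = J a b f - J a b g.
Proof. by move=> lf lg a0; apply: RintegralB => //; exact: lintW. Qed.

Lemma J_Z k f a b : lint f -> 0 <= a -> J a b (fun t => k * f t) = k * J a b f.
Proof. by move=> lf a0; apply: RintegralZl => //; exact: lintW. Qed.

Lemma J_N f a b : lint f -> 0 <= a -> J a b (fun t => - f t) = - J a b f.
Proof.
move=> lf a0; under eq_Rintegral do rewrite -mulN1r.
by rewrite J_Z// mulN1r.
Qed.

Lemma J_eq f g a b : (forall t, a <= t <= b -> f t = g t) -> J a b f = J a b g.
Proof. by move=> fg; apply: eq_Rintegral => t; rewrite inE/= in_itv/= => /fg. Qed.

Lemma J_le f g a b : lint f -> lint g -> 0 <= a ->
  (forall t, a <= t <= b -> f t <= g t) -> J a b f <= J a b g.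
Proof.
by move=> lf lg a0 fg; apply: le_Rintegral => //; exact: lintW.
Qed.

Lemma J_ge0 f a b : (forall t, a <= t <= b -> 0 <= f t) -> 0 <= J a b f.
Proof. by move=> f0; apply: Rintegral_ge0 => t /=; rewrite in_itv/= => /f0. Qed.

Lemma J_norm f a b : lint f -> 0 <= a -> `|J a b f| <= J a b (fun t => `|f t|).
Proof. by move=> lf a0; apply: le_normr_Rintegral => //; exact: lintW. Qed.

Lemma J_pt f a : J a a f = 0.
Proof. by rewrite set_itv1 Rintegral_set1. Qed.

Lemma J_cat f a b c : lint f -> 0 <= a -> a <= b -> b <= c ->
  J a c f = J a b f + J b c f.
Proof.
move=> lf a0 ab bc; have b0 := le_trans a0 ab.
have := @Rintegral_itvB _ f (BLeft a) (BRight c) b (lintW lf a0).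
rewrite !bnd_simp => /(_ ab bc) E.
rewrite -(@Rintegral_itv_obnd_cbnd _ b (BRight c)) -?E; first by rewrite addrC subrK.
by apply: integrableS (lintW (b := c) lf b0) => //; exact: subset_itv_oc_cc.
Qed.

Lemma J_cst k a b : a <= b -> J a b (fun=> k) = k * (b - a).
Proof.
move=> ab; rewrite Rintegral_cst//= lebesgue_measure_itv/= lte_fin.
by move: ab; rewrite le_eqVlt => /predU1P[->|->//]; rewrite ltxx/= subrr.
Qed.

Lemma J_mono f a b c : lint f -> 0 <= a -> a <= b -> b <= c ->
  (forall t, b <= t <= c -> 0 <= f t) -> J a b f <= J a c f.
Proof. by move=> lf a0 ab bc f0; rewrite (J_cat lf a0 ab bc) lerDl J_ge0. Qed.

Lemma J_sub f a b a' b' : lint f -> 0 <= a -> a <= a' -> a' <= b' -> b' <= b ->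
  (forall t, a <= t <= b -> 0 <= f t) -> J a' b' f <= J a b f.
Proof.
move=> lf a0 aa' ab' bb' f0; have a'0 := le_trans a0 aa'.
rewrite [leRHS](J_cat (b := a') lf)//; last exact: le_trans ab' bb'.
rewrite [X in _ <= _ + X](J_cat (b := b') lf)//.
rewrite addrCA lerDl addr_ge0// J_ge0// => t /andP[h1 h2]; apply: f0.
  by rewrite h1 /= (le_trans h2) // (le_trans ab').
by rewrite h2 andbT (le_trans aa')// (le_trans ab').
Qed.

Lemma J_bound f a b k : lint f -> 0 <= a -> a <= b ->
  (forall t, a <= t <= b -> f t <= k) -> J a b f <= k * (b - a).
Proof. by move=> lf a0 ab fk; rewrite -J_cst// J_le//; exact: lint_cst. Qed.

Lemma ac_lint F f : ac F f -> lint f. Proof. by case. Qed.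

Lemma prim_lcont f : lint f -> lcont (fun x => J 0 x f).
Proof. by move=> lf b b0; have := parameterized_integral_continuous b0 (lf b b0). Qed.

Lemma lcont_eq F G : (forall x, 0 <= x -> F x = G x) -> lcont F -> lcont G.
Proof.
move=> FG cF b b0; apply: (subspace_eq_continuous _ (cF b b0)).
by move=> x; rewrite inE/= in_itv/= => /andP[x0 _]; exact: FG.
Qed.

Lemma ac_lcont F f : ac F f -> lcont F.
Proof.
move=> [lf FE]; apply: (@lcont_eq (fun x => F 0 + J 0 x f)).
  by move=> x /FE.
by apply: lcontD; [exact: lcont_cst|exact: prim_lcont].
Qed.

Lemma ac_J F f a b : ac F f -> 0 <= a -> a <= b -> F b - F a = J a b f.
Proof.
move=> [lf FE] a0 ab; rewrite (FE b) ?(FE a)//; last exact: le_trans ab.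
rewrite [J 0 b f](J_cat (b := a) lf)//; ring.
Qed.

Lemma ac_eq F G f g : (forall x, 0 <= x -> F x = G x) ->
  (forall x, 0 <= x -> f x = g x) -> ac F f -> ac G g.
Proof.
move=> FG fg [lf FE]; split.
  move=> b b0; apply: eq_integrable (lf b b0) => // x.
  by rewrite inE/= in_itv/= => /andP[x0 _]; rewrite fg.
move=> x x0; rewrite -!FG// FE//; congr (_ + _).
by apply: J_eq => t /andP[t0 _]; exact: fg.
Qed.

Lemma ac_prim f k : lint f -> ac (fun x => k + J 0 x f) f.
Proof. by move=> lf; split => // x x0; rewrite J_pt addr0. Qed.

Lemma ac_cst k : ac (fun=> k) (fun=> 0).
Proof. by split; [exact: lint_cst|move=> x x0; rewrite J_cst// mul0r addr0]. Qed.

Lemma acD F G f g : ac F f -> ac G g -> ac (fun x => F x + G x) (fun x => f x + g x).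
Proof.
move=> [lf FE] [lg GE]; split; first exact: lintD.
by move=> x x0; rewrite J_D// FE// GE//; ring.
Qed.

Lemma acZ k F f : ac F f -> ac (fun x => k * F x) (fun x => k * f x).
Proof.
move=> [lf FE]; split; first exact: lintZ.
by move=> x x0; rewrite J_Z// FE//; ring.
Qed.

Lemma acN F f : ac F f -> ac (fun x => - F x) (fun x => - f x).
Proof.
move=> [lf FE]; split; first exact: lintN.
by move=> x x0; rewrite J_N// FE//; ring.
Qed.

Lemma acB F G f g : ac F f -> ac G g -> ac (fun x => F x - G x) (fun x => f x - g x).
Proof. by move=> aF aG; apply: acD => //; exact: acN. Qed.

Lemma ac_C1 F f : (forall x, derivable F x 1) -> derive1 F = f -> continuous f -> ac F f.
Proof.
move=> dF Ff cf; have cF : continuous F.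
  by move=> x; apply/differentiable_continuous/derivable1_diffP.
have lf : lint f by apply: lcont_lint => b b0; exact: continuous_subspaceT.
split=> // x; rewrite le_eqVlt => /predU1P[<-|x0]; first by rewrite J_pt addr0.
have : (\int[mu]_(x in `[0%R, x]) (f x)%:E = (F x)%:E - (F 0)%:E)%E.
  apply: continuous_FTC2 => //.
  - exact: continuous_subspaceT.
  - split => //; [apply: cvg_at_right_filter; exact: cF|apply: cvg_at_left_filter; exact: cF].
  - by move=> y _; rewrite Ff.
by move=> E; rewrite /Rintegral E /=; ring.
Qed.

End AbsolutelyContinuous.

(** * The product rule for absolutely continuous functions *)

Section ProductRule.
Context {R : realType}.
Local Notation mu := (@lebesgue_measure R).
Local Notation J a b f := (Rintegral mu `[a, b]%classic f).
Implicit Types (f g h F G : R -> R) (a b c x : R).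

Lemma J_EFin f a b : lint f -> 0 <= a ->
  (\int[mu]_(t in `[a, b]) (f t)%:E = (J a b f)%:E)%E.
Proof.
move=> lf a0; rewrite /Rintegral fineK//.
by apply: integrable_fin_num => //; exact: lintW.
Qed.

Lemma J_sub0 f b c : lint f -> 0 <= b -> b <= c -> J b c f = J 0 c f - J 0 b f.
Proof. by move=> lf b0 bc; rewrite (J_cat lf (lexx 0) b0 bc); ring. Qed.

(** Fubini on the triangle t <= s of the square [0, x]^2; this is the analytic
    content of the product rule, since neither density need be continuous. *)
Lemma fubini_triangle f g x : lint f -> lint g -> 0 <= x ->
  J 0 x (fun t => g t * J t x f) = J 0 x (fun s => f s * J 0 s g).
Proof.
move=> lf lg x0.
pose f1 := f \_ `[0, x]; pose g1 := g \_ `[0, x].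
have if1 : mu.-integrable setT (EFin \o f1).
  rewrite /f1 -restrict_EFin; apply/integrable_restrict => //=.
  by rewrite setTI; exact: lintW.
have ig1 : mu.-integrable setT (EFin \o g1).
  rewrite /g1 -restrict_EFin; apply/integrable_restrict => //=.
  by rewrite setTI; exact: lintW.
have mf1 : measurable_fun setT f1.
  by apply/measurable_EFinP; exact: (measurable_int mu).
have mg1 : measurable_fun setT g1.
  by apply/measurable_EFinP; exact: (measurable_int mu).
(* K is the indicator of the triangle, H the integrand extended by zero. *)
pose K (p : R * R) : R := (p.2 <= p.1)%R%:R.
have mK : measurable_fun setT K.
  have mle : measurable_fun setT (fun p : R * R => p.2 <= p.1).
    by apply: measurable_fun_ler; [exact: measurable_snd|exact: measurable_fst].
  have -> : K = (fun b : bool => b%:R : R) \o (fun p : R * R => p.2 <= p.1) by [].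
  apply: measurableT_comp => //.
pose H (p : R * R) : \bar R := (f1 p.1 * g1 p.2 * K p)%:E.
have mH : measurable_fun setT H.
  apply/measurable_EFinP; apply: measurable_funM => //.
  apply: measurable_funM; apply: measurableT_comp => //.
have K01 p : 0 <= K p <= 1 by rewrite /K; case: (p.2 <= p.1); rewrite /= ?lexx ?ler01.
have iH : (mu \x mu)%E.-integrable setT H.
  apply/(integrable12ltyP mu mu mH).
  have /integrableP[_ if1oo] := if1.
  have /integrableP[mg1' ig1oo] := ig1.
  pose C := (\int[mu]_t `|(g1 t)%:E|)%E.
  have mf1' : measurable_fun [set: R] (fun s => `|(f1 s)%:E|%E).
    by apply: measurableT_comp => //; exact/measurable_EFinP.
  have mg1a : measurable_fun [set: R] (fun s => `|(g1 s)%:E|%E).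
    by apply: measurableT_comp => //; exact/measurable_EFinP.
  have C0 : (0 <= C)%E by exact: integral_ge0.
  apply: (@le_lt_trans _ _ (\int[mu]_s (`|(f1 s)%:E| * C))%E).
    apply: ge0_le_integral => //.
    - by move=> s _; apply: integral_ge0.
    - apply: (@measurable_fun_fubini_tonelli_F _ _ _ _ _ mu (fun p => `|H p|%E)) => //.
      exact: measurableT_comp.
    - by under eq_fun do rewrite muleC; exact: measurable_funeM.
    - move=> s _; rewrite /C -ge0_integralZl//.
      apply: ge0_le_integral => //.
      + apply: measurableT_comp => //.
        by apply: measurable_fun_pair2.
      + exact: measurable_funeM.
      + move=> t _; rewrite /H/= -EFinM lee_fin !normrM.
        have /andP[k0 k1] := K01 (s, t).
        by rewrite (ger0_norm k0) ler_piMr// mulr_ge0.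
  rewrite ge0_integralZr// lte_mul_pinfty//.
    by apply: integral_ge0.
  by rewrite ge0_fin_numE//; apply: integral_ge0.
have lJ : lint (fun t => g t * (J 0 x f - J 0 t f)).
  by apply: lintM => //; apply: lcontB; [exact: lcont_cst|exact: prim_lcont].
have EJx : J 0 x (fun t => g t * J t x f) = J 0 x (fun t => g t * (J 0 x f - J 0 t f)).
  by apply: J_eq => t /andP[t0 tx]; rewrite (J_sub0 lf).
have lJ2 : lint (fun t => f t * J 0 t g).
  by apply: lintM => //; exact: prim_lcont.
have := Fubini iH.
under eq_integral => s _.
  have -> : (\int[mu]_y H (s, y))%E = ((EFin \o (fun s => f s * J 0 s g)) \_ `[0, x]) s.
    rewrite patchE; case: ifPn => [|sx].
      rewrite inE/= in_itv/= => /andP[s0 sx].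
      rewrite -J_Z// -J_EFin//; last exact: lintZ.
      rewrite [RHS]integral_mkcond; apply: eq_integral => t _.
      rewrite /H/= /f1 /g1 /K !patchE/= !mem_setE !in_itv/= s0 sx/=.
      have [ts|ts] := leP t s; last by rewrite andbF mulr0.
      by rewrite (le_trans ts sx) !andbT; case: ifP => // _; rewrite mulr1 ?mulr0.
    by apply: integral0_eq => t _; rewrite /H /f1/= patchE (negbTE sx) !mul0r.
  over.
rewrite -integral_mkcond (J_EFin _ lJ2 (lexx 0)).
under eq_integral => t _.
  have -> : (\int[mu]_s H (s, t))%E = ((EFin \o (fun t => g t * (J 0 x f - J 0 t f))) \_ `[0, x]) t.
    rewrite patchE; case: ifPn => [|sx].
      rewrite inE/= in_itv/= => /andP[t0 tx].
      rewrite -(J_sub0 lf t0 tx).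
      rewrite -J_Z// -J_EFin//; last exact: lintZ.
      rewrite [RHS]integral_mkcond; apply: eq_integral => s _.
      rewrite /H/= /f1 /g1 /K !patchE/= !mem_setE !in_itv/= t0 tx/=.
      have [ts|ts] := leP t s; last by rewrite mulr0.
      by rewrite (le_trans t0 ts); case: ifP => _; rewrite mulr1 ?mul0r// mulrC.
    by apply: integral0_eq => s _; rewrite /H /g1/= patchE (negbTE sx) mulr0 mul0r.
  over.
by rewrite -integral_mkcond (J_EFin _ lJ (lexx 0)) EJx => -[].
Qed.

(** With F = F 0 + P and G = G 0 + Q, the product of the two primitives P and Q
    is a double integral over a square, which is cut along its diagonal. *)
Lemma acM F G f g : ac F f -> ac G g ->
  ac (fun x => F x * G x) (fun x => f x * G x + F x * g x).
Proof.
move=> aF aG; have cF := ac_lcont aF; have cG := ac_lcont aG.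
case: (aF) => lf FE; case: (aG) => lg GE.
have cPF := prim_lcont lf; have cPG := prim_lcont lg.
split; first by apply: lintD; [exact: lintM|exact: lintMl].
move=> x x0.
have E : J 0 x f * J 0 x g = J 0 x (fun t => f t * J 0 t g) + J 0 x (fun t => J 0 t f * g t).
  rewrite -fubini_triangle//.
  rewrite [X in _ = X + _](@J_eq _ _ (fun t => g t * (J 0 x f - J 0 t f))); last first.
    by move=> t /andP[t0 tx]; rewrite (J_sub0 lf).
  have lA : lint (fun t => g t * (J 0 x f - J 0 t f)).
    by apply: lintM => //; apply: lcontB; [exact: lcont_cst|exact: prim_lcont].
  have lB : lint (fun t => J 0 t f * g t) by exact: lintMl.
  rewrite -(J_D _ lA lB (lexx 0)).
  by rewrite -J_Z//; apply: J_eq => t _; ring.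
rewrite [X in _ = _ + X](@J_eq _ _ (fun t => (G 0 * f t + F 0 * g t) + (f t * J 0 t g + J 0 t f * g t))); last first.
  by move=> t /andP[t0 _]; rewrite (FE t)// (GE t)//; ring.
have l1 : lint (fun t => G 0 * f t) by exact: lintZ.
have l2 : lint (fun t => F 0 * g t) by exact: lintZ.
have l3 : lint (fun t => f t * J 0 t g) by exact: lintM.
have l4 : lint (fun t => J 0 t f * g t) by exact: lintMl.
rewrite J_D//; [|exact: lintD|exact: lintD].
rewrite J_D// J_D// -E !J_Z// (FE x)// (GE x)//; ring.
Qed.

Lemma acX F f n : ac F f -> ac (fun x => F x ^+ n.+1) (fun x => n.+1%:R * F x ^+ n * f x).
Proof.
move=> aF; elim: n => [|n IH].
  by apply: ac_eq aF => x _; rewrite ?expr1 ?expr0; ring.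
by apply: ac_eq (acM aF IH) => x _; rewrite ?exprS //= -!natr1; ring.
Qed.

End ProductRule.

(** * Gronwall's inequality and linear systems with integrable coefficients *)

Section LinearSystems.
Context {R : realType}.
Local Notation mu := (@lebesgue_measure R).
Local Notation J a b f := (Rintegral mu `[a, b]%classic f).

Lemma J_dominated (f_ : nat -> R -> R) (f g : R -> R) (x : R) : 0 <= x ->
  (forall n, lint (f_ n)) -> lint g ->
  (forall n t, 0 <= t <= x -> `|f_ n t| <= g t) ->
  (forall t, 0 <= t <= x -> f_ n t @[n --> \oo] --> f t) ->
  mu.-integrable `[0, x] (EFin \o f) /\ J 0 x (f_ n) @[n --> \oo] --> J 0 x f.
Proof.
move=> x0 lf_ lg fg ff.
have mf_ n : measurable_fun (`[0, x] : set R) (EFin \o f_ n).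
  by apply: (measurable_int mu); exact: lintW.
have mf : measurable_fun (`[0, x] : set R) (EFin \o f).
  apply/measurable_EFinP.
  apply: (measurable_fun_cvg (h := fun n => f_ n)) => //.
    by move=> n; apply/measurable_EFinP.
have [] := @dominated_convergence _ _ _ mu `[0, x] (measurable_itv _) 
  (fun n => EFin \o f_ n) (EFin \o f) (EFin \o g) mf_ mf _ (lg x x0).
- apply: aeW => t /=; rewrite in_itv/= => tx.
  by apply/cvg_EFin; [exact: nearW|exact: ff].
- by apply: aeW => t /= n; rewrite in_itv/= => tx; rewrite lee_fin; exact: fg.
move=> i1 _; have <- : (J 0 x f)%:E = (\int[mu]_(x in `[0%R, x]) (EFin \o f) x)%E.
  by rewrite fineK//; exact: integrable_fin_num.
by move=> /fine_cvg c; split.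
Qed.

Lemma lint_sum (I : finType) (f : I -> R -> R) : (forall i, lint (f i)) ->
  lint (fun t => \sum_i f i t).
Proof.
move=> lf; elim: (index_enum I) => [|i s IH].
  by under eq_fun do rewrite big_nil; exact: lint_cst.
by under eq_fun do rewrite big_cons; exact: lintD.
Qed.

(** The primitive A of a satisfies (A^(k+1))' = (k+1) a A^k; hence k-fold iteration
    of the integral operator with kernel a yields the terms of the exponential
    series of A, which drives both Gronwall's inequality and Picard iteration. *)
Lemma J_pow (a : R -> R) k x : lint a -> 0 <= x ->
  J 0 x (fun t => a t * J 0 t a ^+ k) = J 0 x a ^+ k.+1 / k.+1%:R.
Proof.
move=> la x0; have cA := prim_lcont la.
have aA : ac (fun x => 0 + J 0 x a) a by exact: ac_prim.
have {}aA : ac (fun x => J 0 x a) a by apply: ac_eq aA => // t _; rewrite add0r.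
have [_ /(_ x x0)] := acX k aA.
rewrite J_pt expr0n /= add0r => ->.
have -> : J 0 x (fun x0 => k.+1%:R * J 0 x0 a ^+ k * a x0) =
    J 0 x (fun t => k.+1%:R * (a t * J 0 t a ^+ k)).
  by apply: J_eq => t _; ring.
rewrite J_Z//; last by apply: lintM => //; exact: lcontX.
by rewrite mulrC mulKf.
Qed.

Lemma exp_coeffS (z : R) k : exp_coeff z k.+1 = (z ^+ k.+1 / k.+1%:R) / k`!%:R.
Proof. by rewrite /exp_coeff/= factS natrM invfM mulrA. Qed.

Lemma J_exp_coeff (a : R -> R) k x : lint a -> 0 <= x ->
  J 0 x (fun t => a t * exp_coeff (J 0 t a) k) = exp_coeff (J 0 x a) k.+1.
Proof.
move=> la x0; rewrite exp_coeffS -J_pow//.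
have -> : J 0 x (fun t => a t * exp_coeff (J 0 t a) k) =
    J 0 x (fun t => (k`!%:R)^-1 * (a t * J 0 t a ^+ k)).
  by apply: J_eq => t _; rewrite /exp_coeff/=; ring.
rewrite J_Z//; first by rewrite mulrC.
by apply: lintM => //; apply: lcontX; exact: prim_lcont.
Qed.

Lemma lcont_exp_coeff (a : R -> R) k : lint a -> lcont (fun t => exp_coeff (J 0 t a) k).
Proof.
by move=> la; apply: lcontM; [apply: lcontX; exact: prim_lcont|exact: lcont_cst].
Qed.

(** Inserting the hypothesis n times into itself gives g times the n-th partial
    sum of the exponential series plus a remainder bounded by its n-th term. *)
Lemma gronwall (a y : R -> R) (g X : R) : lint a -> (forall t, 0 <= t -> 0 <= a t) -> lcont y ->
  0 <= X ->
  (forall x, 0 <= x <= X -> y x <= g + J 0 x (fun t => a t * y t)) ->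
  y X <= g * expR (J 0 X a).
Proof.
move=> la a0 cy X0 hy.
have [M M0 yM] := lcont_bounded cy X0.
have step n x : 0 <= x <= X ->
    y x <= g * series (exp_coeff (J 0 x a)) n + M * exp_coeff (J 0 x a) n.
  elim: n x => [|n IH] x xX.
    rewrite /series/= big_geq// mulr0 add0r /exp_coeff/= expr0 fact0 divr1 mulr1.
    by apply: le_trans (yM _ xX); exact: ler_norm.
  have /andP[x0 xX'] := xX.
  apply: (le_trans (hy _ xX)).
  have lE k : lint (fun t => a t * exp_coeff (J 0 t a) k).
    by apply: lintM => //; exact: lcont_exp_coeff.
  have lS : forall n, lint (fun t => a t * series (exp_coeff (J 0 t a)) n) /\
     J 0 x (fun t => a t * series (exp_coeff (J 0 t a)) n) =
     series (exp_coeff (J 0 x a)) n.+1 - 1.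
    elim=> [|m [IH1 IH2]].
      have -> : series (exp_coeff (J 0 x a)) 1 = 1.
        by rewrite /series/= big_nat1 /exp_coeff/= expr0 fact0 divr1.
      under eq_fun do rewrite /series/= big_geq// mulr0.
      by split; [exact: lint_cst|rewrite J_cst// mul0r subrr].
    under eq_fun do rewrite seriesSr/= mulrDr.
    split; first exact: lintD.
    by rewrite J_D// IH2 J_exp_coeff// [in RHS]seriesSr/=; ring.
  have [l1 e1] := lS n.
  rewrite -lerBrDl.
  have -> : g * series (exp_coeff (J 0 x a)) n.+1 + M * exp_coeff (J 0 x a) n.+1 - g
   = J 0 x (fun t => g * (a t * series (exp_coeff (J 0 t a)) n) + M * (a t * exp_coeff (J 0 t a) n)).
    rewrite J_D//; [|exact: lintZ|exact: lintZ].
    by rewrite !J_Z// e1 J_exp_coeff//; ring.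
  apply: J_le => //; first exact: lintM.
    by apply: lintD; exact: lintZ.
  move=> t /andP[t0 tx].
  have -> : g * (a t * series (exp_coeff (J 0 t a)) n) + M * (a t * exp_coeff (J 0 t a) n)
   = a t * (g * series (exp_coeff (J 0 t a)) n + M * exp_coeff (J 0 t a) n) by ring.
  by apply: ler_wpM2l; [exact: a0|apply: IH; rewrite t0 (le_trans tx)].
have c1 : g * series (exp_coeff (J 0 X a)) n + M * exp_coeff (J 0 X a) n @[n --> \oo]
    --> g * expR (J 0 X a) + M * 0.
  apply: cvgD; apply: cvgMr.
    exact: is_cvg_series_exp_coeff.
  exact: cvg_exp_coeff.
rewrite -[leRHS]addr0 -[X in _ + X](mulr0 M).
apply: (@ler_cvg_to _ _ _ _ (fun=> y X) _ _ _ (cvg_cst _) c1).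
by apply: nearW => n; apply: step; rewrite X0 lexx.
Qed.

(** Picard iteration: the increments e k are bounded on [0, X] by a constant times
    the k-th term of the exponential series of the primitive of a, the sum of the
    absolute values of all coefficients; the series of increments therefore
    converges, and dominated convergence passes to the limit in the integral
    equation. *)
Theorem linear_system_exists (I : finType) (A : I -> I -> R -> R) (b : I -> R -> R) (c : I -> R) :
  (forall i j, lint (A i j)) -> (forall i, lint (b i)) ->
  exists y : I -> R -> R, forall i,
    y i 0 = c i /\ ac (y i) (fun t => (\sum_j A i j t * y j t) + b i t).
Proof.
move=> lA lb.
pose a t := \sum_i \sum_j `|A i j t|.
have la : lint a by apply: lint_sum => i; apply: lint_sum => j; exact: lint_norm.
have a0 t : 0 <= a t by apply: sumr_ge0 => i _; exact: sumr_ge0.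
(* e k is the k-th increment of the iteration, S n its n-th approximation. *)
pose e := fix e k i x := if k is k'.+1 then J 0 x (fun t => \sum_j A i j t * e k' j t)
   else c i + J 0 x (b i).
have ce k i : lcont (e k i).
  elim: k i => [|k IH] i /=.
    by apply: lcontD; [exact: lcont_cst|exact: prim_lcont].
  by apply: prim_lcont; apply: lint_sum => j; exact: lintM.
have lAe k i : lint (fun t => \sum_j A i j t * e k j t).
  by apply: lint_sum => j; exact: lintM.
have rowle i t : \sum_j `|A i j t| <= a t.
  by rewrite /a [leRHS](bigD1 i)//= lerDl; apply: sumr_ge0 => ? _; exact: sumr_ge0.
have bnd X : 0 <= X -> exists2 B, 0 <= B & forall k i x, 0 <= x <= X ->
    `|e k i x| <= B * exp_coeff (J 0 x a) k.
  move=> X0.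
  have [B B0 e0B] : exists2 B, 0 <= B & forall i x, 0 <= x <= X -> `|e 0%N i x| <= B.
    have h i : exists M, 0 <= M /\ forall x, 0 <= x <= X -> `|e 0%N i x| <= M.
      by have [M M0 hM] := lcont_bounded (ce 0%N i) X0; exists M.
    have [M hM] := choice h.
    exists (\sum_i M i); first by apply: sumr_ge0 => i _; case: (hM i).
    move=> i x xX; rewrite (bigD1 i)//=; apply: ler_wpDr.
      by apply: sumr_ge0 => j _; case: (hM j).
    by case: (hM i) => _; exact.
  exists B => //; elim=> [|k IH] i x xX.
    by rewrite /exp_coeff /= expr0 fact0 divr1 mulr1; exact: e0B.
  have /andP[x0 xX'] := xX.
  rewrite -J_exp_coeff// -J_Z//; last by apply: lintM => //; exact: lcont_exp_coeff.
  apply: (le_trans (J_norm _ (lAe k i) (lexx 0))).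
  apply: J_le => //; first exact: lint_norm.
    by apply: lintZ; apply: lintM => //; exact: lcont_exp_coeff.
  move=> t /andP[t0 tx].
  apply: (le_trans (ler_norm_sum _ _ _)).
  apply: (@le_trans _ _ (\sum_j `|A i j t| * (B * exp_coeff (J 0 t a) k))).
    apply: ler_sum => j _; rewrite normrM ler_wpM2l//; apply: IH.
    by rewrite t0 (le_trans tx).
  rewrite -mulr_suml [leRHS]mulrCA ler_wpM2r//.
  by apply: mulr_ge0 => //; apply: exp_coeff_ge0; exact: J_ge0.
pose S n i x := \sum_(0 <= k < n) e k i x.
have cS n i : lcont (S n i).
  elim: n => [|n IH]; first by rewrite /S; under eq_fun do rewrite big_geq//; exact: lcont_cst.
  by rewrite /S; under eq_fun do rewrite big_nat_recr//=; exact: lcontD.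
have SE n i x : 0 <= x -> S n.+1 i x = e 0%N i x + J 0 x (fun t => \sum_j A i j t * S n j t).
  move=> x0; elim: n => [|n IH].
    rewrite /S big_nat1; rewrite (@J_eq _ _ (fun=> 0)).
      by rewrite J_cst// mul0r addr0.
    by move=> t _; rewrite big1// => j _; rewrite big_geq// mulr0.
  rewrite /S big_nat_recr//= -/(S n.+1 i x) IH -addrA; congr (_ + _).
  rewrite -J_D//; last by apply: lint_sum => j; exact: lintM.
  apply: J_eq => t _; rewrite -big_split/=; apply: eq_bigr => j _.
  by rewrite -mulrDr /S big_nat_recr.
pose y i x := limn (fun n => S n i x).
have cvS i x : 0 <= x -> S n i x @[n --> \oo] --> y i x.
  move=> x0; have [B B0 hB] := bnd x x0.
  suff : cvgn (series (fun k => e k i x)) by [].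
  apply: normed_cvg; apply: (@series_le_cvg _ _ (fun k => B * exp_coeff (J 0 x a) k)) => //.
  - by move=> k; exact: normr_ge0.
  - by move=> k /=; apply: mulr_ge0 => //; apply: exp_coeff_ge0; exact: J_ge0.
  - by move=> k; apply: hB; rewrite x0 lexx.
  - exact: (@is_cvg_seriesZ _ (exp_coeff (J 0 x a)) B (is_cvg_series_exp_coeff _)).
have Sbnd X : 0 <= X -> exists2 C, 0 <= C & forall n i x, 0 <= x <= X -> `|S n i x| <= C.
  move=> X0; have [B B0 hB] := bnd X X0.
  exists (B * expR (J 0 X a)); first by rewrite mulr_ge0// expR_ge0.
  move=> n i x /[dup] xX /andP[x0 xX'].
  apply: (le_trans (ler_norm_sum _ _ _)).
  apply: (@le_trans _ _ (\sum_(0 <= k < n) B * exp_coeff (J 0 x a) k)).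
    by apply: ler_sum => k _; exact: hB.
  rewrite -mulr_sumr ler_wpM2l//.
  apply: (@le_trans _ _ (expR (J 0 x a))); last first.
    by rewrite ler_expR; apply: J_mono.
  apply: (nondecreasing_cvgn_le _ (is_cvg_series_exp_coeff (J 0 x a)) n).
  apply: nondecreasing_series => k _ _; apply: exp_coeff_ge0; exact: J_ge0.
exists y => i.
have main x : 0 <= x -> mu.-integrable `[0, x] (EFin \o (fun t => \sum_j A i j t * y j t)) /\
    J 0 x (fun t => \sum_j A i j t * S n j t) @[n --> \oo] --> J 0 x (fun t => \sum_j A i j t * y j t).
  move=> x0; have [C C0 hC] := Sbnd x x0.
  apply: (@J_dominated _ _ (fun t => a t * C)) => //.
  - by move=> n; apply: lint_sum => j; exact: lintM.
  - by apply: lintM => //; exact: lcont_cst.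
  - move=> n t tx; apply: (le_trans (ler_norm_sum _ _ _)).
    apply: (@le_trans _ _ (\sum_j `|A i j t| * C)).
      by apply: ler_sum => j _; rewrite normrM ler_wpM2l//; exact: hC.
    by rewrite -mulr_suml ler_wpM2r.
  - move=> t /andP[t0 _]; apply: cvg_big => //; first by move=> ?; exact: add_continuous.
    by move=> j _; apply: cvgMr; exact: cvS.
have lAy : lint (fun t => \sum_j A i j t * y j t) by move=> x /main[].
have yE x : 0 <= x -> y i x = e 0%N i x + J 0 x (fun t => \sum_j A i j t * y j t).
  move=> x0; have c1 := cvS i x x0; have [_ c2] := main x x0.
  have {}c1 : S n.+1 i x @[n --> \oo] --> y i x.
    by have -> := cvg_shiftS (fun n => S n i x) (nbhs (y i x)).
  have c3 : S n.+1 i x @[n --> \oo] --> e 0%N i x + J 0 x (fun t => \sum_j A i j t * y j t).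
    by under eq_fun do rewrite SE//; apply: cvgD => //; exact: cvg_cst.
  by rewrite -(cvg_lim _ c1)// (cvg_lim _ c3).
have y0 : y i 0 = c i by rewrite yE// J_pt addr0 /= J_pt addr0.
split => //; split; first exact: lintD.
by move=> x x0; rewrite y0 J_D// yE//=; ring.
Qed.

End LinearSystems.

(** * Potentials that are uniformly locally integrable *)

Section UnitIntervals.
Context {R : realType}.
Local Notation mu := (@lebesgue_measure R).
Local Notation J a b f := (Rintegral mu `[a, b]%classic f).
Implicit Types (f g V : R -> R).

Definition uniformly_bounded_by V (M : R) :=
  0 <= M /\ forall x, 0 <= x -> J x (x + 1) (fun t => `|V t|) <= M.

Definition decaying V := forall d, 0 < d -> exists2 X : R, 0 <= X &
  forall x, X <= x -> J x (x + 1) (fun t => `|V t|) <= d.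

Lemma uniformly_bounded_by_shift V (M E F : R) : lint V -> uniformly_bounded_by V M ->
  `|E| <= F -> uniformly_bounded_by (fun t => V t - E) (M + F).
Proof.
move=> lV [M0 VM] EF; have F0 : 0 <= F by exact: le_trans EF.
have lVn := lint_norm lV; split=> [|x x0]; first exact: addr_ge0.
apply: (@le_trans _ _ (J x (x + 1) (fun t => `|V t| + F))).
  apply: J_le => //.
  - by apply: lint_norm; apply: lintB => //; exact: lint_cst.
  - by apply: lintD => //; exact: lint_cst.
  - by move=> t _; apply: (le_trans (ler_normB _ _)); rewrite lerD2l.
rewrite J_D//; last exact: lint_cst.
rewrite J_cst ?lerDl//.
have -> : F * (x + 1 - x) = F by ring.
by rewrite lerD2r VM.
Qed.

Lemma J_unit_le f g (X : R) n : lint f -> lint g -> 0 <= X ->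
  (forall x, X <= x -> J x (x + 1) f <= J x (x + 1) g) -> J X (X + n%:R) f <= J X (X + n%:R) g.
Proof.
move=> lf lg X0 fg; elim: n => [|n IH]; first by rewrite addr0 !J_pt.
have Xn : X <= X + n%:R by rewrite lerDl.
have XS : X + n%:R <= X + n%:R + 1 by rewrite lerDl.
rewrite -natr1 addrA (J_cat lf X0 Xn XS) (J_cat lg X0 Xn XS).
by apply: lerD => //; exact: fg.
Qed.

Lemma J_unit_bound g (d a : R) n : lint g -> 0 <= a ->
  (forall x, a <= x -> J x (x + 1) g <= d) -> J a (a + n%:R) g <= n%:R * d.
Proof.
move=> lg a0 gd.
have -> : n%:R * d = J a (a + n%:R) (fun=> d).
  by rewrite J_cst ?lerDl//; ring.
apply: J_unit_le => //; first exact: lint_cst.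
move=> x ax; rewrite J_cst ?lerDl//.
have -> : d * (x + 1 - x) = d by ring.
exact: gd.
Qed.

End UnitIntervals.

(** * The equation u'' = q u - h *)

Section ScalarEquation.
Context {R : realType}.
Local Notation mu := (@lebesgue_measure R).
Local Notation J a b f := (Rintegral mu `[a, b]%classic f).
Implicit Types (q h u v : R -> R).

Definition solves q h u u1 := ac u u1 /\ ac u1 (fun t => q t * u t - h t).

Lemma wronskian_ac q1 q2 h1 h2 u u1 v v1 : solves q1 h1 u u1 -> solves q2 h2 v v1 ->
  ac (fun t => u1 t * v t - u t * v1 t)
     (fun t => (q1 t - q2 t) * (u t * v t) - h1 t * v t + h2 t * u t).
Proof.
move=> [uu1 u1u2] [vv1 v1v2].
by apply: ac_eq (acB (acM u1u2 vv1) (acM uu1 v1v2)) => // t _; ring.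
Qed.

Lemma energy_ac q h u u1 : solves q h u u1 ->
  ac (fun t => u t * u1 t) (fun t => u1 t ^+ 2 + u t * (q t * u t - h t)).
Proof.
move=> [uu1 u1u2].
by apply: ac_eq (acM uu1 u1u2) => // t _; ring.
Qed.

Lemma solves_lin q h g u u1 v v1 c : solves q h u u1 -> solves q g v v1 ->
  solves q (fun t => h t - c * g t) (fun t => u t - c * v t) (fun t => u1 t - c * v1 t).
Proof.
move=> [uu1 u1u2] [vv1 v1v2]; split; first by apply: acB => //; exact: acZ.
by apply: ac_eq (acB u1u2 (acZ c v1v2)) => // t _; ring.
Qed.

Lemma solves_eq q q' h h' u u' u1 u1' :
  (forall t, 0 <= t -> q t * u t - h t = q' t * u' t - h' t) ->
  (forall t, 0 <= t -> u t = u' t) -> (forall t, 0 <= t -> u1 t = u1' t) ->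
  solves q h u u1 -> solves q' h' u' u1'.
Proof. by move=> E1 E2 E3 [h1 h2]; split; [apply: ac_eq h1|apply: ac_eq h2]. Qed.

Lemma J_cauchy_schwarz h a b : lint h -> lint (fun t => h t ^+ 2) -> 0 <= a -> a <= b ->
  (J a b (fun t => `|h t|)) ^+ 2 <= (b - a) * J a b (fun t => h t ^+ 2).
Proof.
move=> lh lh2 a0; rewrite le_eqVlt => /predU1P[->|ab].
  by rewrite !J_pt expr0n/= mulr0.
have ba : 0 < b - a by rewrite subr_gt0.
set H := J a b _; set S := J a b _.
have lnh := lint_norm lh.
(* Integrate 2 c |h| <= h^2 + c^2 with c the mean of |h|. *)
pose c := H / (b - a).
have : J a b (fun t => 2 * c * `|h t|) <= J a b (fun t => h t ^+ 2 + c ^+ 2).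
  apply: J_le => //; [exact: lintZ|by apply: lintD => //; exact: lint_cst|].
  move=> t _; rewrite -(real_normK (num_real (h t))).
  by have := sqr_ge0 (`|h t| - c); nra.
rewrite J_Z// J_D//; last exact: lint_cst.
rewrite J_cst ?(ltW ab)// -/H -/S => E.
have cE : c * (b - a) = H by rewrite /c mulfVK ?gt_eqF.
by move: E; nra.
Qed.

(** On a unit interval a solution and its derivative are controlled by the L^2 norms
    of u and h alone, with a constant that depends on q only through a bound of
    the integral of |q|; no smallness of q is used. Let m be the maximum of |u|,
    attained at ts. The equation bounds the oscillation of u' by Q m plus the
    mean of |h|, hence u' itself by L = (2 + Q) m plus that mean. So u stays close
    to its maximum on an interval of length e ~ 1 / (2 + Q) next to ts, and e m^2
    is at most a multiple of the integral of u^2 plus a contribution of h. *)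
Lemma local_estimate q h u u1 x Q : 0 <= x -> 0 <= Q ->
  lint q -> lint h -> lint (fun t => h t ^+ 2) -> solves q h u u1 ->
  J x (x + 1) (fun t => `|q t|) <= Q ->
  forall t, x <= t <= x + 1 ->
    u t ^+ 2 <= 23 * (2 + Q) ^+ 3 *
       (J x (x + 1) (fun t => u t ^+ 2) + J x (x + 1) (fun t => h t ^+ 2)) /\
    u1 t ^+ 2 <= 23 * (2 + Q) ^+ 3 *
       (J x (x + 1) (fun t => u t ^+ 2) + J x (x + 1) (fun t => h t ^+ 2)).
Proof.
move=> x0 Q0 lq lh lh2 [uu1 u1u2] qQ.
have x1 : x <= x + 1 by rewrite lerDl.
have x10 : 0 <= x + 1 by rewrite addr_ge0.
have cu := ac_lcont uu1; have cu1 := ac_lcont u1u2.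
have lu2 : lint (fun t => u t ^+ 2) by apply: lcont_lint; exact: lcontX.
set F := J x (x + 1) (fun t => u t ^+ 2); set S := J x (x + 1) (fun t => h t ^+ 2).
have F0 : 0 <= F by apply: J_ge0 => t _; exact: sqr_ge0.
have S0 : 0 <= S by apply: J_ge0 => t _; exact: sqr_ge0.
have [ts tsx umax] : exists2 ts, x <= ts <= x + 1 &
    forall t, x <= t <= x + 1 -> `|u t| <= `|u ts|.
  have cw : {within `[x, x + 1], continuous (fun t => `|u t|)}.
    apply: continuous_subspaceW (lcont_norm cu x10).
    by apply: subset_itvr; rewrite bnd_simp.
  have [c cx cmax] := EVT_max x1 cw.
  by exists c => [|t tx]; [rewrite in_itv in cx|apply: cmax; rewrite in_itv].
set m := `|u ts| in umax.
have m0 : 0 <= m by exact: normr_ge0.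
pose Hh := J x (x + 1) (fun t => `|h t|).
have Hh0 : 0 <= Hh by exact: J_ge0.
have HhS : Hh ^+ 2 <= S.
  by have := J_cauchy_schwarz lh lh2 x0 x1; rewrite -/Hh -/S (addrC x) addrK mul1r.
pose D := J x (x + 1) (fun t => `|q t * u t - h t|).
have lqu : lint (fun t => q t * u t - h t) := ac_lint u1u2.
have DQ : D <= Q * m + Hh.
  apply: (@le_trans _ _ (J x (x + 1) (fun t => m * `|q t| + `|h t|))).
    apply: J_le => //; first exact: lint_norm.
      by apply: lintD; [apply: lintZ|]; exact: lint_norm.
    move=> t tx; apply: (le_trans (ler_normB _ _)); rewrite lerD2r normrM mulrC.
    by rewrite ler_wpM2r// umax.
  rewrite J_D//; [|by apply: lintZ; exact: lint_norm|exact: lint_norm].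
  by rewrite J_Z ?lerD2r 1?mulrC ?ler_wpM2r//; exact: lint_norm.
have osc s t : x <= s -> s <= t -> t <= x + 1 -> `|u1 t - u1 s| <= D.
  move=> xs st tx; have s0 := le_trans x0 xs.
  rewrite (ac_J u1u2)//; apply: (le_trans (J_norm _ lqu s0)).
  by apply: J_sub => //; exact: lint_norm.
have oscs s t : x <= s <= x + 1 -> x <= t <= x + 1 -> `|u1 s - u1 t| <= D.
  move=> /andP[xs sx] /andP[xt tx]; have [st|ts'] := leP s t.
    by rewrite distrC osc.
  by rewrite osc// ltW.
pose B := 2 + Q; pose L := B * m + Hh.
have u1L s : x <= s <= x + 1 -> `|u1 s| <= L.
  move=> sx.
  have E : u1 s - (u (x + 1) - u x) = J x (x + 1) (fun t => u1 s - u1 t).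
    rewrite J_B//; [|exact: lint_cst|exact: lcont_lint].
    by rewrite J_cst// (ac_J uu1)// (addrC x) addrK mulr1.
  have : `|u1 s - (u (x + 1) - u x)| <= D.
    rewrite E; apply: le_trans (J_norm _ _ x0) _.
      by apply: lintB; [exact: lint_cst|exact: lcont_lint].
    have -> : D = D * (x + 1 - x) by rewrite (addrC x) addrK mulr1.
    apply: J_bound => //; last by move=> t tx; exact: oscs.
    by apply: lint_norm; apply: lintB; [exact: lint_cst|exact: lcont_lint].
  have := umax x; have := umax (x + 1); rewrite !lexx x1/= => /(_ isT) a1 /(_ isT) a2 a3.
  have := ler_normD (u1 s - (u (x + 1) - u x)) (u (x + 1) - u x); rewrite subrK => a4.
  have a5 := ler_normB (u (x + 1)) (u x).
  by rewrite /L /B; move: a1 a2 a3 a4 a5 DQ; clear; lra.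
have lip s t : x <= s -> s <= t -> t <= x + 1 -> `|u t - u s| <= L * (t - s).
  move=> xs st tx; have s0 := le_trans x0 xs.
  rewrite (ac_J uu1)//; apply: (le_trans (J_norm _ (ac_lint uu1) s0)).
  apply: J_bound => //; first by apply: lint_norm; exact: ac_lint uu1.
  by move=> r /andP[sr rt]; apply: u1L; rewrite (le_trans xs)// (le_trans rt).
pose e := (4 * B)^-1.
have B2 : 2 <= B by rewrite /B lerDl.
have B0 : 0 < B by lra.
have e0 : 0 < e by rewrite invr_gt0 mulr_gt0.
have eB : e * B = 4^-1 by rewrite /e invfM mulfVK// gt_eqF.
have e8 : e <= 8^-1 by nra.
have L0 : 0 <= L by rewrite /L addr_ge0// mulr_ge0// ltW.
(* [p, p + e] is an interval of length e inside [x, x + 1] that contains ts. *)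
have key p : x <= p -> p + e <= x + 1 -> p <= ts <= p + e ->
    e * m ^+ 2 <= 2 * F + 2 * L ^+ 2 * e ^+ 2 * e.
  move=> xp px /andP[pt tp]; have p0 := le_trans x0 xp.
  have pe : p <= p + e by rewrite lerDl ltW.
  have : J p (p + e) (fun=> m ^+ 2) <= J p (p + e) (fun t => 2 * u t ^+ 2 + 2 * L ^+ 2 * e ^+ 2).
    apply: J_le => //; first exact: lint_cst.
      by apply: lintD; [exact: lintZ|exact: lint_cst].
    move=> t /andP[pt' tp'].
    have : `|u t - u ts| <= L * e.
      have [tts|tts] := leP t ts.
        rewrite distrC; apply: (le_trans (lip t ts _ _ _)) => //.
        - exact: le_trans pt'.
        - by case/andP: tsx.
        - by rewrite ler_wpM2l//; move: pt' tp; clear; lra.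
      apply: (le_trans (lip ts t _ _ _)) => //.
      - by case/andP: tsx.
      - exact: ltW.
      - exact: le_trans px.
      - by rewrite ler_wpM2l//; move: tp' pt; clear; lra.
    move=> d1.
    have d2 : m <= `|u t| + L * e.
      rewrite /m; have := ler_normB (u t) (u t - u ts).
      by rewrite opprB addrC subrK; move: d1; clear; lra.
    rewrite -(real_normK (num_real (u t))).
    have : m ^+ 2 <= (`|u t| + L * e) ^+ 2.
      by rewrite ler_sqr ?nnegrE// addr_ge0// mulr_ge0// ltW.
    by move: (sqr_ge0 (`|u t| - L * e)); clear; nra.
  rewrite J_cst// J_D//; [|exact: lintZ|exact: lint_cst].
  have pE : p + e - p = e by ring.
  rewrite J_cst// J_Z// pE => E.
  have : J p (p + e) (fun t => u t ^+ 2) <= F.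
    by apply: J_sub => // t _; exact: sqr_ge0.
  by move: E; clear; lra.
have {}key : e * m ^+ 2 <= 2 * F + 2 * L ^+ 2 * e ^+ 2 * e.
  move/andP: tsx => [xts tsx].
  have [th|th] := leP ts (x + 1 / 2).
    by apply: (key ts) => //; [move: th e8; clear; lra|rewrite lexx lerDl ltW].
  by apply: (key (ts - e)); [move: th e8; clear; lra|rewrite subrK|rewrite subrK lexx andbT gerBl ltW].
have L2 : L ^+ 2 <= 2 * B ^+ 2 * m ^+ 2 + 2 * S.
  have -> : L ^+ 2 = (B * m + Hh) ^+ 2 by [].
  have := sqr_ge0 (B * m - Hh); nra.
have m2 : m ^+ 2 <= 11 * B * (F + S).
  have k2 : m ^+ 2 <= 8 * B * F + 2 * L ^+ 2 * e ^+ 2.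
    rewrite -(ler_pM2l e0); apply: (le_trans key).
    have -> : e * (8 * B * F + 2 * L ^+ 2 * e ^+ 2) = 8 * (e * B) * F + 2 * L ^+ 2 * e ^+ 2 * e by ring.
    by rewrite eB; clear; lra.
  have k3 : 2 * L ^+ 2 * e ^+ 2 <= 4^-1 * m ^+ 2 + S.
    have -> : 2 * L ^+ 2 * e ^+ 2 = 2 * e ^+ 2 * L ^+ 2 by ring.
    have h1 : 2 * e ^+ 2 * L ^+ 2 <= 2 * e ^+ 2 * (2 * B ^+ 2 * m ^+ 2 + 2 * S).
      by rewrite ler_wpM2l// mulr_ge0// sqr_ge0.
    have h2 : 2 * e ^+ 2 * (2 * B ^+ 2 * m ^+ 2 + 2 * S) = 4 * (e * B) ^+ 2 * m ^+ 2 + 4 * e ^+ 2 * S by ring.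
    move: h1; rewrite h2 eB => h1; apply: (le_trans h1).
    have h3 : 4 * e ^+ 2 * S <= S by rewrite ler_piMl//; move: e0 e8; clear; nra.
    by move: h3 (sqr_ge0 m); clear; lra.
  by move: k2 k3 B2 F0 S0; clear; nra.
have FS : 0 <= F + S by rewrite addr_ge0.
move=> t tx; split; rewrite -(real_normK (num_real _)).
  have : `|u t| ^+ 2 <= m ^+ 2 by rewrite ler_sqr ?nnegrE// umax.
  move=> h1; apply: (le_trans h1); apply: (le_trans m2); rewrite ler_wpM2r//.
  by rewrite -/B; move: B2; clear; nra.
have h1 : `|u1 t| ^+ 2 <= L ^+ 2 by rewrite ler_sqr ?nnegrE// u1L.
apply: (le_trans h1); apply: (le_trans L2).
have h2 : 2 * B ^+ 2 * m ^+ 2 <= 2 * B ^+ 2 * (11 * B * (F + S)).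
  by rewrite ler_wpM2l// mulr_ge0// sqr_ge0.
have h3 : 2 * S <= B ^+ 3 * (F + S).
  have b3 : 2 <= B ^+ 3 by rewrite !exprS expr0 mulr1; move: B2; clear; nra.
  by move: b3 F0 S0; clear; nra.
have -> : 23 * (2 + Q) ^+ 3 * (F + S) = 2 * B ^+ 2 * (11 * B * (F + S)) + B ^+ 3 * (F + S).
  by rewrite /B; ring.
exact: lerD.
Qed.

(** Gronwall's inequality for |d| + |d'|; the case h = 0 is uniqueness for the
    initial value problem, and h = (E' - E) phi gives continuity in the energy. *)
Lemma gronwall_sol q h d d1 X : lint q -> lint h -> solves q h d d1 ->
  d 0 = 0 -> d1 0 = 0 -> 0 <= X ->
  `|d X| + `|d1 X| <= J 0 X (fun t => `|h t|) * expR (J 0 X (fun t => 1 + `|q t|)).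
Proof.
move=> lq lh [dd1 d1d2] d0 d10 X0.
have cd := ac_lcont dd1; have cd1 := ac_lcont d1d2.
have lnq := lint_norm lq; have lnh := lint_norm lh.
have ld1 := lcont_lint cd1.
have la : lint (fun t => 1 + `|q t|) by apply: lintD => //; exact: lint_cst.
have cy : lcont (fun t => `|d t| + `|d1 t|) by apply: lcontD; exact: lcont_norm.
apply: (gronwall la _ cy X0) => [t _|x /andP[x0 xX]]; first by rewrite addr_ge0.
have [_ /(_ x x0)] := dd1; rewrite d0 add0r => dE.
have [ld2 /(_ x x0)] := d1d2; rewrite d10 add0r => d1E.
have lay : lint (fun t => (1 + `|q t|) * (`|d t| + `|d1 t|)) by exact: lintM.
apply: (@le_trans _ _ (J 0 x (fun t => `|h t|) + J 0 x (fun t => (1 + `|q t|) * (`|d t| + `|d1 t|)))); last first.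
  by rewrite lerD2r; apply: J_mono.
rewrite dE d1E; apply: (le_trans (lerD (J_norm _ ld1 (lexx 0)) (J_norm _ ld2 (lexx 0)))).
rewrite -!J_D//; [|exact: lint_norm|exact: lint_norm].
apply: J_le => //; [by apply: lintD; exact: lint_norm|exact: lintD|].
move=> t _; have := ler_normB (q t * d t) (h t); rewrite normrM.
have p1 : 0 <= `|d t| by []. have p2 : 0 <= `|d1 t| by []. have p3 : 0 <= `|q t| by [].
by nra.
Qed.

(** The real and imaginary parts u and v of a solution of
    - f'' + V f = (a + b i) f + h with f 0 = 0 and f' 0 = c. *)
Lemma ivp_exists V h1 h2 a b c : lint V -> lint h1 -> lint h2 ->
  exists u u1 v v1 : R -> R, [/\ u 0 = 0, v 0 = 0, u1 0 = c, v1 0 = 0 &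
    solves (fun t => V t - a) (fun t => h1 t - b * v t) u u1 /\
    solves (fun t => V t - a) (fun t => h2 t + b * u t) v v1].
Proof.
move=> lV lh1 lh2.
have lq : lint (fun t => V t - a) by apply: lintB => //; exact: lint_cst.
(* The unknowns u, u', v, v' are indexed by (false, false), (false, true),
   (true, false), (true, true). *)
pose A (i j : bool * bool) : R -> R :=
  if i.2 then if j.2 then fun=> 0 else
    if i.1 == j.1 then (fun t => V t - a) else fun=> (if i.1 then - b else b)
  else fun=> ((i.1 == j.1) && j.2)%:R.
pose s (i : bool * bool) : R -> R :=
  if i.2 then (if i.1 then (fun t => - h2 t) else (fun t => - h1 t)) else fun=> 0.
have lA i j : lint (A i j).
  by rewrite /A; case: i j => [[] []] [[] []] //=; exact: lint_cst.
have ls i : lint (s i).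
  by case: i => [[] []]; rewrite /s/=; [exact: lintN|exact: lint_cst|exact: lintN|exact: lint_cst].
have [y hy] := linear_system_exists (fun i => if i == (false, true) then c else 0) lA ls.
have sum4 (G : bool * bool -> R) : \sum_j G j =
    G (true, true) + G (true, false) + (G (false, true) + G (false, false)).
  transitivity (\sum_(p : bool * bool) G (p.1, p.2)); first by apply: eq_bigr => -[].
  by rewrite -(pair_bigA _ (fun x y => G (x, y)))/= big_bool/= !big_bool.
exists (y (false, false)), (y (false, true)), (y (true, false)), (y (true, true)).
have [y1 a1] := hy (false, false); have [y2 a2] := hy (false, true).
have [y3 a3] := hy (true, false); have [y4 a4] := hy (true, true).
split => //; split; split.
- by apply: ac_eq a1 => // t _; rewrite sum4 /A/s/=; ring.
- by apply: ac_eq a2 => // t _; rewrite sum4 /A/s/=; ring.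
- by apply: ac_eq a3 => // t _; rewrite sum4 /A/s/=; ring.
- by apply: ac_eq a4 => // t _; rewrite sum4 /A/s/=; ring.
Qed.

End ScalarEquation.

(** * The operator in terms of real functions *)

Section Translation.
Context {R : realType}.
Local Notation mu := (@lebesgue_measure R).
Local Notation J a b f := (Rintegral mu `[a, b]%classic f).
Local Notation Re := (@complex.Re R).
Local Notation Im := (@complex.Im R).
Local Notation halfline := (`]0%R, +oo[%classic : set R).
Implicit Types (g h : R -> R) (f : R -> R[i]).

Lemma halfline_measurable g : measurable_fun halfline g ->
  measurable_fun (`[0, +oo[%classic : set R) g.
Proof. by move=> /measurable_fun_itv_obnd_cbndP. Qed.

Lemma halfline_measurable_seg g b : measurable_fun halfline g ->
  measurable_fun (`[0, b]%classic : set R) g.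
Proof.
move=> /halfline_measurable; apply: measurable_funS => //.
by apply: subset_itvl.
Qed.

Lemma lint_halfline_measurable g : lint g -> measurable_fun halfline g.
Proof.
move=> lg; apply: (@measurable_funS _ _ _ _ (`[0, +oo[%classic : set R)) => //.
  by apply: subset_itvr; rewrite bnd_simp.
rewrite itv_bndy_bigcup_BRight; apply/measurable_fun_bigcup => // n.
by rewrite add0r; exact: lint_meas.
Qed.

Lemma nat_above (x : R) : exists n : nat, x <= n%:R.
Proof.
have [x0|x0] := leP 0 x; last by exists 0%N; rewrite ltW.
by exists (Num.truncn x).+1; rewrite ltW// truncnS_gt.
Qed.

(** Integrals over the half-line are limits of integrals over [0, n], so that L^2
    norms only enter through bounds that are uniform in n. *)
Lemma ge0_halfline_integral g C : (forall t, 0 <= g t) -> lint g ->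
  (\int[mu]_(t in halfline) (g t)%:E <= C%:E)%E <-> forall n : nat, J 0 n%:R g <= C.
Proof.
move=> g0 lg; have mg := lint_halfline_measurable lg.
rewrite integral_itv_obnd_cbnd; last exact/measurable_EFinP.
have mg0 := halfline_measurable mg.
split=> [gC n|gC].
  rewrite -lee_fin -J_EFin//; apply: le_trans gC; apply: ge0_subset_integral => //.
  - exact/measurable_EFinP.
  - by move=> t _; rewrite lee_fin.
  - exact: subset_itvl.
rewrite itv_bndy_bigcup_BRight.
have c : (\int[mu]_(t in [set` Interval (BLeft 0%R) (BRight (0%R + n%:R)%R)]) (g t)%:E
   @[n --> \oo] --> \int[mu]_(t in \bigcup_n [set` Interval (BLeft 0%R) (BRight (0%R + n%:R)%R)]) (g t)%:E)%E.
  apply: ge0_nondecreasing_set_cvg_integral.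
  - move=> m n mn; rewrite subsetEset; apply: subset_itvl.
    by rewrite bnd_simp lerD2l ler_nat.
  - by move=> i; exact: measurable_itv.
  - by move=> i; rewrite add0r; apply/measurable_EFinP; exact: lint_meas.
  - by move=> i x _; rewrite lee_fin.
apply: (cvge_to_le c); apply: nearW => n; rewrite add0r J_EFin// lee_fin; exact: gC.
Qed.

Lemma lint_of_halfline g : (forall t, 0 <= g t) -> measurable_fun halfline g ->
  (\int[mu]_(t in halfline) (g t)%:E < +oo)%E -> lint g.
Proof.
move=> g0 mg goo b b0; apply/integrableP; split.
  by apply/measurable_EFinP; exact: halfline_measurable_seg.
apply: le_lt_trans goo; rewrite integral_itv_obnd_cbnd; last exact/measurable_EFinP.
under eq_integral do rewrite /= ger0_norm//.
apply: ge0_subset_integral => //.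
- by apply/measurable_EFinP; exact: halfline_measurable.
- by move=> t _; rewrite lee_fin.
- exact: subset_itvl.
Qed.

Lemma lint_of_sq g : measurable_fun halfline g -> lint (fun t => g t ^+ 2) -> lint g.
Proof.
move=> mg lg2 b b0.
have l1 : lint (fun t => 1 + g t ^+ 2) by apply: lintD => //; exact: lint_cst.
apply: (le_integrable _ _ _ (l1 b b0)) => //.
  by apply/measurable_EFinP; exact: halfline_measurable_seg.
move=> t _ /=; rewrite lee_fin [leRHS]ger0_norm ?addr_ge0// ?sqr_ge0//.
rewrite -(real_normK (num_real (g t))).
by have := sqr_ge0 (`|g t| - 1); have : 0 <= `|g t| by []; nra.
Qed.

Lemma lint_of_sq_le g k : (forall t, 0 <= k t) -> measurable_fun halfline g -> lint k ->
  (forall t, g t ^+ 2 <= k t) -> lint (fun t => g t ^+ 2).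
Proof.
move=> k0 mg lk gk b b0; apply: (le_integrable _ _ _ (lk b b0)) => //.
  apply/measurable_EFinP; apply: halfline_measurable_seg; exact: measurable_funX.
by move=> t _ /=; rewrite lee_fin !ger0_norm ?sqr_ge0.
Qed.

Definition modsq f : R -> R := fun t => Re (f t) ^+ 2 + Im (f t) ^+ 2.

Definition L2loc f := [/\ lint (Re \o f), lint (Im \o f),
  lint (fun t => Re (f t) ^+ 2) & lint (fun t => Im (f t) ^+ 2)].

Lemma modsq_ge0 f t : 0 <= modsq f t.
Proof. by rewrite addr_ge0// sqr_ge0. Qed.

Lemma normc_modsq f t : Normc.normc (f t) ^+ 2 = modsq f t.
Proof. by rewrite /modsq /Normc.normc; case: (f t) => a b /=; rewrite sqr_sqrtr// addr_ge0// sqr_ge0. Qed.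

Lemma normc2_integralE f :
  normc2_integral f = (\int[mu]_(t in halfline) (modsq f t)%:E)%E.
Proof. by apply: eq_integral => t _; rewrite normc_modsq. Qed.

Lemma L2loc_modsq f : L2loc f -> lint (modsq f).
Proof. by case=> _ _ l1 l2; exact: lintD. Qed.

Lemma normc2P f C : L2loc f ->
  (normc2_integral f <= C%:E)%E <-> forall n : nat, J 0 n%:R (modsq f) <= C.
Proof.
move=> lf; rewrite normc2_integralE; apply: ge0_halfline_integral; last exact: L2loc_modsq.
exact: modsq_ge0.
Qed.

Lemma L2P f : L2_halfline f <->
  L2loc f /\ exists C, forall n : nat, J 0 n%:R (modsq f) <= C.
Proof.
split=> [[mRe mIm foo]|[lf [C fC]]].
  have lm : lint (modsq f).
    apply: lint_of_halfline; [exact: modsq_ge0| |by rewrite -normc2_integralE].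
    by apply: measurable_funD; exact: measurable_funX.
  have lRe : lint (fun t => Re (f t) ^+ 2).
    apply: (lint_of_sq_le (@modsq_ge0 f) mRe lm) => t.
    by rewrite /modsq lerDl sqr_ge0.
  have lIm : lint (fun t => Im (f t) ^+ 2).
    apply: (lint_of_sq_le (@modsq_ge0 f) mIm lm) => t.
    by rewrite /modsq lerDr sqr_ge0.
  have lf : L2loc f by split => //; exact: lint_of_sq.
  split=> //; exists (fine (normc2_integral f)).
  apply/(normc2P _ lf); rewrite fineK// ge0_fin_numE//.
  by rewrite normc2_integralE; apply: integral_ge0 => t _; rewrite lee_fin modsq_ge0.
have [l1 l2 _ _] := lf.
split; [exact: lint_halfline_measurable|exact: lint_halfline_measurable|].
by apply: (@le_lt_trans _ _ C%:E); [apply/normc2P|rewrite ltry].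
Qed.

Lemma weak_derivativeP f (g : R -> R[i]) : weak_derivative f g <->
  ac (Re \o f) (Re \o g) /\ ac (Im \o f) (Im \o g).
Proof.
split=> [[lg fE]|[[lr rE] [li iE]]].
  split; split.
  - by move=> b /lg[].
  - by move=> x x0; rewrite /= (fE x x0); case: (f 0).
  - by move=> b /lg[].
  - by move=> x x0; rewrite /= (fE x x0); case: (f 0).
split=> [b b0|x x0]; first by split; [exact: lr|exact: li].
have := rE x x0; have := iE x x0; rewrite /= /cintegral.
by case: (f x) => a b /=; case: (f 0) => c d /= -> ->.
Qed.

Lemma ae_imp (P Q : R -> Prop) : (forall t, P t -> Q t) ->
  (\forall t \ae mu, P t) -> \forall t \ae mu, Q t.
Proof. by move=> PQ; apply: negligibleS; apply: subsetC => t; exact: PQ. Qed.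

Lemma ac_ae (F : R -> R) g h : ac F g -> lint h -> 
  (\forall t \ae mu, halfline t -> g t = h t) -> ac F h.
Proof.
move=> [lg FE] lh gh; split => // x x0; rewrite FE//; congr (_ + _).
have sub : `]0, x]%classic `<=` (`[0, x]%classic : set R) by exact: subset_itv_oc_cc.
have ig : mu.-integrable `]0, x] (EFin \o g) by apply: integrableS (lg _ x0) => //; exact: sub.
have ih : mu.-integrable `]0, x] (EFin \o h) by apply: integrableS (lh _ x0) => //; exact: sub.
rewrite -(Rintegral_itv_obnd_cbnd ig) -(Rintegral_itv_obnd_cbnd ih).
congr fine; apply: ae_eq_integral => //; [exact: measurable_int ig|exact: measurable_int ih|].
apply: ae_imp gh => t /= gh; rewrite in_itv/= => /andP[t0 _].
by rewrite gh// in_itv/= t0.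
Qed.

(** The second weak derivative equals V f - g almost everywhere, and V f - g is
    locally integrable because f is continuous. *)
Lemma schroedinger_elim V f (g : R -> R[i]) : lint V -> schroedinger V f g ->
  [/\ L2_halfline f, L2_halfline g, f 0 = 0 & exists u1 v1 : R -> R,
    solves V (Re \o g) (Re \o f) u1 /\ solves V (Im \o g) (Im \o f) v1].
Proof.
move=> lV [Lf Lg f0 [f1 [f2 [/weak_derivativeP[r1 i1] /weak_derivativeP[r2 i2] gE]]]].
split=> //; exists (Re \o f1), (Im \o f1).
have /L2P[[lgr lgi _ _] _] := Lg.
split; split => //.
- apply: (ac_ae r2); first by apply: lintB => //; apply: lintM => //; exact: ac_lcont r1.
  apply: ae_imp gE => t + ht => /(_ ht) /= ->.
  by case: (f t) => a b; case: (f2 t) => c d /=; ring.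
- apply: (ac_ae i2); first by apply: lintB => //; apply: lintM => //; exact: ac_lcont i1.
  apply: ae_imp gE => t + ht => /(_ ht) /= ->.
  by case: (f t) => a b; case: (f2 t) => c d /=; ring.
Qed.

Lemma schroedinger_intro V f (g : R -> R[i]) u1 v1 : L2_halfline f -> L2_halfline g -> f 0 = 0 ->
  solves V (Re \o g) (Re \o f) u1 -> solves V (Im \o g) (Im \o f) v1 -> schroedinger V f g.
Proof.
move=> Lf Lg f0 [uu1 u1u2] [vv1 v1v2]; split => //.
exists (fun t => u1 t +i* v1 t), (fun t => (V t * Re (f t) - Re (g t)) +i* (V t * Im (f t) - Im (g t))).
split; [by apply/weak_derivativeP|by apply/weak_derivativeP|].
apply: aeW => t _; case: (f t) => a b /=; case: (g t) => c d /=.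
by apply/eqP; rewrite eq_complex /=; apply/andP; split; apply/eqP; ring.
Qed.

End Translation.

(** * Nonnegative energies belong to the spectrum *)

Section SpectrumContainsHalfline.
Context {R : realType}.
Local Notation mu := (@lebesgue_measure R).
Local Notation J a b f := (Rintegral mu `[a, b]%classic f).

Lemma ac_cos (k : R) : ac (fun x => cos (k * x)) (fun x => - (k * sin (k * x))).
Proof.
have D (x : R) : is_derive x 1 (fun x => cos (k * x)) (- (k * sin (k * x))).
  have d1 : is_derive x 1 (fun y : R => k * y) (k * 1).
    by apply: is_deriveZ.
  have := is_derive1_comp (is_derive_cos (k * x)) d1.
  by rewrite mulr1 mulNr mulrC.
apply: ac_C1.
- by move=> x; have [] := D x.
- by apply/funext => x; rewrite derive1E derive_val.
- move=> x; apply: cvgN; apply: cvgMr.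
  apply: continuous_comp; last exact: continuous_sin.
  by apply: cvgMr; exact: cvg_id.
Qed.

Lemma ac_sin (k : R) : ac (fun x => sin (k * x)) (fun x => k * cos (k * x)).
Proof.
have D (x : R) : is_derive x 1 (fun x => sin (k * x)) (k * cos (k * x)).
  have d1 : is_derive x 1 (fun y : R => k * y) (k * 1).
    by apply: is_deriveZ.
  have := is_derive1_comp (is_derive_sin (k * x)) d1.
  by rewrite mulr1 mulrC.
apply: ac_C1.
- by move=> x; have [] := D x.
- by apply/funext => x; rewrite derive1E derive_val.
- move=> x; apply: cvgMr.
  apply: continuous_comp; last exact: continuous_cos.
  by apply: cvgMr; exact: cvg_id.
Qed.

Lemma cos_sin_2pi_nat (n : nat) :
  cos (n%:R * (2 * pi)) = 1 :> R /\ sin (n%:R * (2 * pi)) = 0 :> R.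
Proof.
elim: n => [|n [IH1 IH2]]; first by rewrite mul0r cos0 sin0.
rewrite -natr1 mulrDl mul1r.
have -> : n%:R * (2 * pi) + 2 * pi = n%:R * (2 * pi) + pi + pi :> R by ring.
by rewrite !cosDpi !sinDpi !opprK.
Qed.

Lemma norm_cos_le1 (x : R) : `|cos x| <= 1.
Proof. by rewrite ler_norml cos_geN1 cos_le1. Qed.

Lemma norm_sin_le1 (x : R) : `|sin x| <= 1.
Proof. by rewrite ler_norml sin_geN1 sin_le1. Qed.

Lemma lint_patch (g : R -> R) (a b : R) : lint g -> lint (g \_ `[a, b]).
Proof.
move=> lg c c0; rewrite -restrict_EFin; apply/integrable_restrict => //.
by apply: integrableS (lg c c0) => //; apply: measurableI.
Qed.

(** For lambda = k^2 the equation (L - lambda) u = h is solved with the data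
    h = p cos(k t) and h = p sin(k t) cut off to a period [a, a + N] of the bump
    p = 1 - cos(w t), w = 2 pi / N. Since h'' + k^2 h is of order w, Green's
    identity for u and h expresses the integral of h^2 through that of V u h and a
    term of order w. If N is large and a so far out that V is small, both terms
    are small against N, because u is bounded by the local estimate and by the
    assumed bound on its norm. Adding the two cases gives at most 3/8 N for the
    integral of p^2, which is 3/2 N. *)
Lemma no_bounded_inverse (V : R -> R) (M lambda K : R) : 0 <= lambda -> 0 <= K ->
  lint V -> uniformly_bounded_by V M -> decaying V ->
  (forall h H, lint h -> lint (fun t => h t ^+ 2) ->
     (forall n : nat, J 0 n%:R (fun t => h t ^+ 2) <= H) ->
     exists u u1 : R -> R, solves (fun t => V t - lambda) h u u1 /\
       forall n : nat, J 0 n%:R (fun t => u t ^+ 2) <= K * H) -> False.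
Proof.
move=> lambda0 K0 lV VM Vtail inv.
have [Q0 qQ] := uniformly_bounded_by_shift lV VM (lexx `|lambda|).
rewrite (ger0_norm lambda0) in Q0 qQ.
pose k := Num.sqrt lambda; have k0 : 0 <= k by exact: sqrtr_ge0.
have k2 : k ^+ 2 = lambda by rewrite sqr_sqrtr.
have pi0 := pi_gt0 R.
(* The choice of N below makes |h'' + k^2 h| at most eta / 2; eta is small against
   1 / K because the integral of u^2 is only known to be at most 4 K N. *)
pose eta := (64 * K + 64)^-1.
have eta0 : 0 < eta by rewrite invr_gt0; lra.
have etaK : eta * (64 * K + 64) = 1 by rewrite mulVf// gt_eqF//; lra.
have eta1 : eta <= 64^-1 by nra.
have [N0 N0P] := nat_above (2 * pi * (2 * (1 + 2 * k) / eta)).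
pose N := N0.+1; pose NR : R := N%:R.
have NR0 : 0 < NR by rewrite ltr0n.
have NRP : 2 * pi * (2 * (1 + 2 * k) / eta) <= NR.
  by apply: (le_trans N0P); rewrite ler_nat.
pose w := 2 * pi / NR.
have w0 : 0 < w by rewrite divr_gt0// mulr_gt0.
have wN : w * NR = 2 * pi by rewrite divfK// gt_eqF.
have w_le : w * (2 * (1 + 2 * k)) <= eta.
  rewrite -(ler_pM2r (x := NR / eta)); last by rewrite divr_gt0.
  have -> : w * (2 * (1 + 2 * k)) * (NR / eta) = w * NR * (2 * (1 + 2 * k) / eta) by ring.
  by rewrite wN [leRHS]mulrCA divff ?gt_eqF// mulr1.
clearbody w.
have w1 : w <= 1 by nra.
(* rho bounds |h'' + k^2 h|. *)
pose rho := w ^+ 2 + 2 * w * k.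
have rho0 : 0 <= rho by rewrite /rho; nra.
have rho_le : rho <= eta / 2 by rewrite /rho; nra.
pose Q := M + lambda.
pose C1 := 23 * (2 + Q) ^+ 3.
have C10 : 0 <= C1 by rewrite mulr_ge0// exprn_ge0// addr_ge0.
(* S bounds u^2 on the support of h; V has to be small compared with 1 / S. *)
pose S := C1 * (K * (4 * NR) + 4 * NR).
have S0 : 0 <= S by rewrite mulr_ge0// addr_ge0// ?mulr_ge0// ltW.
pose d := (16 * (1 + S))^-1.
have d0 : 0 < d by rewrite invr_gt0; lra.
have dS : d * (1 + S) = 16^-1.
  by rewrite /d invfM mulrC mulrCA divff ?mulr1// gt_eqF//; lra.
have [X X0 XP] := Vtail d d0.
have [m mX] := nat_above X.
pose a : R := m%:R * NR; pose b := a + NR.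
have a0 : 0 <= a by rewrite mulr_ge0// ltW.
have Xa : X <= a.
  by apply: (le_trans mX); rewrite /a -{1}(mulr1 m%:R) ler_wpM2l// ler1n.
have ab : a <= b by rewrite lerDl ltW.
have b0 : 0 <= b by exact: le_trans ab.
have waE : w * a = m%:R * (2 * pi) by rewrite /a mulrCA wN.
have wbE : w * b = m.+1%:R * (2 * pi) by rewrite /b mulrDr waE wN -natr1; ring.
have [cosa sina] := cos_sin_2pi_nat m.
have [cosb sinb] := cos_sin_2pi_nat m.+1.
pose p t := 1 - cos (w * t).
pose p1 t := w * sin (w * t).
pose p2 t := w ^+ 2 * cos (w * t).
have pp1 : ac p p1.
  by apply: ac_eq (acB (ac_cst 1) (ac_cos w)) => // t _; rewrite /p1; ring.
have p1p2 : ac p1 p2.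
  by apply: ac_eq (acZ w (ac_sin w)) => // t _; rewrite /p2; ring.
have pa : p a = 0 by rewrite /p waE cosa subrr.
have pb : p b = 0 by rewrite /p wbE cosb subrr.
have p1a : p1 a = 0 by rewrite /p1 waE sina mulr0.
have p1b : p1 b = 0 by rewrite /p1 wbE sinb mulr0.
have p02 t : 0 <= p t <= 2.
  by rewrite /p; move: (cos_le1 (w * t)) (cos_geN1 (w * t)); clear; lra.
(* c stands for cos(k t) or sin(k t). *)
have one c dc : ac c dc -> ac dc (fun t => - (k ^+ 2 * c t)) ->
    (forall t, `|c t| <= 1) -> (forall t, `|dc t| <= k) ->
    J a b (fun t => (p t * c t) ^+ 2) <= 3 / 16 * NR.
  move=> acc acdc c1 dck.
  pose phi t := p t * c t.
  pose phi1 t := p1 t * c t + p t * dc t.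
  pose r t := p2 t * c t + 2 * (p1 t * dc t).
  have phiphi1 : ac phi phi1 by exact: acM.
  have phi1phi2 : ac phi1 (fun t => r t - k ^+ 2 * phi t).
    by apply: ac_eq (acD (acM p1p2 acc) (acM pp1 acdc)) => // t _; rewrite /r /phi; ring.
  have cphi := ac_lcont phiphi1; have cphi1 := ac_lcont phi1phi2.
  have cr : lcont r.
    apply: lcontD; first by apply: lcontM; [apply: lcontM; [exact: lcont_cst|exact: ac_lcont (ac_cos w)]|exact: ac_lcont acc].
    by apply: lcontM; [exact: lcont_cst|apply: lcontM; [exact: ac_lcont p1p2|exact: ac_lcont acdc]].
  have phia : phi a = 0 by rewrite /phi pa mul0r.
  have phib : phi b = 0 by rewrite /phi pb mul0r.
  have phi1a : phi1 a = 0 by rewrite /phi1 pa p1a !mul0r addr0.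
  have phi1b : phi1 b = 0 by rewrite /phi1 pb p1b !mul0r addr0.
  have phi2 t : `|phi t| <= 2.
    rewrite normrM -[leRHS]mulr1; apply: ler_pM => //.
    by rewrite ger0_norm; have := p02 t; case/andP.
  have rle t : `|r t| <= rho.
    apply: (le_trans (ler_normD _ _)); rewrite /rho /p1 /p2 !normrM.
        rewrite (ger0_norm (ltW w0)) (ger0_norm (ler0n _ 2)).
    have e1 : `|cos (w * t)| * `|c t| <= 1 by apply: mulr_ile1 => //; exact: norm_cos_le1.
    have e2 : `|sin (w * t)| * `|dc t| <= k.
      by rewrite -[leRHS]mul1r; apply: ler_pM => //; exact: norm_sin_le1.
    have f1 : w ^+ 2 * (`|cos (w * t)| * `|c t|) <= w ^+ 2.
      by rewrite ler_piMr// sqr_ge0.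
    have f2 : w * (`|sin (w * t)| * `|dc t|) <= w * k by rewrite ler_wpM2l// ltW.
    by move: f1 f2; clear; lra.
  pose h := phi \_ `[a, b].
  have hE t : a <= t <= b -> h t = phi t.
    by move=> tab; rewrite /h patchE mem_set//= in_itv.
  have h0 t : t <= a \/ b <= t -> h t = 0.
    move=> tab; rewrite /h patchE; case: ifP => //; rewrite inE/= in_itv/=.
    case: tab => [ta|bt] /andP[ta' tb'].
      by rewrite (_ : t = a)//; apply/eqP; rewrite eq_le ta ta'.
    by rewrite (_ : t = b)//; apply/eqP; rewrite eq_le bt tb'.
  have lh : lint h by apply: lint_patch; exact: lcont_lint.
  have h2E : (fun t => h t ^+ 2) = (fun t => phi t ^+ 2) \_ `[a, b].
    by apply/funext => t; rewrite /h !patchE; case: ifP => // _; rewrite expr0n.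
  have lh2 : lint (fun t => h t ^+ 2).
    by rewrite h2E; apply: lint_patch; apply: lcont_lint; exact: lcontX.
  have hH (n : nat) : J 0 n%:R (fun t => h t ^+ 2) <= 4 * NR.
    pose B := Num.max n%:R b.
    have nB : n%:R <= B by rewrite le_max lexx.
    have bB : b <= B by rewrite le_max lexx orbT.
    apply: (@le_trans _ _ (J 0 B (fun t => h t ^+ 2))).
      by apply: J_mono => // t _; exact: sqr_ge0.
    rewrite (J_cat (b := b))// [X in X + _](J_cat (b := a))//.
    rewrite [X in X + _ + _](@J_eq _ _ (fun=> 0)); last first.
      by move=> t /andP[_ ta]; rewrite h0 ?expr0n//; left.
    rewrite [X in _ + X](@J_eq _ _ (fun=> 0)); last first.
      by move=> t /andP[bt _]; rewrite h0 ?expr0n//; right.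
    rewrite !J_cst// !mul0r add0r addr0.
    have -> : 4 * NR = 4 * (b - a) by rewrite /b; ring.
    apply: J_bound => // t tab; rewrite hE// -(real_normK (num_real _)).
    by move: (phi2 t) (normr_ge0 (phi t)); clear; nra.
  have [u [u1 [su uK]]] := inv h _ lh lh2 hH.
  have [uu1 u1u2] := su.
  have cu := ac_lcont uu1.
  have lq : lint (fun t => V t - lambda) by apply: lintB => //; exact: lint_cst.
  have lu2 : lint (fun t => u t ^+ 2) by apply: lcont_lint; exact: lcontX.
  have u2S t : a <= t -> u t ^+ 2 <= S.
    move=> at_; have t0 := le_trans a0 at_.
    have tt1 : t <= t <= t + 1 by rewrite lexx lerDl ler01.
    have [+ _] := local_estimate t0 Q0 lq lh lh2 su (qQ t t0) tt1.
    move=> E; apply: (le_trans E); rewrite ler_wpM2l//.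
    have [n nP] := nat_above (t + 1).
    have sub f : lint f -> (forall t, 0 <= f t) -> J t (t + 1) f <= J 0 n%:R f.
      by move=> lf f0; apply: J_sub => //; rewrite lerDl.
    apply: lerD.
      by apply: le_trans (uK n); apply: sub => // s; exact: sqr_ge0.
    by apply: le_trans (hH n); apply: sub => // s; exact: sqr_ge0.
  (* The boundary terms vanish because p and p' do at both ends. *)
  have green : J a b (fun t => (V t - lambda) * u t * phi t - h t * phi t
      - u t * (r t - k ^+ 2 * phi t)) = 0.
    have W := acB (acM u1u2 phiphi1) (acM uu1 phi1phi2).
    have := ac_J W a0 ab; rewrite phia phib phi1a phi1b !mulr0 !subrr => /esym E.
    by rewrite -[RHS]E; apply: J_eq => t _; ring.
  have lVu : lint (fun t => V t * u t * phi t - u t * r t).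
    apply: lintB; first by apply: lintM => //; exact: lintM.
    by apply: lcont_lint; exact: lcontM.
  have lphi2 : lint (fun t => phi t ^+ 2) by apply: lcont_lint; exact: lcontX.
  have E : J a b (fun t => phi t ^+ 2) = J a b (fun t => V t * u t * phi t - u t * r t).
    apply/eqP; rewrite eq_sym -subr_eq0; apply/eqP; rewrite -J_B//.
    rewrite -[RHS]green; apply: J_eq => t tab; rewrite hE// k2; ring.
  rewrite [leLHS]E.
  have lVn := lint_norm lV.
  apply: (@le_trans _ _ (J a b (fun t => (1 + S) * `|V t| + (eta * u t ^+ 2 + 16^-1)))).
    apply: J_le => //.
      apply: lintD; first exact: lintZ.
      by apply: lintD; [exact: lintZ|exact: lint_cst].
    move=> t /andP[at_ tb].
    have e1 : V t * u t * phi t <= (1 + S) * `|V t|.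
      apply: (le_trans (ler_norm _)); rewrite (normrM (V t * u t)) (normrM (V t)) -mulrA [leRHS]mulrC.
      rewrite ler_wpM2l//.
      have := u2S t at_; rewrite -(real_normK (num_real (u t))).
      have g1 : `|u t| * `|phi t| <= `|u t| * 2 by rewrite ler_wpM2l.
      have g2 : (`|u t| - 1) ^+ 2 = `|u t| ^+ 2 - 2 * `|u t| + 1 by ring.
      by move: g1 (sqr_ge0 (`|u t| - 1)); rewrite g2; clear; lra.
    have e2 : - (u t * r t) <= eta * u t ^+ 2 + 16^-1.
      have f1 : - (u t * r t) <= `|u t| * rho.
        by apply: (le_trans (ler_norm _)); rewrite normrN (normrM (u t)) ler_wpM2l.
      apply: (le_trans f1); rewrite -(real_normK (num_real (u t))).
      have : 0 <= `|u t| by [].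
      move: rho_le; set x := `|u t| => g1 g2.
      have g3 : x * rho <= x * (eta / 2) by rewrite ler_wpM2l.
      by move: g1 g2 g3 eta0 eta1 (sqr_ge0 (x - 2^-1)); clear; nra.
    by move: e1 e2; clear; lra.
  rewrite J_D//; [|exact: lintZ|by apply: lintD; [exact: lintZ|exact: lint_cst]].
  rewrite J_D//; [|exact: lintZ|exact: lint_cst].
  rewrite !J_Z// J_cst//.
  have bNR : b - a = NR by rewrite /b; ring.
  rewrite bNR.
  have i1 : J a b (fun t => `|V t|) <= NR * d.
    by apply: J_unit_bound => // x ax; apply: XP; exact: le_trans ax.
  have i2 : J a b (fun t => u t ^+ 2) <= K * (4 * NR).
    have [n nP] := nat_above b.
    apply: le_trans (uK n); apply: J_sub => // t _; exact: sqr_ge0.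
  have i3 : (1 + S) * J a b (fun t => `|V t|) <= NR * 16^-1.
    rewrite -dS (mulrC d) mulrCA ler_wpM2l//; move: S0; clear; lra.
  have i4 : eta * J a b (fun t => u t ^+ 2) <= NR * 16^-1.
    apply: (@le_trans _ _ (eta * (K * (4 * NR)))); first by rewrite ler_wpM2l// ltW.
    have -> : eta * (K * (4 * NR)) = NR * (eta * (4 * K)) by ring.
    by rewrite ler_wpM2l ?(ltW NR0)//; move: etaK eta0; clear; lra.
  by move: i3 i4; clear; lra.
have cosB : J a b (fun t => (p t * cos (k * t)) ^+ 2) <= 3 / 16 * NR.
  apply: (one _ _ (ac_cos k)).
  - by apply: ac_eq (acN (acZ k (ac_sin k))) => // t _; ring.
  - by move=> t; exact: norm_cos_le1.
  - move=> t; rewrite normrN normrM (ger0_norm k0) -[leRHS]mulr1 ler_wpM2l//.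
    exact: norm_sin_le1.
have sinB : J a b (fun t => (p t * sin (k * t)) ^+ 2) <= 3 / 16 * NR.
  apply: (one _ _ (ac_sin k)).
  - by apply: ac_eq (acZ k (ac_cos k)) => // t _; ring.
  - by move=> t; exact: norm_sin_le1.
  - move=> t; rewrite normrM (ger0_norm k0) -[leRHS]mulr1 ler_wpM2l//.
    exact: norm_cos_le1.
have cp := ac_lcont pp1.
have lsq c dc : ac c dc -> lint (fun t => (p t * c t) ^+ 2).
  by move=> acc; apply: lcont_lint; apply: lcontX; apply: lcontM => //; exact: ac_lcont acc.
have lcosw : lint (fun t => w * cos (w * t)) := ac_lint (ac_sin w).
have intcos : J a b (fun t => w * cos (w * t)) = 0.
  by rewrite -(ac_J (ac_sin w) a0 ab) waE wbE sina sinb subrr.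
(* The lower bound p^2 >= 1 - 2 cos(w t) has integral N over a period. *)
have : J a b (fun t => 1 - 2 / w * (w * cos (w * t))) <=
    J a b (fun t => (p t * cos (k * t)) ^+ 2 + (p t * sin (k * t)) ^+ 2).
  apply: J_le => //.
  - by apply: lintB; [exact: lint_cst|exact: lintZ].
  - by apply: lintD; [exact: lsq (ac_cos k)|exact: lsq (ac_sin k)].
  move=> t _; rewrite mulrA divfK ?gt_eqF//.
  have := cos2Dsin2 (k * t); rewrite /p !exprMn -mulrDr => ->; rewrite mulr1.
  by move: (sqr_ge0 (cos (w * t))); clear; nra.
rewrite J_B//; [|exact: lint_cst|exact: lintZ].
rewrite J_D//; [|exact: lsq (ac_cos k)|exact: lsq (ac_sin k)].
rewrite J_cst// J_Z// intcos mulr0 subr0 mul1r.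
have -> : b - a = NR by rewrite /b; ring.
by move: cosB sinB NR0; clear; lra.
Qed.

End SpectrumContainsHalfline.

(** * Solutions at negative energies *)

Section EnergyEstimates.
Context {R : realType}.
Local Notation mu := (@lebesgue_measure R).
Local Notation J a b f := (Rintegral mu `[a, b]%classic f).
Implicit Types (q h u v V : R -> R).

(** Square integrability on the half-line, for a locally square integrable function. *)
Definition sq_bounded u := exists C : R, forall n : nat, J 0 n%:R (fun t => u t ^+ 2) <= C.

Lemma sq_cvg0 (x : nat -> R) : x n ^+ 2 @[n --> \oo] --> 0 -> x n @[n --> \oo] --> 0.
Proof.
move=> /cvgrPdist_lt c; apply/cvgrPdist_lt => e e0.
have e20 : 0 < e ^+ 2 by rewrite exprn_gt0.
apply: filterS (c _ e20) => n; rewrite !sub0r !normrN => h.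
rewrite -(ltr_pXn2r (n := 2))// ?nnegrE ?(ltW e0)//.
by rewrite -normrX.
Qed.

Lemma sq_bounded_cvg u : lint (fun t => u t ^+ 2) -> sq_bounded u ->
  J n%:R (n%:R + 1) (fun t => u t ^+ 2) @[n --> \oo] --> 0.
Proof.
move=> lu [C uC].
pose a (n : nat) := J 0 n%:R (fun t => u t ^+ 2).
have nda : nondecreasing_seq a.
  move=> m n mn; apply: J_mono => //; first by rewrite ler_nat.
  by move=> t _; exact: sqr_ge0.
have ca : cvgn a.
  apply: nondecreasing_is_cvgn => //; exists C => _ [n _ <-]; exact: uC.
have ca1 : a n.+1 @[n --> \oo] --> limn a by have -> := cvg_shiftS a (nbhs (limn a)).
rewrite (_ : (fun n => _) = fun n => a n.+1 - a n).
  by rewrite -(subrr (limn a)); exact: cvgB.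
apply/funext => n.
have n1 : n%:R <= n%:R + 1 :> R by rewrite lerDl.
by rewrite /a -natr1 (J_cat lu (lexx 0) (ler0n _ n) n1) addrAC subrr add0r.
Qed.

(** The masses of u^2 and h^2 on [n, n + 1] tend to 0 and control u n and u' n by
    the local estimate. *)
Lemma solution_decay q h u u1 Q : uniformly_bounded_by q Q -> lint q -> lint h ->
  lint (fun t => h t ^+ 2) -> solves q h u u1 -> sq_bounded u -> sq_bounded h ->
  u n%:R @[n --> \oo] --> 0 /\ u1 n%:R @[n --> \oo] --> 0.
Proof.
move=> [Q0 qQ] lq lh lh2 su bu bh.
have cu := ac_lcont (proj1 su).
have lu2 : lint (fun t => u t ^+ 2) by apply: lcont_lint; exact: lcontX.
have c1 := sq_bounded_cvg lu2 bu; have c2 := sq_bounded_cvg lh2 bh.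
have c : 23 * (2 + Q) ^+ 3 * (J n%:R (n%:R + 1) (fun t => u t ^+ 2) +
   J n%:R (n%:R + 1) (fun t => h t ^+ 2)) @[n --> \oo] --> 23 * (2 + Q) ^+ 3 * (0 + 0).
  by apply: cvgMr; apply: cvgD.
have K0 : 23 * (2 + Q) ^+ 3 * (0 + 0) = 0 by rewrite addr0 mulr0.
rewrite {}K0 in c.
have nn (x : R) : x <= x <= x + 1 by rewrite lexx lerDl ler01.
split; apply: sq_cvg0.
  apply: (squeeze_cvgr (f := fun=> 0) _ (cvg_cst _) c); apply: nearW => n; rewrite sqr_ge0/=.
  have n0 : 0 <= n%:R :> R by [].
  by have [] := local_estimate n0 Q0 lq lh lh2 su (qQ _ n0) (nn _).
apply: (squeeze_cvgr (f := fun=> 0) _ (cvg_cst _) c); apply: nearW => n; rewrite sqr_ge0/=.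
have n0 : 0 <= n%:R :> R by [].
by have [] := local_estimate n0 Q0 lq lh lh2 su (qQ _ n0) (nn _).
Qed.

(** Energy estimate far out: integrate (u u')' = u'^2 + (V - E) u^2 - u h, where
    - E >= e. On every unit interval the integral of |V| u^2 is at most the small
    mass of V times the maximum of u^2, hence by the local estimate a small
    multiple of the mass of u^2 + h^2. The threshold X0 works for all energies in
    [- F, - e]. *)
Lemma tail_estimate V M e F : lint V -> uniformly_bounded_by V M -> decaying V ->
  0 < e -> e <= F ->
  exists2 X0, 0 <= X0 & forall E h u u1 X (n : nat), - F <= E -> E <= - e -> X0 <= X ->
    lint h -> lint (fun t => h t ^+ 2) -> solves (fun t => V t - E) h u u1 ->
    e / 2 * J X (X + n%:R) (fun t => u t ^+ 2) <=
    u (X + n%:R) * u1 (X + n%:R) - u X * u1 X + (e^-1 + 1) * J X (X + n%:R) (fun t => h t ^+ 2).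
Proof.
move=> lV VM Vtail e0 eF; have M0 := proj1 VM.
have F0 : 0 < F by exact: lt_le_trans eF.
pose C1 := 23 * (2 + (M + F)) ^+ 3.
have C10 : 0 <= C1 by rewrite mulr_ge0// exprn_ge0//; lra.
pose s := Num.min (e / 4) 1.
have s0 : 0 < s by rewrite lt_min ltr01 andbT; lra.
have se : s <= e / 4 by rewrite ge_min lexx.
have s1 : s <= 1 by rewrite ge_min lexx orbT.
pose d := s / (C1 + 1).
have C11 : 0 < C1 + 1 by lra.
have d0 : 0 < d by rewrite divr_gt0.
have dC : d * C1 <= s.
  have : d * (C1 + 1) = s by rewrite divfK// gt_eqF.
  by rewrite mulrDr mulr1; lra.
have [X0 X00 X0P] := Vtail d d0.
exists X0 => // E h u u1 X n FE Ee X0X lh lh2 su.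
have X_0 : 0 <= X by exact: le_trans X0X.
have lq : lint (fun t => V t - E) by apply: lintB => //; exact: lint_cst.
have lVn := lint_norm lV.
have [uu1 u1u2] := su.
have cu := ac_lcont uu1; have cu1 := ac_lcont u1u2.
have lu2 : lint (fun t => u t ^+ 2) by apply: lcont_lint; exact: lcontX.
have lu12 : lint (fun t => u1 t ^+ 2) by apply: lcont_lint; exact: lcontX.
have lVu2 : lint (fun t => `|V t| * u t ^+ 2) by apply: lintM => //; exact: lcontX.
have EF : `|E| <= F by rewrite ler_norml FE/=; lra.
have [Q0 qQ] := uniformly_bounded_by_shift lV VM EF.
have unit_ x : X <= x -> J x (x + 1) (fun t => `|V t| * u t ^+ 2) <=
    J x (x + 1) (fun t => s * (u t ^+ 2 + h t ^+ 2)).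
  move=> Xx; have x0 := le_trans X_0 Xx.
  set A := J x (x + 1) (fun t => u t ^+ 2) + J x (x + 1) (fun t => h t ^+ 2).
  have A0 : 0 <= A by apply: addr_ge0; apply: J_ge0 => t _; exact: sqr_ge0.
  rewrite J_Z//; last exact: lintD.
  rewrite J_D// -/A.
  apply: (@le_trans _ _ (J x (x + 1) (fun t => C1 * A * `|V t|))).
    apply: J_le => //; first exact: lintZ.
    move=> t tx; rewrite mulrC ler_wpM2r//.
    by have [] := local_estimate x0 Q0 lq lh lh2 su (qQ x x0) tx.
  rewrite J_Z//.
  have Vd := X0P x (le_trans X0X Xx).
  have h1 : C1 * A * J x (x + 1) (fun t => `|V t|) <= C1 * A * d.
    by rewrite ler_wpM2l// mulr_ge0.
  apply: (le_trans h1).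
  by rewrite (mulrC (C1 * A)) mulrA ler_wpM2r.
have lsum : lint (fun t => s * (u t ^+ 2 + h t ^+ 2)) by apply: lintZ; exact: lintD.
have VU := J_unit_le n lVu2 lsum X_0 unit_.
have XXn : X <= X + n%:R by rewrite lerDl.
rewrite J_Z// in VU; last exact: lintD.
rewrite J_D// in VU.
rewrite (ac_J (energy_ac su))//.
set U := J X (X + n%:R) (fun t => u t ^+ 2) in VU *.
set H := J X (X + n%:R) (fun t => h t ^+ 2) in VU *.
have U0 : 0 <= U by apply: J_ge0 => t _; exact: sqr_ge0.
have H0 : 0 <= H by apply: J_ge0 => t _; exact: sqr_ge0.
have low : 3 / 4 * e * U - J X (X + n%:R) (fun t => `|V t| * u t ^+ 2) - e^-1 * H <=
   J X (X + n%:R) (fun t => u1 t ^+ 2 + u t * ((V t - E) * u t - h t)).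
  have l1 : lint (fun t => 3 / 4 * e * u t ^+ 2) by exact: lintZ.
  have l2 : lint (fun t => e^-1 * h t ^+ 2) by exact: lintZ.
  have l3 : lint (fun t => 3 / 4 * e * u t ^+ 2 - `|V t| * u t ^+ 2) by exact: lintB.
  rewrite -(J_Z _ _ lu2 X_0) -(J_Z _ _ lh2 X_0) -(J_B _ l1 lVu2 X_0) -(J_B _ l3 l2 X_0).
  apply: J_le => //.
  - exact: lintB.
  - by apply: lintD => //; apply: lintMl => //; exact: ac_lint u1u2.
  move=> t _.
  have p1 := sqr_ge0 (u1 t).
  have p2 : - (`|V t| * u t ^+ 2) <= V t * u t ^+ 2.
    by rewrite -mulNr ler_wpM2r ?sqr_ge0// lerNl -normrN ler_norm.
  have p3 : e * u t ^+ 2 <= - E * u t ^+ 2 by rewrite ler_wpM2r ?sqr_ge0//; lra.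
  have p4 : u t * h t <= e / 4 * u t ^+ 2 + e^-1 * h t ^+ 2.
    have -> : e / 4 * u t ^+ 2 + e^-1 * h t ^+ 2 = u t * h t + e * (u t / 2 - e^-1 * h t) ^+ 2.
      by field; rewrite gt_eqF.
    by rewrite lerDl mulr_ge0 ?sqr_ge0// ltW.
  by lra.
have sU : s * U <= e / 4 * U by rewrite ler_wpM2r.
have sH : s * H <= H by rewrite ler_piMl.
by lra.
Qed.

(** Since u' is close to 1 near 0, u t >= t / 2 there. *)
Lemma nonzero_start u u1 : ac u u1 -> lcont u1 -> u 0 = 0 -> u1 0 = 1 ->
  0 < J 0 1 (fun t => u t ^+ 2).
Proof.
move=> auu1 cu1 u0 u10.
have cu := ac_lcont auu1.
have := cu1 1 ler01 => /(continuous_within_itvP _ ltr01)[_ /cvgrPdist_lt/(_ 2^-1) + _].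
rewrite u10 invr_gt0 => /(_ (ltr0n _ 2)) [r /= r0 rP].
pose e := Num.min (r / 2) 1.
have e0 : 0 < e by rewrite lt_min ltr01 andbT divr_gt0.
have er : e < r by rewrite gt_min; apply/orP; left; lra.
have e1 : e <= 1 by rewrite ge_min lexx orbT.
have u1e t : 0 <= t <= e -> 2^-1 <= u1 t.
  rewrite le_eqVlt => /andP[/predU1P[<- _|t0 te]]; first by rewrite u10; lra.
  have : `|1 - u1 t| < 2^-1.
    by apply: rP => //=; rewrite sub0r normrN gtr0_norm//; lra.
  by rewrite ltr_norml => /andP[_]; lra.
have ue t : 0 <= t <= e -> t / 2 <= u t.
  move=> /andP[t0 te]; have := ac_J auu1 (lexx 0) t0; rewrite u0 subr0 => ->.
  have -> : t / 2 = J 0 t (fun=> 2^-1) by rewrite J_cst//; ring.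
  apply: J_le => //; [exact: lint_cst|exact: lcont_lint|].
  by move=> s /andP[s0 st]; apply: u1e; rewrite s0 (le_trans st).
have lu2 : lint (fun t => u t ^+ 2) by apply: lcont_lint; exact: lcontX.
apply: (@lt_le_trans _ _ (J (e / 2) e (fun=> (e / 4) ^+ 2))).
  rewrite J_cst; last by lra.
  by rewrite mulr_gt0// ?exprn_gt0//; lra.
apply: (@le_trans _ _ (J (e / 2) e (fun t => u t ^+ 2))).
  apply: J_le => //; [exact: lint_cst|lra|].
  move=> t /andP[te1 te2].
  have : t / 2 <= u t by apply: ue; rewrite te2 andbT; lra.
  by move=> h; rewrite ler_sqr ?nnegrE; lra.
by apply: J_sub => //; [lra|lra|move=> t _; exact: sqr_ge0].
Qed.

End EnergyEstimates.

(** * A priori bounds for boundary value problems *)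

Section AprioriBounds.
Context {R : realType}.
Local Notation mu := (@lebesgue_measure R).
Local Notation J a b f := (Rintegral mu `[a, b]%classic f).
Implicit Types (q h u v V : R -> R).

Lemma gronwall_sq q (Y : R) : lint q -> 0 <= Y ->
  exists2 D, 0 <= D & forall h d d1, lint h -> lint (fun t => h t ^+ 2) -> solves q h d d1 ->
    d 0 = 0 -> d1 0 = 0 -> forall x, 0 <= x <= Y ->
    d x ^+ 2 <= D * J 0 Y (fun t => h t ^+ 2) /\ d1 x ^+ 2 <= D * J 0 Y (fun t => h t ^+ 2).
Proof.
move=> lq Y0.
pose G := expR (J 0 Y (fun t => 1 + `|q t|)).
have la : lint (fun t => 1 + `|q t|) by apply: lintD; [exact: lint_cst|exact: lint_norm].
have G0 : 0 <= G by exact: expR_ge0.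
exists (Y * G ^+ 2); first by rewrite mulr_ge0// sqr_ge0.
move=> h d d1 lh lh2 sd d0 d10 x /andP[x0 xY].
have lnh := lint_norm lh.
have gw := gronwall_sol lq lh sd d0 d10 x0.
have {gw} : `|d x| + `|d1 x| <= J 0 Y (fun t => `|h t|) * G.
  apply: (le_trans gw); apply: ler_pM.
  - exact: J_ge0.
  - exact: expR_ge0.
  - exact: J_mono.
  - by rewrite ler_expR; apply: J_mono => // t _; rewrite addr_ge0.
set s := J 0 Y _ * G => le_s.
have s0 : 0 <= s by rewrite mulr_ge0// J_ge0.
have s2 : s ^+ 2 <= Y * G ^+ 2 * J 0 Y (fun t => h t ^+ 2).
  rewrite exprMn [leRHS]mulrAC ler_wpM2r ?sqr_ge0//.
  by have := J_cauchy_schwarz lh lh2 (lexx 0) Y0; rewrite subr0.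
have n1 : 0 <= `|d x| by []. have n2 : 0 <= `|d1 x| by [].
split; apply: (le_trans _ s2); rewrite -(real_normK (num_real _)) ler_sqr ?nnegrE//; lra.
Qed.

Lemma le_sqD (x y z : R) : x = y + z -> x ^+ 2 <= 2 * y ^+ 2 + 2 * z ^+ 2.
Proof. by move=> ->; have := sqr_ge0 (y - z); nra. Qed.

Lemma norm_mul_le (x y : R) : `|x * y| <= 2^-1 * x ^+ 2 + 2^-1 * y ^+ 2.
Proof.
rewrite ler_norml; have := sqr_ge0 (x - y); have := sqr_ge0 (x + y).
by move=> *; apply/andP; split; nra.
Qed.

Lemma le_pert (p p1 x y t : R) : 0 <= p -> 0 <= p1 -> 0 <= x -> 0 <= y -> x + y <= t -> t <= 1 ->
  p * y + x * p1 + x * y <= t * (p + p1 + 1).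
Proof.
move=> p0 p10 x0 y0 xyt t1.
have f1 : p * y <= p * t by rewrite ler_wpM2l//; lra.
have f2 : x * p1 <= t * p1 by rewrite ler_wpM2r//; lra.
have f3 : x * y <= t * 1 by apply: ler_pM => //; lra.
by lra.
Qed.

(** The Dirichlet problem on [0, n] at a negative energy E, with a constant that
    does not depend on n, provided the solution phi with phi 0 = 0 and phi' 0 = 1
    is not square integrable. Write u = c phi + d, where d has vanishing initial
    data; d is controlled on [0, Y] by Gronwall's inequality, and the tail estimate
    controls u on [X, n] by its boundary term at X, which is at most c^2 B up to
    multiples of the norm of h. As Y is chosen so that the mass of phi on [X, Y]
    exceeds what this boundary term can produce, c^2 is bounded by the norm of h. *)
Lemma dirichlet_bound_real V M E phi phi1 : lint V -> uniformly_bounded_by V M -> decaying V ->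
  E < 0 -> solves (fun t => V t - E) (fun=> 0) phi phi1 -> phi 0 = 0 -> phi1 0 = 1 ->
  ~ sq_bounded phi ->
  exists K (N0 : nat), 0 <= K /\ forall h u u1 (n : nat), (N0 <= n)%N ->
    lint h -> lint (fun t => h t ^+ 2) -> solves (fun t => V t - E) h u u1 ->
    u 0 = 0 -> u n%:R = 0 ->
    J 0 n%:R (fun t => u t ^+ 2) <= K * J 0 n%:R (fun t => h t ^+ 2).
Proof.
move=> lV [M0 VM] Vd E0 sphi phi0 phi10 phiL2.
pose e := - E; have e0 : 0 < e by rewrite oppr_gt0.
have [X0 X00 X0P] := tail_estimate lV (conj M0 VM) Vd e0 (lexx e).
have [X X0X] := nat_above X0.
have lq : lint (fun t => V t - E) by apply: lintB => //; exact: lint_cst.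
have cphi := ac_lcont (proj1 sphi).
have lphi2 : lint (fun t => phi t ^+ 2) by apply: lcont_lint; exact: lcontX.
pose B := phi X%:R ^+ 2 + phi1 X%:R ^+ 2.
have B0 : 0 <= B by rewrite addr_ge0// sqr_ge0.
pose IX := J 0 X%:R (fun t => phi t ^+ 2).
have IX0 : 0 <= IX by apply: J_ge0 => t _; exact: sqr_ge0.
pose C2 := e^-1 + 1.
have C20 : 0 < C2 by rewrite addr_gt0// invr_gt0.
(* Y is so large that the mass of phi on [X, Y] beats the boundary term at X. *)
have [Y XY YP] : exists2 Y : nat, (X <= Y)%N & 4 / e * B + 1 <= J X%:R Y%:R (fun t => phi t ^+ 2).
  have [Y YP] : exists Y : nat, IX + (4 / e * B + 1) < J 0 Y%:R (fun t => phi t ^+ 2).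
    apply: contrapT => h; apply: phiL2; exists (IX + (4 / e * B + 1)) => n.
    by rewrite leNgt; apply/negP => hn; apply: h; exists n.
  have XY : (X <= Y)%N.
    rewrite leqNgt; apply/negP => YX; move: YP; rewrite ltNge => /negP; apply.
    apply: (@le_trans _ _ IX).
      by apply: J_mono => //; [rewrite ler_nat ltnW|move=> t _; exact: sqr_ge0].
    by rewrite lerDl addr_ge0// mulr_ge0// divr_ge0// ltW.
  exists Y => //; move: YP.
  rewrite (J_cat (b := X%:R) lphi2)// ?ler_nat// -/IX; lra.
have Y0 : 0 <= Y%:R :> R by [].
have [D D0 DP] := gronwall_sq lq Y0.
pose C3 := 4 / e * (2 * D + C2) + 2 * Y%:R * D.
have C30 : 0 <= C3.
  have p1 : 0 <= 2 * Y%:R * D by rewrite !mulr_ge0.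
  have p2 : 0 <= 4 / e * (2 * D + C2) by rewrite mulr_ge0 ?divr_ge0 ?(ltW e0)//; lra.
  by rewrite /C3; lra.
pose K := 2 * X%:R * D + 2 * C3 * IX + 2 / e * (2 * D + C3 * B + C2).
exists K, Y; split.
  have p1 : 0 <= 2 * X%:R * D by rewrite !mulr_ge0.
  have p2 : 0 <= 2 * C3 * IX by rewrite !mulr_ge0.
  have p3 : 0 <= C3 * B by rewrite mulr_ge0.
  have p4 : 0 <= 2 / e * (2 * D + C3 * B + C2).
    by rewrite mulr_ge0 ?divr_ge0 ?(ltW e0)//; lra.
  by rewrite /K; lra.
move=> h u u1 n Yn lh lh2 su u0 un.
set H := J 0 n%:R (fun t => h t ^+ 2).
have XYR : X%:R <= Y%:R :> R by rewrite ler_nat.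
have YnR : Y%:R <= n%:R :> R by rewrite ler_nat.
have XnR := le_trans XYR YnR.
have hH a b : 0 <= a -> a <= b -> b <= n%:R -> J a b (fun t => h t ^+ 2) <= H.
  by move=> *; apply: J_sub => // t _; exact: sqr_ge0.
have H0 : 0 <= H by apply: J_ge0 => t _; exact: sqr_ge0.
have lz : lint (fun=> 0 : R) by exact: lint_cst.
have cu := ac_lcont (proj1 su).
have lu2 : lint (fun t => u t ^+ 2) by apply: lcont_lint; exact: lcontX.
pose c := u1 0.
pose d t := u t - c * phi t; pose d1 t := u1 t - c * phi1 t.
have sd : solves (fun t => V t - E) h d d1.
  by apply: solves_eq (solves_lin c su sphi) => t _ /=; rewrite /d ?/d1; ring.
have dH x : 0 <= x <= Y%:R -> d x ^+ 2 <= D * H /\ d1 x ^+ 2 <= D * H.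
  have d00 : d 0 = 0 by rewrite /d u0 phi0 mulr0 subr0.
  have d10 : d1 0 = 0 by rewrite /d1 phi10 mulr1 subrr.
  move=> xY; have [h1 h2] := DP h d d1 lh lh2 sd d00 d10 x xY.
  by split; [apply: (le_trans h1)|apply: (le_trans h2)]; rewrite ler_wpM2l// hH.
have cd := ac_lcont (proj1 sd).
have ld2 : lint (fun t => d t ^+ 2) by apply: lcont_lint; exact: lcontX.
have uX : `|u X%:R * u1 X%:R| <= 2 * D * H + c ^+ 2 * B.
  have XX : (0 <= X%:R :> R) && (X%:R <= Y%:R :> R) by rewrite ler0n XYR.
  have [a1 a2] := dH _ XX.
  have b1 : u X%:R ^+ 2 <= 2 * d X%:R ^+ 2 + 2 * (c * phi X%:R) ^+ 2.
    by apply: le_sqD; rewrite /d; ring.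
  have b2 : u1 X%:R ^+ 2 <= 2 * d1 X%:R ^+ 2 + 2 * (c * phi1 X%:R) ^+ 2.
    by apply: le_sqD; rewrite /d1; ring.
  rewrite exprMn in b1; rewrite exprMn in b2.
  have b3 := norm_mul_le (u X%:R) (u1 X%:R).
  by rewrite /B; move: a1 a2 b1 b2 b3; clear; lra.
have tail : e / 2 * J X%:R n%:R (fun t => u t ^+ 2) <= 2 * D * H + c ^+ 2 * B + C2 * H.
  have Ee : - e <= E by rewrite /e opprK.
  have eE : E <= - e by rewrite /e opprK.
  have := X0P E h u u1 X%:R (n - X)%N Ee eE X0X lh lh2 su.
  rewrite -natrD subnKC ?(leq_trans XY)// un mul0r => t1.
  have := ler_norm (- (u X%:R * u1 X%:R)); rewrite normrN => t2.
  have t3 := hH X%:R n%:R (ler0n _ _) XnR (lexx _).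
  have t4 : C2 * J X%:R n%:R (fun t => h t ^+ 2) <= C2 * H by rewrite ler_wpM2l// ltW.
  by move: t1; rewrite -/C2; move: t2 uX t4; clear; lra.
set U := J X%:R n%:R (fun t => u t ^+ 2) in tail.
have tail' : 2 * U <= 4 / e * (2 * D * H + c ^+ 2 * B + C2 * H).
  have -> : 2 * U = 4 / e * (e / 2 * U) by field; rewrite gt_eqF.
  by rewrite ler_wpM2l// divr_ge0// ltW.
have cC3 : c ^+ 2 <= C3 * H.
  have p1 : c ^+ 2 * J X%:R Y%:R (fun t => phi t ^+ 2) <=
      2 * J X%:R Y%:R (fun t => u t ^+ 2) + 2 * J X%:R Y%:R (fun t => d t ^+ 2).
    rewrite -!J_Z// -J_D//; [|exact: lintZ|exact: lintZ].
    apply: J_le => //; [exact: lintZ|by apply: lintD; exact: lintZ|].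
    move=> t _; rewrite -exprMn -(sqrrN (d t)); apply: le_sqD; rewrite /d; ring.
  have p2 : J X%:R Y%:R (fun t => u t ^+ 2) <= U.
    by apply: J_mono => // t _; exact: sqr_ge0.
  have p3 : J X%:R Y%:R (fun t => d t ^+ 2) <= Y%:R * (D * H).
    apply: (@le_trans _ _ (D * H * (Y%:R - X%:R))).
      apply: J_bound => // t /andP[Xt tY]; apply: (proj1 (dH t _)).
      by rewrite tY (le_trans _ Xt).
    by rewrite mulrC ler_wpM2r ?mulr_ge0// gerBl.
  have p4 : c ^+ 2 * (4 / e * B + 1) <= c ^+ 2 * J X%:R Y%:R (fun t => phi t ^+ 2).
    by rewrite ler_wpM2l// sqr_ge0.
  by rewrite /C3; move: p1 p2 p3 p4 tail'; clear; lra.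
have cB : c ^+ 2 * B <= C3 * H * B by rewrite ler_wpM2r.
have head : J 0 X%:R (fun t => u t ^+ 2) <= 2 * X%:R * D * H + 2 * C3 * IX * H.
  apply: (@le_trans _ _ (J 0 X%:R (fun t => 2 * (D * H) + 2 * c ^+ 2 * phi t ^+ 2))).
    apply: J_le => //; first by apply: lintD; [exact: lint_cst|exact: lintZ].
    move=> t /andP[t0 tX].
    have [a1 _] : d t ^+ 2 <= D * H /\ d1 t ^+ 2 <= D * H.
      by apply: dH; rewrite t0 (le_trans tX).
    have : u t ^+ 2 <= 2 * d t ^+ 2 + 2 * (c * phi t) ^+ 2 by apply: le_sqD; rewrite /d; ring.
    by rewrite exprMn; move: a1; clear; lra.
  rewrite J_D//; [|exact: lint_cst|exact: lintZ].
  rewrite J_cst// J_Z// -/IX subr0.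
  have : c ^+ 2 * IX <= C3 * H * IX by rewrite ler_wpM2r.
  by clear; lra.
rewrite (J_cat (b := X%:R) lu2)// -/U.
have tail2 : U <= 2 / e * (2 * D * H + C3 * H * B + C2 * H).
  have : 4 / e * (2 * D * H + c ^+ 2 * B + C2 * H) <= 4 / e * (2 * D * H + C3 * H * B + C2 * H).
    by rewrite ler_wpM2l ?divr_ge0 ?(ltW e0)//; move: cB; clear; lra.
  by move: tail'; clear; lra.
by rewrite /K; move: head tail2; clear; lra.
Qed.

(** Suppose phi at E0 and u at E close to E0 are both square integrable, with the
    same initial data. They are orthogonal, because their Wronskian vanishes at 0
    and at infinity. By the tail estimate both have little mass on the far side of a
    suitable X, which is the same for all E near E0, and on [0, X] Gronwall's
    inequality makes u - phi small. So the integral of u phi is close to that of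
    phi^2 over [0, X], which is at least alpha > 0. *)
Lemma eigenvalue_isolated_real V M E0 phi phi1 : lint V -> uniformly_bounded_by V M -> decaying V ->
  E0 < 0 -> solves (fun t => V t - E0) (fun=> 0) phi phi1 -> phi 0 = 0 -> phi1 0 = 1 ->
  sq_bounded phi ->
  exists2 eps, 0 < eps & forall E u u1, `|E - E0| < eps -> E != E0 ->
    solves (fun t => V t - E) (fun=> 0) u u1 -> u 0 = 0 -> u1 0 = 1 -> ~ sq_bounded u.
Proof.
move=> lV [M0 VM] Vd E00 sphi phi0 phi10 bphi.
pose e := - E0 / 2; have e0 : 0 < e by rewrite divr_gt0// oppr_gt0.
pose F := - 2 * E0; have eF : e <= F by rewrite /e /F; lra.
have F0 : 0 < F by lra.
have [X0 X00 X0P] := tail_estimate lV (conj M0 VM) Vd e0 eF.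
have lz : lint (fun=> 0 : R) by exact: lint_cst.
have lz2 : lint (fun=> 0 ^+ 2 : R) by exact: lint_cst.
have lq E : lint (fun t => V t - E) by apply: lintB => //; exact: lint_cst.
have cphi := ac_lcont (proj1 sphi). have cphi1 := ac_lcont (proj2 sphi).
have lphi2 : lint (fun t => phi t ^+ 2) by apply: lcont_lint; exact: lcontX.
have lnphi : lint (fun t => `|phi t|) by apply: lint_norm; exact: lcont_lint.
have decay E u u1 : - F <= E -> E <= - e -> solves (fun t => V t - E) (fun=> 0) u u1 -> sq_bounded u ->
    u n%:R @[n --> \oo] --> 0 /\ u1 n%:R @[n --> \oo] --> 0.
  move=> FE Ee su bu.
  have EF : `|E| <= F by rewrite ler_norml FE/=; lra.
  apply: (solution_decay (uniformly_bounded_by_shift lV (conj M0 VM) EF) (lq E) lz lz2 su bu).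
  by exists 0 => n; rewrite expr0n/= J_cst// mul0r.
(* The boundary term at the far endpoint tends to 0. *)
have tail E u u1 (X n : nat) : - F <= E -> E <= - e -> X0 <= X%:R ->
    solves (fun t => V t - E) (fun=> 0) u u1 -> sq_bounded u ->
    e / 2 * J X%:R (X + n)%:R (fun t => u t ^+ 2) <= `|u X%:R * u1 X%:R|.
  move=> FE Ee X0X su bu.
  have cu := ac_lcont (proj1 su).
  have lu2 : lint (fun t => u t ^+ 2) by apply: lcont_lint; exact: lcontX.
  have [c1 c2] := decay E u u1 FE Ee su bu.
  have c3 : u n%:R * u1 n%:R + `|u X%:R * u1 X%:R| @[n --> \oo] --> 0 * 0 + `|u X%:R * u1 X%:R|.
    by apply: cvgD; [exact: cvgM|exact: cvg_cst].
  rewrite mulr0 add0r in c3.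
  apply: (@ler_cvg_to _ _ _ _ (fun=> _) _ _ _ (cvg_cst _) c3).
  exists (X + n)%N => // m /= Xnm.
  have := X0P E (fun=> 0) u u1 X%:R (m - X)%N FE Ee X0X lz lz2 su.
  rewrite -natrD subnKC ?(leq_trans _ Xnm) ?leq_addr//.
  rewrite [J _ _ (fun=> 0 ^+ 2)](@J_eq _ _ (fun=> 0)); last by move=> *; rewrite expr0n.
  rewrite J_cst ?ler_nat ?(leq_trans _ Xnm) ?leq_addr// mul0r mulr0 addr0 => t1.
  have := ler_norm (- (u X%:R * u1 X%:R)); rewrite normrN => t2.
  have : e / 2 * J X%:R (X + n)%:R (fun t => u t ^+ 2) <= e / 2 * J X%:R m%:R (fun t => u t ^+ 2).
    apply: ler_wpM2l; first by rewrite divr_ge0// ltW.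
    apply: (J_mono lu2); [by []|by rewrite ler_nat leq_addr|by rewrite ler_nat|].
    by move=> t _; exact: sqr_ge0.
  by lra.
have E0F : - F <= E0 by rewrite /F; lra.
have E0e : E0 <= - e by rewrite /e; lra.
pose alpha := J 0 1 (fun t => phi t ^+ 2).
have alpha0 : 0 < alpha by apply: (nonzero_start (proj1 sphi)).
have [c1 c2] := decay _ _ _ E0F E0e sphi bphi.
have c12 : phi n%:R * phi1 n%:R @[n --> \oo] --> (0 * 0 : R) by exact: cvgM.
rewrite mulr0 in c12.
have ea0 : 0 < e / 4 * (alpha / 2) by rewrite mulr_gt0// divr_gt0.
have [X [X1 X0X phiX]] : exists X : nat, [/\ (1 <= X)%N, X0 <= X%:R &
    `|phi X%:R * phi1 X%:R| <= e / 4 * (alpha / 2)].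
  have [N1 N1P] := nat_above X0.
  move/cvgrPdist_le : c12 => /(_ _ ea0)[N2 _ N2P].
  exists (maxn 1 (maxn N1 N2)); split; first by rewrite leq_max leqnn.
    by apply: (le_trans N1P); rewrite ler_nat !leq_max leqnn orbT.
  have := N2P (maxn 1 (maxn N1 N2)); rewrite /= sub0r normrN; apply.
  by rewrite !leq_max leqnn !orbT.
pose B := `|phi X%:R| + `|phi1 X%:R|.
have B0 : 0 <= B by rewrite addr_ge0.
pose I1 := J 0 X%:R (fun t => `|phi t|).
have I10 : 0 <= I1 by exact: J_ge0.
have lG : lint (fun t => 1 + (`|V t| + F)).
  by apply: lintD; [exact: lint_cst|apply: lintD; [exact: lint_norm|exact: lint_cst]].
pose G := I1 * expR (J 0 X%:R (fun t => 1 + (`|V t| + F))).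
have G0 : 0 <= G by rewrite mulr_ge0// expR_ge0.
(* If t bounds |u - phi| + |u' - phi'| on [0, X], the total error is at most
   alpha / 4 + t W. *)
pose W := I1 + 2 / e * (B + 1).
have W0 : 0 <= W.
  exact: addr_ge0 I10 (mulr_ge0 (divr_ge0 (ler0n _ 2) (ltW e0)) (addr_ge0 B0 ler01)).
pose tau := Num.min 1 (alpha / 4 / (W + 1)).
have W1 : 0 < W + 1 by rewrite ltr_wpDl.
have tau0 : 0 < tau by rewrite lt_min ltr01/= !divr_gt0.
have tau1 : tau <= 1 by rewrite ge_min lexx.
have tauW : tau * W < alpha / 2.
  have : tau * (W + 1) <= alpha / 4.
    by rewrite -ler_pdivlMr// ge_min lexx orbT.
  by move: tau0 alpha0; clear; lra.
pose eps := Num.min e (tau / (G + 1)).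
have G1 : 0 < G + 1 by rewrite ltr_wpDl.
have eps0 : 0 < eps by rewrite lt_min e0/= divr_gt0.
exists eps => // E u u1 Eeps EE0 su u0 u10 bu.
have Ee : `|E - E0| <= e by apply: (le_trans (ltW Eeps)); rewrite ge_min lexx.
have Eee : E <= - e by move: Ee; rewrite ler_norml => /andP[_]; rewrite /e; clear; lra.
have FE : - F <= E by move: Ee E00; rewrite ler_norml => /andP[+ _]; rewrite /e /F; clear; lra.
pose t := `|E - E0| * G.
have t0 : 0 <= t by rewrite mulr_ge0.
have ttau : t <= tau.
  have a1 : `|E - E0| <= tau / (G + 1) by apply: (le_trans (ltW Eeps)); rewrite ge_min lexx orbT.
  have : `|E - E0| * (G + 1) <= tau by rewrite -ler_pdivlMr.
  by apply: le_trans; rewrite ler_wpM2l// lerDl.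
pose d s := u s - phi s; pose d1 s := u1 s - phi1 s.
have lhd : lint (fun s => (E - E0) * phi s) by apply: lintZ; exact: lcont_lint.
have sd : solves (fun s => V s - E) (fun s => (E - E0) * phi s) d d1.
  have sphi' : solves (fun s => V s - E) (fun s => (E0 - E) * phi s) phi phi1.
    by apply: solves_eq sphi => // s _; ring.
  by apply: solves_eq (solves_lin 1 su sphi') => s _; rewrite /d /d1; ring.
have dt s : 0 <= s <= X%:R -> `|d s| + `|d1 s| <= t.
  move=> /andP[s0 sX].
  have d00 : d 0 = 0 by rewrite /d u0 phi0 subrr.
  have d10 : d1 0 = 0 by rewrite /d1 u10 phi10 subrr.
  apply: (le_trans (gronwall_sol (lq E) lhd sd d00 d10 s0)).
  have -> : J 0 s (fun x => `|(E - E0) * phi x|) = `|E - E0| * J 0 s (fun x => `|phi x|).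
    by rewrite -J_Z//; apply: J_eq => x _; rewrite normrM.
  rewrite /t /G -mulrA ler_wpM2l//; apply: ler_pM.
  - exact: J_ge0.
  - exact: expR_ge0.
  - exact: J_mono.
  - rewrite ler_expR; apply: (@le_trans _ _ (J 0 s (fun x => 1 + (`|V x| + F)))).
      apply: J_le => //; first by apply: lintD; [exact: lint_cst|exact: lint_norm].
      move=> x _; rewrite lerD2l; apply: (le_trans (ler_normB _ _)); rewrite lerD2l.
      by rewrite ler_norml FE/=; move: Eee e0 F0; clear; lra.
    by apply: J_mono => // x _; rewrite addr_ge0// addr_ge0// ltW.
have cu := ac_lcont (proj1 su). have cd := ac_lcont (proj1 sd).
have lu2 : lint (fun t => u t ^+ 2) by apply: lcont_lint; exact: lcontX.
have luphi : lint (fun t => u t * phi t) by apply: lcont_lint; exact: lcontM.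
have ldphi : lint (fun t => d t * phi t) by apply: lcont_lint; exact: lcontM.
have [cu0 cu10] := decay _ _ _ FE Eee su bu.
have orth : J 0 n%:R (fun s => u s * phi s) @[n --> \oo] --> 0.
  have wr := wronskian_ac su sphi.
  have WE n : J 0 n%:R (fun s => u s * phi s) =
     (E0 - E)^-1 * (u1 n%:R * phi n%:R - u n%:R * phi1 n%:R).
    have EE : E0 - E != 0 by rewrite subr_eq0 eq_sym.
    have := ac_J wr (lexx 0) (ler0n _ n).
    rewrite u0 phi0 mulr0 mul0r subrr subr0 => ->.
    rewrite (@J_eq _ _ (fun s => (E0 - E) * (u s * phi s))); last by move=> s _; ring.
    by rewrite J_Z// mulKf.
  under eq_fun do rewrite WE.
  have cc : (E0 - E)^-1 * (u1 n%:R * phi n%:R - u n%:R * phi1 n%:R) @[n --> \oo] -->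
      (E0 - E)^-1 * (0 * 0 - 0 * 0).
    by apply: cvgMr; apply: cvgB; exact: cvgM.
  by move: cc; rewrite mulr0 subrr mulr0.
have key : `|J 0 X%:R (fun s => u s * phi s)| <= e^-1 * (`|u X%:R * u1 X%:R| + `|phi X%:R * phi1 X%:R|).
  set k := e^-1 * _.
  have c0 : k + `|J 0 n%:R (fun s => u s * phi s)| @[n --> \oo] --> k + `|(0 : R)|.
    by apply: cvgD; [exact: cvg_cst|exact: cvg_norm].
  rewrite normr0 addr0 in c0.
  apply: (@ler_cvg_to _ _ _ _ (fun=> _) _ _ _ (cvg_cst _) c0).
  exists X => // n /= Xn.
  have XnR : X%:R <= n%:R :> R by rewrite ler_nat.
  have X0R : 0 <= X%:R :> R by [].
  have := J_cat luphi (lexx 0) X0R XnR.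
  have b1 : `|J X%:R n%:R (fun s => u s * phi s)| <= k.
    apply: (le_trans (J_norm _ luphi X0R)).
    have := tail E u u1 X (n - X)%N FE Eee X0X su bu.
    have := tail E0 phi phi1 X (n - X)%N E0F E0e X0X sphi bphi.
    rewrite subnKC// => a1 a2.
    have -> : k = e^-1 * `|u X%:R * u1 X%:R| + e^-1 * `|phi X%:R * phi1 X%:R| by rewrite /k mulrDr.
    have a3 : 2^-1 * J X%:R n%:R (fun t => u t ^+ 2) <= e^-1 * `|u X%:R * u1 X%:R|.
      have -> : 2^-1 * J X%:R n%:R (fun t => u t ^+ 2) = e^-1 * (e / 2 * J X%:R n%:R (fun t => u t ^+ 2)).
        by field; rewrite gt_eqF.
      by rewrite ler_wpM2l// invr_ge0 ltW.
    have a4 : 2^-1 * J X%:R n%:R (fun t => phi t ^+ 2) <= e^-1 * `|phi X%:R * phi1 X%:R|.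
      have -> : 2^-1 * J X%:R n%:R (fun t => phi t ^+ 2) = e^-1 * (e / 2 * J X%:R n%:R (fun t => phi t ^+ 2)).
        by field; rewrite gt_eqF.
      by rewrite ler_wpM2l// invr_ge0 ltW.
    apply: le_trans (lerD a3 a4).
    rewrite -(J_Z _ _ lu2 X0R) -(J_Z _ _ lphi2 X0R) -J_D//; [|exact: lintZ|exact: lintZ].
    apply: J_le => //; [exact: lint_norm|by apply: lintD; exact: lintZ|].
    by move=> s _; exact: norm_mul_le.
  move=> E1.
  have -> : J 0 X%:R (fun s => u s * phi s) =
     J 0 n%:R (fun s => u s * phi s) - J X%:R n%:R (fun s => u s * phi s) by rewrite E1 addrK.
  by apply: (le_trans (ler_normB _ _)); rewrite addrC lerD2r.
have X0R : 0 <= X%:R :> R by [].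
have split_ : J 0 X%:R (fun s => u s * phi s) =
    J 0 X%:R (fun s => phi s ^+ 2) + J 0 X%:R (fun s => d s * phi s).
  by rewrite -J_D//; apply: J_eq => s _; rewrite /d; ring.
have dphi : `|J 0 X%:R (fun s => d s * phi s)| <= t * I1.
  apply: (le_trans (J_norm _ ldphi (lexx 0))).
  rewrite /I1 -J_Z//; apply: J_le => //; [exact: lint_norm|exact: lintZ|].
  move=> s sX; rewrite normrM ler_wpM2r//.
  by apply: le_trans (dt s sX); rewrite lerDl.
have alphaX : alpha <= J 0 X%:R (fun s => phi s ^+ 2).
  by apply: J_mono => //; [rewrite ler1n|move=> s _; exact: sqr_ge0].
have uu1 : `|u X%:R * u1 X%:R| <= `|phi X%:R * phi1 X%:R| + t * (B + 1).
  have XX : (0 <= X%:R :> R) && (X%:R <= X%:R :> R) by rewrite X0R lexx.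
  have := dt _ XX => a1.
  have -> : u X%:R * u1 X%:R = phi X%:R * phi1 X%:R +
     (phi X%:R * d1 X%:R + d X%:R * phi1 X%:R + d X%:R * d1 X%:R) by rewrite /d /d1; ring.
  apply: (le_trans (ler_normD _ _)); rewrite lerD2l.
  apply: (le_trans (ler_normD _ _)).
  have a2 := ler_normD (phi X%:R * d1 X%:R) (d X%:R * phi1 X%:R).
  apply: (le_trans (lerD a2 (lexx _))); rewrite (normrM (phi _)) !(normrM (d _)) /B.
  apply: le_pert => //; exact: le_trans ttau tau1.
have ei : 0 < e^-1 by rewrite invr_gt0.
have q1 : e^-1 * (`|u X%:R * u1 X%:R| + `|phi X%:R * phi1 X%:R|) <=
    e^-1 * (2 * (e / 4 * (alpha / 2)) + t * (B + 1)).
  by rewrite ler_wpM2l ?(ltW ei)//; move: uu1 phiX; clear; lra.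
have q2 : e^-1 * (2 * (e / 4 * (alpha / 2)) + t * (B + 1)) = alpha / 4 + e^-1 * (t * (B + 1)).
  by field; rewrite gt_eqF.
have q3 : e^-1 * (t * (B + 1)) <= t * (2 / e * (B + 1)).
  have -> : t * (2 / e * (B + 1)) = 2 * (e^-1 * (t * (B + 1))) by ring.
  have : 0 <= e^-1 * (t * (B + 1)) by rewrite mulr_ge0 ?(ltW ei)// mulr_ge0// addr_ge0.
  by clear; lra.
have q4 : t * W <= tau * W by rewrite ler_wpM2r.
move: key; rewrite split_ => key.
have := ler_norm (J 0 X%:R (fun s => phi s ^+ 2) + J 0 X%:R (fun s => d s * phi s)).
have := ler_norm (- J 0 X%:R (fun s => d s * phi s)); rewrite normrN.
have q5 : t * W = t * I1 + t * (2 / e * (B + 1)) by rewrite /W; ring.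
by move: alpha0 key q1 q2 q3 q4 q5 alphaX dphi tauW; clear; lra.
Qed.

(** The Wronskian of the real and imaginary parts satisfies
    (u' v - u v')' = b (u^2 + v^2) - h1 v + h2 u. *)
Lemma nonreal_bound V a b h1 h2 u u1 v v1 n : b != 0 ->
  lint h1 -> lint h2 -> lint (fun t => h1 t ^+ 2) -> lint (fun t => h2 t ^+ 2) ->
  solves (fun t => V t - a) (fun t => h1 t - b * v t) u u1 ->
  solves (fun t => V t - a) (fun t => h2 t + b * u t) v v1 ->
  u 0 = 0 -> v 0 = 0 -> 0 <= n ->
  b ^+ 2 * J 0 n (fun t => u t ^+ 2 + v t ^+ 2) <=
  2 * (b * (u1 n * v n - u n * v1 n)) + J 0 n (fun t => h1 t ^+ 2 + h2 t ^+ 2).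
Proof.
move=> b0 lh1 lh2 lh12 lh22 su sv u0 v0 n0.
have cu := ac_lcont (proj1 su); have cv := ac_lcont (proj1 sv).
have lu2 : lint (fun t => u t ^+ 2) by apply: lcont_lint; exact: lcontX.
have lv2 : lint (fun t => v t ^+ 2) by apply: lcont_lint; exact: lcontX.
have luv : lint (fun t => u t ^+ 2 + v t ^+ 2) by exact: lintD.
have lhh : lint (fun t => h1 t ^+ 2 + h2 t ^+ 2) by exact: lintD.
have wr := wronskian_ac su sv.
have := ac_J wr (lexx 0) n0; rewrite u0 v0 mulr0 mul0r subrr subr0 => ->.
have lw := ac_lint wr.
rewrite -(J_Z _ _ lw (lexx 0)) -(J_Z _ _ (lintZ b lw) (lexx 0)) -(J_Z _ _ luv (lexx 0)).
rewrite -(J_D _ (lintZ 2 (lintZ b lw)) lhh (lexx 0)).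
apply: J_le => //; [exact: lintZ|by apply: lintD => //; apply: lintZ; exact: lintZ|].
move=> t _.
set U := u t; set W := v t; set x := h1 t; set y := h2 t.
have -> : 2 * (b * ((V t - a - (V t - a)) * (U * W) - (x - b * W) * W + (y + b * U) * U)) +
   (x ^+ 2 + y ^+ 2) = b ^+ 2 * (U ^+ 2 + W ^+ 2) + ((x - b * W) ^+ 2 + (y + b * U) ^+ 2) by ring.
by rewrite lerDl addr_ge0// sqr_ge0.
Qed.

End AprioriBounds.

(** * From a priori bounds to the resolvent *)

Section Resolvent.
Context {R : realType}.
Local Notation mu := (@lebesgue_measure R).
Local Notation J a b f := (Rintegral mu `[a, b]%classic f).
Local Notation Re := (@complex.Re R).
Local Notation Im := (@complex.Im R).
Local Notation halfline := (`]0%R, +oo[%classic : set R).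

(** A point common to a decreasing sequence of closed sublevel sets, each of which
    meets a fixed compact box. *)
Lemma nested_sublevel_point (Q : nat -> R * R -> R) (L b : R) (N0 : nat) :
  (forall m, continuous (Q m)) ->
  (forall m n c, (m <= n)%N -> Q m c <= Q n c) ->
  (forall n, (N0 <= n)%N -> exists c, [/\ `|c.1| <= b, `|c.2| <= b & Q n c <= L]) ->
  exists c, forall m, Q m c <= L.
Proof.
move=> cQ mQ exQ.
have /choice [c cP] : forall n, exists c, [/\ `|c.1| <= b, `|c.2| <= b & Q (N0 + n)%N c <= L].
  by move=> n; apply: exQ; exact: leq_addr.
pose box : set (R * R) := `[- b, b]%classic `*` `[- b, b]%classic.
have cbox : compact box by apply: compact_setX; exact: segment_compact.
have Fbox : (c @ \oo) box.
  exists 0%N => // n _ /=; have [h1 h2 _] := cP n.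
  by split; rewrite /= in_itv/= -ler_norml.
have [p [_ clp]] := cbox (c @ \oo) _ Fbox.
exists p => m; rewrite leNgt; apply/negP => Lp.
have nb : nbhs p [set x | L < Q m x].
  have := cQ m p; move=> /cvgrPdist_lt/(_ (Q m p - L)); rewrite subr_gt0 => /(_ Lp).
  apply: filterS => x /=; rewrite ltr_norml => /andP[_]; rewrite /=; lra.
have Fm : (c @ \oo) [set x | Q m x <= L].
  exists m => // n /= mn; have [_ _] := cP n.
  by apply: le_trans; apply: mQ; exact: leq_trans (leq_addl _ _).
have [x [/= h1 h2]] := clp _ _ Fm nb.
by move: h2; rewrite ltNge h1.
Qed.

Lemma L2_axpy (z : R[i]) (h f : R -> R[i]) : L2_halfline h -> L2_halfline f ->
  L2_halfline (fun x => h x + z * f x).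
Proof.
move=> /L2P[lh [C hC]] /L2P[lf [D fD]].
have [lh1 lh2 lh12 lh22] := lh; have [lf1 lf2 lf12 lf22] := lf.
have lg1 : lint (Re \o (fun x => h x + z * f x)).
  have -> : Re \o (fun x => h x + z * f x) =
    fun x => Re (h x) + (Re z * Re (f x) - Im z * Im (f x)).
    by apply/funext => x /=; case: (z) => a b; case: (h x) => ? ?; case: (f x) => ? ? /=.
  by apply: lintD => //; apply: lintB; exact: lintZ.
have lg2 : lint (Im \o (fun x => h x + z * f x)).
  have -> : Im \o (fun x => h x + z * f x) =
    fun x => Im (h x) + (Re z * Im (f x) + Im z * Re (f x)).
    by apply/funext => x /=; case: (z) => a b; case: (h x) => ? ?; case: (f x) => ? ? /=.
  by apply: lintD => //; apply: lintD; exact: lintZ.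
pose w := Re z ^+ 2 + Im z ^+ 2.
have w0 : 0 <= w by rewrite addr_ge0// sqr_ge0.
pose k x := 2 * modsq h x + 2 * w * modsq f x.
have lmh := L2loc_modsq lh; have lmf := L2loc_modsq lf.
have lk : lint k by apply: lintD; exact: lintZ.
have gk x : modsq (fun x => h x + z * f x) x <= k x.
  rewrite /k /modsq /w; case: (z) => a b; case: (h x) => p q; case: (f x) => r s /=.
  have -> : 2 * (p ^+ 2 + q ^+ 2) + 2 * (a ^+ 2 + b ^+ 2) * (r ^+ 2 + s ^+ 2) =
    ((p + (a * r - b * s)) ^+ 2 + (q + (a * s + b * r)) ^+ 2) +
    ((p - (a * r - b * s)) ^+ 2 + (q - (a * s + b * r)) ^+ 2) by ring.
  by rewrite lerDl addr_ge0// sqr_ge0.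
have k0 x : 0 <= k x by apply: le_trans (gk x); exact: modsq_ge0.
have lg : L2loc (fun x => h x + z * f x).
  split=> //.
    apply: (lint_of_sq_le k0 (lint_halfline_measurable lg1) lk) => x.
    by apply: le_trans (gk x); rewrite /modsq lerDl sqr_ge0.
  apply: (lint_of_sq_le k0 (lint_halfline_measurable lg2) lk) => x.
  by apply: le_trans (gk x); rewrite /modsq lerDr sqr_ge0.
apply/L2P; split=> //; exists (2 * C + 2 * w * D) => n.
apply: (@le_trans _ _ (J 0 n%:R k)).
  by apply: J_le => //; exact: L2loc_modsq.
rewrite J_D//; [|exact: lintZ|exact: lintZ].
by rewrite !J_Z//; apply: lerD; rewrite ler_wpM2l// mulr_ge0.
Qed.

Section Apriori.
Context (V : R -> R) (lV : lint V) (z : R[i]).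
Local Notation T := (schroedinger V).

Lemma schroedinger_zP (h f : R -> R[i]) : L2_halfline h ->
  (T f (fun x => h x + z * f x) <->
  [/\ L2_halfline f, f 0 = 0 & exists u1 v1 : R -> R,
    solves (fun t => V t - Re z) (fun t => Re (h t) - Im z * Im (f t)) (Re \o f) u1 /\
    solves (fun t => V t - Re z) (fun t => Im (h t) + Im z * Re (f t)) (Im \o f) v1]).
Proof.
move=> Lh; split=> [/(schroedinger_elim lV)[Lf Lg f0 [u1 [v1 [su sv]]]]|[Lf f0 [u1 [v1 [su sv]]]]].
  split=> //; exists u1, v1; split.
    apply: solves_eq su => // t _; rewrite /=.
    by case: (z) => a b; case: (h t) => ? ?; case: (f t) => ? ? /=; ring.
  apply: solves_eq sv => // t _; rewrite /=.
  by case: (z) => a b; case: (h t) => ? ?; case: (f t) => ? ? /=; ring.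
apply: (schroedinger_intro (u1 := u1) (v1 := v1)) => //; first exact: L2_axpy.
  apply: solves_eq su => // t _; rewrite /=.
  by case: (z) => a b; case: (h t) => ? ?; case: (f t) => ? ? /=; ring.
apply: solves_eq sv => // t _; rewrite /=.
by case: (z) => a b; case: (h t) => ? ?; case: (f t) => ? ? /=; ring.
Qed.

Lemma L2_0 : L2_halfline (fun=> 0 : R[i]).
Proof.
apply/L2P; split; first by split; rewrite ?expr0n; exact: lint_cst.
exists 0 => n; rewrite (@J_eq _ _ (fun=> 0)); first by rewrite J_cst// mul0r.
by move=> t _; rewrite /modsq/= expr0n/= addr0.
Qed.

Lemma eigenfunctionP (f : R -> R[i]) : eigenfunction T z f <->
  [/\ L2_halfline f, f 0 = 0 & exists u1 v1 : R -> R,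
    solves (fun t => V t - Re z) (fun t => - (Im z * Im (f t))) (Re \o f) u1 /\
    solves (fun t => V t - Re z) (fun t => Im z * Re (f t)) (Im \o f) v1].
Proof.
have -> : eigenfunction T z f = T f (fun x => (fun=> 0) x + z * f x).
  by rewrite /eigenfunction; congr (T f _); apply/funext => x; rewrite add0r.
split=> [/(schroedinger_zP _ L2_0)[Lf f0 [u1 [v1 [su sv]]]]|[Lf f0 [u1 [v1 [su sv]]]]].
  split=> //; exists u1, v1; split.
    by apply: solves_eq su => // t _ /=; ring.
  by apply: solves_eq sv => // t _ /=; ring.
apply/(schroedinger_zP _ L2_0); split=> //; exists u1, v1; split.
  by apply: solves_eq su => // t _ /=; ring.
by apply: solves_eq sv => // t _ /=; ring.
Qed.

Lemma ae_eq0_of_modsq (f : R -> R[i]) : L2loc f -> (forall n : nat, J 0 n%:R (modsq f) <= 0) ->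
  ae_eq mu halfline f (fun=> 0).
Proof.
move=> lf f0.
have : (normc2_integral f <= 0%:E)%E by apply/normc2P.
rewrite normc2_integralE => le0.
have mm := lint_halfline_measurable (L2loc_modsq lf).
have : ae_eq mu halfline (EFin \o modsq f) (cst 0%E).
  apply/ae_eq_integral_abs => //; first exact/measurable_EFinP.
  apply/eqP; rewrite eq_le integral_ge0// andbT; apply: le_trans le0.
  by under eq_integral do rewrite /= ger0_norm ?modsq_ge0//.
apply: ae_imp => t /= + ht => /(_ ht) [].
rewrite /modsq; case: (f t) => a b /= /eqP.
rewrite paddr_eq0 ?sqr_ge0// !sqrf_eq0 => /andP[/eqP -> /eqP ->].
by [].
Qed.

(** A bound for the Dirichlet problems on [0, n] that is uniform in n yields a
    bounded inverse on the half-line. Let p + i r solve the inhomogeneous equation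
    with zero initial data and f + i g the homogeneous one with slope 1 at 0. For
    each large n some c makes the solution (p + i r) + c (f + i g) vanish at n, so
    that its norm on [0, n] is at most K H; the mass of f + i g on [0, 1] then
    bounds c. By compactness one c works for all n. *)
Lemma resolvent_of_apriori (K : R) (N0 : nat) : 0 <= K ->
  (forall h1 h2 u u1 v v1 (n : nat), (N0 <= n)%N ->
     lint h1 -> lint h2 -> lint (fun t => h1 t ^+ 2) -> lint (fun t => h2 t ^+ 2) ->
     solves (fun t => V t - Re z) (fun t => h1 t - Im z * v t) u u1 ->
     solves (fun t => V t - Re z) (fun t => h2 t + Im z * u t) v v1 ->
     u 0 = 0 -> v 0 = 0 -> u n%:R = 0 -> v n%:R = 0 ->
     J 0 n%:R (fun t => u t ^+ 2 + v t ^+ 2) <= K * J 0 n%:R (fun t => h1 t ^+ 2 + h2 t ^+ 2)) ->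
  ~ eigenvalue_of_operator T z -> resolvent_set T z.
Proof.
move=> K0 AP nev; exists K => h Lh.
have /L2P[lh _] := Lh; have [lh1 lh2 lh12 lh22] := lh.
have [p [p1 [r [r1 [p0 r0 p10 r10 [sp sr]]]]]] := ivp_exists (Re z) (Im z) 0 lV lh1 lh2.
have lz : lint (fun=> 0 : R) by exact: lint_cst.
have [f [f1 [g [g1 [f0 g0 f10 g10 [sf sg]]]]]] := ivp_exists (Re z) (Im z) 1 lV lz lz.
pose H := fine (normc2_integral h).
have HE : normc2_integral h = H%:E.
  rewrite fineK// ge0_fin_numE//; first by case: Lh.
  by rewrite normc2_integralE; apply: integral_ge0 => t _; rewrite lee_fin modsq_ge0.
have hH n : J 0 n%:R (modsq h) <= H by apply: (normc2P _ lh).1; rewrite HE.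
pose u (c : R * R) t := p t + (c.1 * f t - c.2 * g t).
pose u1 (c : R * R) t := p1 t + (c.1 * f1 t - c.2 * g1 t).
pose v (c : R * R) t := r t + (c.1 * g t + c.2 * f t).
pose v1 (c : R * R) t := r1 t + (c.1 * g1 t + c.2 * f1 t).
have su c : solves (fun t => V t - Re z) (fun t => (Re \o h) t - Im z * v c t) (u c) (u1 c).
  case: (sp) => a1 a2; case: (sf) => b1 b2; case: (sg) => d1 d2; split.
    by apply: acD a1 (acB (acZ _ b1) (acZ _ d1)).
  by apply: ac_eq (acD a2 (acB (acZ c.1 b2) (acZ c.2 d2))) => // t _; rewrite /u /v; ring.
have sv c : solves (fun t => V t - Re z) (fun t => (Im \o h) t + Im z * u c t) (v c) (v1 c).
  case: (sr) => a1 a2; case: (sf) => b1 b2; case: (sg) => d1 d2; split.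
    by apply: acD a1 (acD (acZ _ d1) (acZ _ b1)).
  by apply: ac_eq (acD a2 (acD (acZ c.1 d2) (acZ c.2 b2))) => // t _; rewrite /u /v; ring.
have u0 c : u c 0 = 0 by rewrite /u p0 f0 g0 !mulr0 subrr addr0.
have v0 c : v c 0 = 0 by rewrite /v r0 f0 g0 !mulr0 !addr0.
have cp := ac_lcont (proj1 sp); have cr := ac_lcont (proj1 sr).
have cf := ac_lcont (proj1 sf); have cg := ac_lcont (proj1 sg).
have lf2 : lint (fun t => f t ^+ 2) by apply: lcont_lint; exact: lcontX.
have lfg : lint (fun t => f t ^+ 2 + g t ^+ 2).
  by apply: lcont_lint; apply: lcontD; exact: lcontX.
have lpr : lint (fun t => p t ^+ 2 + r t ^+ 2).
  by apply: lcont_lint; apply: lcontD; exact: lcontX.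
have cu c : lcont (u c) := ac_lcont (proj1 (su c)).
have cv c : lcont (v c) := ac_lcont (proj1 (sv c)).
have luv c : lint (fun t => u c t ^+ 2 + v c t ^+ 2).
  by apply: lcont_lint; apply: lcontD; exact: lcontX.
pose I1 := J 0 1 (fun t => f t ^+ 2 + g t ^+ 2).
have I10 : 0 < I1.
  apply: lt_le_trans (nonzero_start (proj1 sf) (ac_lcont (proj2 sf)) f0 f10) _.
  by apply: J_le => // t _; rewrite lerDl sqr_ge0.
(* If f + i g vanished at n, the a priori bound with h = 0 would force it to be 0. *)
have ends n : (maxn 1 N0 <= n)%N -> exists c, u c n%:R = 0 /\ v c n%:R = 0.
  rewrite geq_max => /andP[n1 N0n].
  pose D := f n%:R ^+ 2 + g n%:R ^+ 2.
  have D0 : D != 0.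
    apply/negP; rewrite /D paddr_eq0 ?sqr_ge0// !sqrf_eq0 => /andP[/eqP fn /eqP gn].
    have l02 : lint (fun=> 0 ^+ 2 : R) by exact: lint_cst.
    have := AP _ _ _ _ _ _ n N0n lz lz l02 l02 sf sg f0 g0 fn gn.
    rewrite [X in K * X](@J_eq _ _ (fun=> 0)); last by move=> t _; rewrite expr0n addr0.
    rewrite J_cst// mul0r mulr0 leNgt => /negP; apply; apply: (lt_le_trans I10).
    by apply: J_mono => //; [rewrite ler1n|move=> t _; rewrite addr_ge0// sqr_ge0].
  exists (- (p n%:R * f n%:R + r n%:R * g n%:R) / D, (p n%:R * g n%:R - r n%:R * f n%:R) / D).
  rewrite /u /v/=; split; rewrite -(mulfK D0 (p n%:R)) -(mulfK D0 (r n%:R)) /D; field; exact: D0.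
pose P := J 0 1 (fun t => p t ^+ 2 + r t ^+ 2).
have P0 : 0 <= P by apply: J_ge0 => t _; rewrite addr_ge0// sqr_ge0.
have H0 : 0 <= H by apply: le_trans (hH 0%N); apply: J_ge0 => t _; exact: modsq_ge0.
pose b := (2 * (K * H) + 2 * P) / I1 + 1.
have b1 : 1 <= b by rewrite lerDr divr_ge0 ?(ltW I10)// addr_ge0// mulr_ge0// mulr_ge0.
pose Q (n : nat) (c : R * R) := J 0 n%:R (fun t => u c t ^+ 2 + v c t ^+ 2).
have Qmono m n c : (m <= n)%N -> Q m c <= Q n c.
  move=> mn; apply: J_mono => //; first by rewrite ler_nat.
  by move=> t _; rewrite addr_ge0// sqr_ge0.
have lB : lint (fun t => p t * f t + r t * g t) by apply: lcont_lint; apply: lcontD; exact: lcontM.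
have lC : lint (fun t => r t * f t - p t * g t) by apply: lcont_lint; apply: lcontB; exact: lcontM.
(* Q m is a quadratic polynomial in c, hence continuous. *)
have QE m c : Q m c = J 0 m%:R (fun t => p t ^+ 2 + r t ^+ 2) +
    (2 * c.1 * J 0 m%:R (fun t => p t * f t + r t * g t) +
     (2 * c.2 * J 0 m%:R (fun t => r t * f t - p t * g t) +
     (c.1 ^+ 2 + c.2 ^+ 2) * J 0 m%:R (fun t => f t ^+ 2 + g t ^+ 2))).
  have l2 := lintZ (2 * c.1) lB; have l3 := lintZ (2 * c.2) lC.
  have l4 := lintZ (c.1 ^+ 2 + c.2 ^+ 2) lfg.
  rewrite -(J_Z _ _ lB (lexx 0)) -(J_Z _ _ lC (lexx 0)) -(J_Z _ _ lfg (lexx 0)).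
  rewrite -(J_D _ l3 l4 (lexx 0)) -(J_D _ l2 (lintD l3 l4) (lexx 0)).
  rewrite -(J_D _ lpr (lintD l2 (lintD l3 l4)) (lexx 0)).
  by apply: J_eq => t _; rewrite /u /v; ring.
have Qcont m : continuous (Q m).
  have -> : Q m = fun c => J 0 m%:R (fun t => p t ^+ 2 + r t ^+ 2) +
    (2 * c.1 * J 0 m%:R (fun t => p t * f t + r t * g t) +
     (2 * c.2 * J 0 m%:R (fun t => r t * f t - p t * g t) +
     (c.1 ^+ 2 + c.2 ^+ 2) * J 0 m%:R (fun t => f t ^+ 2 + g t ^+ 2))).
    by apply/funext => c; exact: QE.
  move=> c.
  have c1 : (fun c : R * R => c.1) @ c --> c.1 by exact: cvg_fst.
  have c2 : (fun c : R * R => c.2) @ c --> c.2 by exact: cvg_snd.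
  apply: cvgD; first exact: cvg_cst.
  apply: cvgD; first by apply: cvgM; [apply: cvgM => //; exact: cvg_cst|exact: cvg_cst].
  apply: cvgD; first by apply: cvgM; [apply: cvgM => //; exact: cvg_cst|exact: cvg_cst].
  by apply: cvgM; [apply: cvgD; rewrite expr2; apply: cvgM|exact: cvg_cst].
have [c cQ] : exists c, forall m, Q m c <= K * H.
  apply: (@nested_sublevel_point _ _ b (maxn 1 N0)) => // n n1N0.
  have [c [un vn]] := ends n n1N0; exists c.
  have /andP[n1 N0n] : (1 <= n)%N && (N0 <= n)%N by rewrite -geq_max.
  have QnKH : Q n c <= K * H.
    apply: (le_trans (AP _ _ _ _ _ _ n N0n lh1 lh2 lh12 lh22 (su c) (sv c) (u0 c) (v0 c) un vn)).
    by rewrite ler_wpM2l//; exact: hH.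
  suff cb : c.1 ^+ 2 + c.2 ^+ 2 <= b.
    have hb (x y : R) : x ^+ 2 + y ^+ 2 <= b -> `|x| <= b.
      rewrite -(real_normK (num_real x)).
      have := sqr_ge0 y; have := sqr_ge0 (`|x| - 1); have : 0 <= `|x| by [].
      by move: b1; clear; nra.
    by split=> //; [exact: (hb _ c.2)|apply: (hb _ c.1); rewrite addrC].
  suff : c.1 ^+ 2 + c.2 ^+ 2 <= (2 * (K * H) + 2 * P) / I1 by rewrite /b; lra.
  rewrite ler_pdivlMr// -J_Z//.
  have i1 : J 0 1 (fun t => u c t ^+ 2 + v c t ^+ 2) <= K * H.
    by apply: le_trans QnKH; exact: (Qmono 1%N).
  apply: (@le_trans _ _ (J 0 1 (fun t => 2 * (u c t ^+ 2 + v c t ^+ 2) + 2 * (p t ^+ 2 + r t ^+ 2)))).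
    apply: J_le => //; [exact: lintZ|by apply: lintD; exact: lintZ|].
    move=> t _; rewrite /u /v.
    set F := f t; set G := g t; set x := p t; set y := r t.
    have -> : 2 * ((x + (c.1 * F - c.2 * G)) ^+ 2 + (y + (c.1 * G + c.2 * F)) ^+ 2) + 2 * (x ^+ 2 + y ^+ 2)
      = (c.1 ^+ 2 + c.2 ^+ 2) * (F ^+ 2 + G ^+ 2) +
        ((2 * x + (c.1 * F - c.2 * G)) ^+ 2 + (2 * y + (c.1 * G + c.2 * F)) ^+ 2) by ring.
    by rewrite lerDl addr_ge0// sqr_ge0.
  rewrite J_D//; [|exact: lintZ|exact: lintZ].
  by rewrite !J_Z// -/P lerD2r ler_wpM2l.
pose w t := u c t +i* v c t.
have lw : L2loc w.
  split; [exact: lcont_lint (cu c)|exact: lcont_lint (cv c)| |].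
    by change (lint (fun t => u c t ^+ 2)); apply: lcont_lint; exact: lcontX.
  by change (lint (fun t => v c t ^+ 2)); apply: lcont_lint; exact: lcontX.
have wK n : J 0 n%:R (modsq w) <= K * H by exact: cQ.
have Lw : L2_halfline w by apply/L2P; split=> //; exists (K * H).
have Tw : T w (fun x => h x + z * w x).
  apply/schroedinger_zP => //; split=> //.
    by apply/eqP; rewrite eq_complex/= u0 v0 eqxx.
  by exists (u1 c), (v1 c); split; [exact: su|exact: sv].
exists w; split => //; last by rewrite HE -EFinM; apply/normc2P.
move=> w' Tw'.
have ef : eigenfunction T z (fun t => w' t - w t).
  have [Lw' w'0 [u' [v' [su' sv']]]] := (schroedinger_zP w' Lh).1 Tw'.
  apply/eigenfunctionP; split.
  - have := L2_axpy (-1) Lw' Lw; congr (L2_halfline _).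
    by apply/funext => t; rewrite mulN1r.
  - by rewrite w'0; apply/eqP; rewrite eq_complex/= u0 v0 subrr eqxx.
  exists (fun t => u' t - 1 * u1 c t), (fun t => v' t - 1 * v1 c t); split.
    apply: solves_eq (solves_lin 1 su' (su c)) => // t _ /=; case: (w' t) => ? ? /=; ring.
  apply: solves_eq (solves_lin 1 sv' (sv c)) => // t _ /=; case: (w' t) => ? ? /=; ring.
have : ae_eq mu halfline (fun t => w' t - w t) (fun=> 0).
  by apply: contrapT => ne; apply: nev; exists (fun t => w' t - w t).
by apply: ae_imp => t /= + ht => /(_ ht)/eqP; rewrite subr_eq0 => /eqP.
Qed.

End Apriori.
End Resolvent.

(** * The essential spectrum *)

Section EssentialSpectrum.
Context {R : realType}.
Local Notation mu := (@lebesgue_measure R).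
Local Notation J a b f := (Rintegral mu `[a, b]%classic f).
Local Notation Re := (@complex.Re R).
Local Notation Im := (@complex.Im R).
Local Notation halfline := (`]0%R, +oo[%classic : set R).

(** Neighbourhoods are defined through the complex-valued norm; here they are
    described with a real radius. *)
Lemma nbhs_normcP (x : R[i]) (A : set R[i]) :
  nbhs x A <-> exists2 e : R, 0 < e & forall w, Normc.normc (x - w) < e -> A w.
Proof.
have nE (w : R[i]) : `|w| = (Normc.normc w)%:C by [].
split=> [/nbhs_ballP[e /= e0 eA]|[e e0 eA]].
  move: e0 eA; case: e => a b; rewrite ltcE/= => /andP[/eqP -> a0] eA.
  exists a => // w xw; apply: eA; rewrite /ball/= nE.
  by rewrite ltcE/= xw eqxx.
apply/nbhs_ballP; exists e%:C; first by rewrite /= ltcR.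
by move=> w; rewrite /ball/= nE ltcR; exact: eA.
Qed.

Context (V : R -> R) (M : R) (lV : lint V) (VM : uniformly_bounded_by V M) (Vd : decaying V).
Local Notation T := (schroedinger V).

Lemma lint_shift E : lint (fun t => V t - E).
Proof. by apply: lintB => //; exact: lint_cst. Qed.

Lemma lint0 : lint (fun=> 0 : R). Proof. exact: lint_cst. Qed.

Lemma solution_multiple E phi phi1 u u1 :
  solves (fun t => V t - E) (fun=> 0) phi phi1 -> phi 0 = 0 -> phi1 0 = 1 ->
  solves (fun t => V t - E) (fun=> 0) u u1 -> u 0 = 0 ->
  forall x, 0 <= x -> u x = u1 0 * phi x.
Proof.
move=> sphi phi0 phi10 su u0 x x0.
have sd := solves_lin (u1 0) su sphi.
have {}sd : solves (fun t => V t - E) (fun=> 0) (fun t => u t - u1 0 * phi t)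
   (fun t => u1 t - u1 0 * phi1 t) by apply: solves_eq sd => // t _ /=; ring.
have := gronwall_sol (lint_shift E) lint0 sd; rewrite u0 phi0 phi10 mulr0 mulr1 !subrr.
move=> /(_ x erefl erefl x0).
have J0 : J 0 x (fun=> `|0 : R|) = 0 by rewrite J_cst// normr0 mul0r.
rewrite J0 mul0r => le0.
apply/eqP; rewrite -subr_eq0 -normr_le0; apply: le_trans le0.
by rewrite lerDl.
Qed.

Lemma eigenfunction_multiple E phi phi1 f :
  solves (fun t => V t - E) (fun=> 0) phi phi1 -> phi 0 = 0 -> phi1 0 = 1 ->
  eigenfunction T E%:C f -> exists c : R[i], forall x, 0 <= x -> f x = c * (phi x)%:C.
Proof.
move=> sphi phi0 phi10 /(eigenfunctionP lV)[_ f0 [u1 [v1 [su sv]]]].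
have {}su : solves (fun t => V t - E) (fun=> 0) (Re \o f) u1.
  by apply: solves_eq su => // t _ /=; ring.
have {}sv : solves (fun t => V t - E) (fun=> 0) (Im \o f) v1.
  by apply: solves_eq sv => // t _ /=; ring.
have u0 : (Re \o f) 0 = 0 by rewrite /= f0.
have v0 : (Im \o f) 0 = 0 by rewrite /= f0.
exists (u1 0 +i* v1 0) => x x0.
have := solution_multiple sphi phi0 phi10 su u0 x0.
have := solution_multiple sphi phi0 phi10 sv v0 x0.
rewrite /=; case: (f x) => a b /= -> ->.
by apply/eqP; rewrite eq_complex/= !mulr0 subr0 add0r !eqxx.
Qed.

(** Every eigenfunction at a real energy E is a multiple of the solution phi of the
    initial value problem. *)
Lemma eigenvalue_sq_bounded E phi phi1 :
  solves (fun t => V t - E) (fun=> 0) phi phi1 -> phi 0 = 0 -> phi1 0 = 1 ->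
  eigenvalue_of_operator T E%:C <-> sq_bounded phi.
Proof.
move=> sphi phi0 phi10.
have cphi := ac_lcont (proj1 sphi).
have lphi2 : lint (fun t => phi t ^+ 2) by apply: lcont_lint; exact: lcontX.
split=> [[f ef nf]|[C phiC]].
  have [c fE] := eigenfunction_multiple sphi phi0 phi10 ef.
  have [c0|c0] := eqVneq c 0.
    exfalso; apply: nf; apply: aeW => t; rewrite /= in_itv/= andbT => t0.
    by rewrite fE ?ltW// c0 mul0r.
  have /(eigenfunctionP lV)[/L2P[lf [C fC]] _ _] := ef.
  pose w := Re c ^+ 2 + Im c ^+ 2.
  have w0 : 0 < w.
    rewrite lt_def addr_ge0 ?sqr_ge0// andbT paddr_eq0 ?sqr_ge0// !sqrf_eq0.
    by apply: contra c0; rewrite eq_complex.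
  exists (C / w) => n; rewrite ler_pdivlMr// mulrC -J_Z//.
  apply: le_trans (fC n); apply: J_le => //; [exact: lintZ|exact: L2loc_modsq|].
  move=> t /andP[t0 _]; rewrite /modsq fE// /w; case: (c) => a b /=.
  by rewrite le_eqVlt; apply/orP; left; apply/eqP; ring.
pose f t := (phi t)%:C.
have lf : L2loc f.
  split; [exact: lcont_lint cphi|exact: lint0|exact: lphi2|].
  by rewrite /= expr0n; exact: lint0.
exists f.
  apply/(eigenfunctionP lV); split.
  - apply/L2P; split=> //; exists C => n.
    have -> : modsq f = fun t => phi t ^+ 2.
      by apply/funext => t; rewrite /modsq /= expr0n addr0.
    exact: phiC.
  - by rewrite /f phi0.
  - exists phi1, (fun=> 0); split.
      by apply: solves_eq sphi => // t _ /=; ring.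
    split; first exact: ac_cst.
    by apply: ac_eq (ac_cst 0) => // t _ /=; ring.
move=> f0.
have := nonzero_start (proj1 sphi) (ac_lcont (proj2 sphi)) phi0 phi10.
have := ac_ae (ac_prim 0 lphi2) lint0.
case=> [|_ /(_ 1 ler01)].
  apply: ae_imp f0 => t /= + ht => /(_ ht) [->].
  by rewrite expr0n.
by rewrite !add0r J_pt add0r [in RHS]J_cst// mul0r => ->; rewrite ltxx.
Qed.

Lemma negative_resolvent_or_eigenvalue E phi phi1 : E < 0 ->
  solves (fun t => V t - E) (fun=> 0) phi phi1 -> phi 0 = 0 -> phi1 0 = 1 ->
  ~ sq_bounded phi -> resolvent_set T E%:C.
Proof.
move=> E0 sphi phi0 phi10 nb.
have nev : ~ eigenvalue_of_operator T E%:C by move/(eigenvalue_sq_bounded sphi phi0 phi10).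
have [K [N0 [K0 KP]]] := dirichlet_bound_real lV VM Vd E0 sphi phi0 phi10 nb.
apply: (resolvent_of_apriori lV K0 (N0 := N0) _ nev).
move=> h1 h2 u u1 v v1 n N0n lh1 lh2 lh12 lh22 su sv u0 v0 un vn.
have {}su : solves (fun t => V t - E) h1 u u1 by apply: solves_eq su => // t _ /=; ring.
have {}sv : solves (fun t => V t - E) h2 v v1 by apply: solves_eq sv => // t _ /=; ring.
have cu := ac_lcont (proj1 su); have cv := ac_lcont (proj1 sv).
rewrite J_D//; [|by apply: lcont_lint; exact: lcontX|by apply: lcont_lint; exact: lcontX].
rewrite (J_D _ lh12 lh22)// mulrDr; apply: lerD; first exact: KP su u0 un.
exact: KP sv v0 vn.
Qed.

(** For an eigenfunction the boundary terms in the Wronskian identity tend to 0, so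
    the identity forces its norm to vanish. *)
Lemma nonreal_not_eigenvalue z : Im z != 0 -> ~ eigenvalue_of_operator T z.
Proof.
move=> b0 [f /(eigenfunctionP lV)[/L2P[lf [C fC]] f0 [u1 [v1 [su sv]]]]]; apply.
have [lf1 lf2 lf12 lf22] := lf.
have cu := ac_lcont (proj1 su); have cv := ac_lcont (proj1 sv).
have bu : sq_bounded (Re \o f).
  exists C => n; apply: le_trans (fC n); apply: J_le => //; first exact: L2loc_modsq.
  by move=> t _; rewrite /modsq lerDl sqr_ge0.
have bv : sq_bounded (Im \o f).
  exists C => n; apply: le_trans (fC n); apply: J_le => //; first exact: L2loc_modsq.
  by move=> t _; rewrite /modsq lerDr sqr_ge0.
have scal (g : R -> R) k : lint (fun t => g t ^+ 2) -> sq_bounded g -> sq_bounded (fun t => k * g t).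
  move=> lg [D gD]; exists (k ^+ 2 * D) => n.
  rewrite (@J_eq _ _ (fun t => k ^+ 2 * g t ^+ 2)); last by move=> t _; rewrite exprMn.
  by rewrite J_Z// ler_wpM2l// sqr_ge0.
have qQ := uniformly_bounded_by_shift lV VM (lexx `|Re z|).
have su' : solves (fun t => V t - Re z) (fun t => - Im z * Im (f t)) (Re \o f) u1.
  by apply: solves_eq su => // t _ /=; ring.
have lsc (g : R -> R) k : lint (fun t => g t ^+ 2) -> lint (fun t => (k * g t) ^+ 2).
  move=> lg; under eq_fun do rewrite exprMn; exact: lintZ.
have [u_0 u1_0] := solution_decay qQ (lint_shift _) (lintZ (- Im z) lf2) (lsc _ _ lf22) su' bu (scal _ _ lf22 bv).
have [v_0 v1_0] := solution_decay qQ (lint_shift _) (lintZ (Im z) lf1) (lsc _ _ lf12) sv bv (scal _ _ lf12 bu).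
have cw : 2 * (Im z * (u1 n%:R * Im (f n%:R) - Re (f n%:R) * v1 n%:R)) @[n --> \oo] -->
    (2 * (Im z * (0 * 0 - 0 * 0)) : R).
  by apply: cvgMr; apply: cvgMr; apply: cvgB; exact: cvgM.
have zE : 2 * (Im z * (0 * 0 - 0 * 0)) = 0 :> R by ring.
rewrite {}zE in cw.
apply: ae_eq0_of_modsq => // m.
have b20 : 0 < Im z ^+ 2 by rewrite lt_def sqr_ge0 sqrf_eq0 b0.
rewrite -(pmulr_rle0 _ b20).
apply: (@ler_cvg_to _ _ _ _ (fun=> _) _ _ _ (cvg_cst _) cw).
exists m => // n /= mn.
have l00 : lint (fun=> 0 ^+ 2 : R) by exact: lint_cst.
have su2 : solves (fun t => V t - Re z) (fun t => (fun=> 0) t - Im z * (Im \o f) t) (Re \o f) u1.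
  by apply: solves_eq su => // t _ /=; ring.
have sv2 : solves (fun t => V t - Re z) (fun t => (fun=> 0) t + Im z * (Re \o f) t) (Im \o f) v1.
  by apply: solves_eq sv => // t _ /=; ring.
have u00 : (Re \o f) 0 = 0 by rewrite /= f0.
have v00 : (Im \o f) 0 = 0 by rewrite /= f0.
have := nonreal_bound b0 lint0 lint0 l00 l00 su2 sv2 u00 v00 (ler0n _ n).
rewrite [X in _ + X](@J_eq _ _ (fun=> 0)); last by move=> t _; rewrite expr0n addr0.
rewrite J_cst// mul0r addr0; apply: le_trans; rewrite ler_wpM2l ?sqr_ge0//.
apply: J_mono => //; first exact: L2loc_modsq lf.
  by rewrite ler_nat.
by move=> t _; rewrite addr_ge0// sqr_ge0.
Qed.

Lemma nonreal_resolvent z : Im z != 0 -> resolvent_set T z.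
Proof.
move=> b0; have b20 : 0 < Im z ^+ 2 by rewrite lt_def sqr_ge0 sqrf_eq0 b0.
have K0 : 0 <= (Im z ^+ 2)^-1 by rewrite invr_ge0 ltW.
apply: (resolvent_of_apriori lV K0 (N0 := 0%N) _ (nonreal_not_eigenvalue b0)).
move=> h1 h2 u u1 v v1 n _ lh1 lh2 lh12 lh22 su sv u0 v0 un vn.
have := nonreal_bound b0 lh1 lh2 lh12 lh22 su sv u0 v0 (ler0n _ n).
rewrite un vn mulr0 mul0r subrr !mulr0 add0r => h.
by rewrite mulrC ler_pdivlMr// mulrC.
Qed.

Lemma nonneg_in_spectrum (lambda : R) : 0 <= lambda -> spectrum T lambda%:C.
Proof.
move=> lambda0 [K KP].
apply: (@no_bounded_inverse _ V M lambda `|K| lambda0 (normr_ge0 _) lV VM Vd).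
move=> h H lh lh2 hH.
pose hc t := (h t)%:C.
have lhc : L2loc hc.
  by split; [exact: lh|exact: lint0|exact: lh2|rewrite /= expr0n; exact: lint0].
have hcE : modsq hc = fun t => h t ^+ 2.
  by apply/funext => t; rewrite /modsq /= expr0n addr0.
have Lh : L2_halfline hc by apply/L2P; split=> //; exists H => n; rewrite hcE.
have nh : (normc2_integral hc <= H%:E)%E by apply/normc2P => // n; rewrite hcE.
have nh0 : (0 <= normc2_integral hc)%E.
  by rewrite normc2_integralE; apply: integral_ge0 => t _; rewrite lee_fin modsq_ge0.
have [f [Tf _ fK]] := KP hc Lh.
have [Lf f0 [u1 [v1 [su _]]]] := (schroedinger_zP lV _ f Lh).1 Tf.
exists (Re \o f), u1; split; first by apply: solves_eq su => // t _ /=; ring.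
move=> n; have /L2P[lf _] := Lf; have [_ _ lf12 _] := lf.
have fKH : (normc2_integral f <= (`|K| * H)%:E)%E.
  apply: (le_trans fK); rewrite EFinM; apply: (@le_trans _ _ (`|K|%:E * normc2_integral hc)%E).
    by apply: lee_wpmul2r => //; rewrite lee_fin ler_norm.
  by apply: lee_wpmul2l.
apply: le_trans ((normc2P _ lf).1 fKH n); apply: J_le => //; first exact: L2loc_modsq.
by move=> t _; rewrite /modsq lerDl sqr_ge0.
Qed.

(** Such a z is a negative energy whose solution phi is square integrable. It is
    isolated because a nearby energy in the spectrum would have a square integrable
    solution too. *)
Lemma outside_halfline_discrete z : spectrum T z -> ~ (exists2 x : R, 0 <= x & x%:C = z) ->
  discrete_spectrum T z.
Proof.
move=> sz nz.
have [z0|b0] := eqVneq (Im z) 0; last by case: (sz (nonreal_resolvent b0)).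
pose E := Re z.
have zE : z = E%:C by rewrite /E; move: z0; case: (z) => a b /= ->.
have E0 : E < 0 by rewrite ltNge; apply/negP => E0; apply: nz; exists E.
have [phi [phi1 [v [v1 [phi0 _ phi10 _ [sphi _]]]]]] := ivp_exists E 0 1 lV lint0 lint0.
have {}sphi : solves (fun t => V t - E) (fun=> 0) phi phi1.
  by apply: solves_eq sphi => // t _ /=; ring.
have bphi : sq_bounded phi.
  apply: contrapT => nb; apply: sz; rewrite zE.
  exact: negative_resolvent_or_eigenvalue sphi phi0 phi10 nb.
split.
- split; first exact/mem_set.
  have [eps eps0 epsP] := eigenvalue_isolated_real lV VM Vd E0 sphi phi0 phi10 bphi.
  pose e := Num.min eps (- E).
  have e0 : 0 < e by rewrite lt_min eps0 oppr_gt0.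
  exists [set w | Normc.normc (z - w) < e].
    by apply/nbhs_normcP; exists e.
  apply/seteqP; split=> [w [/= we sw]|w ->]; last first.
    by split => //=; rewrite subrr Normc.normc0.
  have [w0|b0] := eqVneq (Im w) 0; last by case: (sw (nonreal_resolvent b0)).
  pose E' := Re w; have wE : w = E'%:C by rewrite /E'; move: w0; case: (w) => a b /= ->.
  have EE' : `|E' - E| < e.
    by move: we; rewrite zE wE /Normc.normc/= subrr expr0n addr0 sqrtr_sqr distrC.
  have E'0 : E' < 0.
    have : `|E' - E| < - E by apply: (lt_le_trans EE'); rewrite ge_min lexx orbT.
    by rewrite ltr_norml => /andP[_]; lra.
  have [psi [psi1 [v' [v1' [psi0 _ psi10 _ [spsi _]]]]]] := ivp_exists E' 0 1 lV lint0 lint0.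
  have {}spsi : solves (fun t => V t - E') (fun=> 0) psi psi1.
    by apply: solves_eq spsi => // t _ /=; ring.
  rewrite wE zE; congr (_%:C); apply/eqP; apply: contrapT => /negP nE.
  have EE'' : `|E' - E| < eps by apply: (lt_le_trans EE'); rewrite ge_min lexx.
  apply: sw; rewrite wE; apply: (negative_resolvent_or_eigenvalue E'0 spsi psi0 psi10).
  exact: epsP EE'' nE spsi psi0 psi10.
- by rewrite zE; apply/(eigenvalue_sq_bounded sphi phi0 phi10).
- exists 1%N, (fun _ t => (phi t)%:C) => f; rewrite zE => ef.
  have [c fE] := eigenfunction_multiple sphi phi0 phi10 ef.
  exists (fun=> c); apply: aeW => t; rewrite /= in_itv/= andbT => t0.
  by rewrite big_ord1 fE// ltW.
Qed.

(** No point of the half-line is isolated in the spectrum, as all of the half-line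
    belongs to the spectrum. *)
Theorem essential_spectrum_decaying :
  essential_spectrum T = [set x%:C | x in (`[0%R, +oo[%classic : set R)].
Proof.
apply/seteqP; split=> [z [sz nd]|_ [x + <-]].
  have [[x x0 xz]|nz] := pselect (exists2 x : R, 0 <= x & x%:C = z).
    by exists x => //; rewrite /= in_itv/= x0.
  by exfalso; apply: nd; exact: outside_halfline_discrete.
rewrite /= in_itv/= andbT => x0; split; first exact: nonneg_in_spectrum.
move=> [[_ [A /nbhs_normcP[e e0 eA] AE]] _ _].
have : (A `&` spectrum T) (x + e / 2)%:C.
  split; last by apply: nonneg_in_spectrum; lra.
  apply: eA; rewrite /Normc.normc/= subrr expr0n addr0 sqrtr_sqr.
  have -> : x - (x + e / 2) = - (e / 2) by ring.
  by rewrite normrN gtr0_norm; lra.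
rewrite AE => /= -[] /eqP; rewrite -subr_eq0; have -> : x + e / 2 - x = e / 2 by ring.
by apply/negP; rewrite gt_eqF; lra.
Qed.

End EssentialSpectrum.

(** * The Martin function of the complement of a half-line *)

Section MartinFunction.
Context {R : realType}.
Local Notation Re := (@complex.Re R).
Local Notation Im := (@complex.Im R).
Local Notation normc := (@Normc.normc R).
Implicit Types (z w : R[i]) (Omega : set R[i]) (u : R[i] -> R).

Lemma normc_ge_absRe z : `|Re z| <= normc z.
Proof.
case: z => a b /=; rewrite -sqrtr_sqr ler_wsqrtr//.
by rewrite lerDl sqr_ge0.
Qed.

Lemma normc_ge_absIm z : `|Im z| <= normc z.
Proof.
case: z => a b /=; rewrite -sqrtr_sqr ler_wsqrtr//.
by rewrite lerDr sqr_ge0.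
Qed.

Lemma normc_ge0 z : 0 <= normc z.
Proof. exact: le_trans (normc_ge_absRe z). Qed.

Lemma lipschitz_continuous u : (forall z w, `|u z - u w| <= normc (z - w)) -> continuous u.
Proof.
move=> lu z A /nbhs_ballP[e /= e0 eA].
apply: (nbhs_normcP z (u @^-1` A)).2; exists e => // w zw; apply: eA.
exact: le_lt_trans (lu z w) zw.
Qed.

Lemma continuous_Re : continuous Re.
Proof.
apply: lipschitz_continuous => z w.
have -> : Re z - Re w = Re (z - w) by case: z w => ? ? [? ?].
exact: normc_ge_absRe.
Qed.

Lemma continuous_Im : continuous Im.
Proof.
apply: lipschitz_continuous => z w.
have -> : Im z - Im w = Im (z - w) by case: z w => ? ? [? ?].
exact: normc_ge_absIm.
Qed.

Lemma continuous_normc : continuous normc.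
Proof.
apply: lipschitz_continuous => z w.
have h (x y : R[i]) : normc x - normc y <= normc (x - y).
  by rewrite lerBlDr -{1}(subrK y x); exact: le_normcD.
rewrite ler_norml h andbT lerNl opprB.
by rewrite -(normcN (z - w)) opprB h.
Qed.

(** The partial derivatives are only prescribed on Omega; as Omega is open, u agrees
    with w on a segment around each of its points. *)
Lemma C1_onP Omega u (w p q : R[i] -> R) : (forall z, Omega z -> nbhs z Omega) ->
  (forall z, Omega z -> u z = w z) ->
  (forall z, Omega z -> [/\ is_derive (Re z) 1 (xslice w z) (p z),
     is_derive (Im z) 1 (yslice w z) (q z), {for z, continuous p} & {for z, continuous q}]) ->
  C1_on Omega u /\ forall z, Omega z -> dx u z = p z /\ dy u z = q z.
Proof.
move=> oO uw dw.
have dxu z : Omega z -> is_derive (Re z) 1 (xslice u z) (p z).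
  move=> Oz; have [dp _ _ _] := dw z Oz.
  apply: near_eq_is_derive dp; have /nbhs_normcP[e e0 eO] := oO z Oz.
  exists e => //= t zt; apply/esym/uw; apply: eO; move: zt.
  by rewrite /normc; case: (z) => a b /=; rewrite subrr expr0n/= addr0 sqrtr_sqr.
have dyu z : Omega z -> is_derive (Im z) 1 (yslice u z) (q z).
  move=> Oz; have [_ dq _ _] := dw z Oz.
  apply: near_eq_is_derive dq; have /nbhs_normcP[e e0 eO] := oO z Oz.
  exists e => //= t zt; apply/esym/uw; apply: eO; move: zt.
  by rewrite /normc; case: (z) => a b /=; rewrite subrr expr0n/= add0r sqrtr_sqr.
have E z : Omega z -> dx u z = p z /\ dy u z = q z.
  move=> Oz; have h1 := dxu z Oz; have h2 := dyu z Oz.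
  by rewrite /dx /dy !derive1E !derive_val.
split=> // z Oz; have [_ _ cp cq] := dw z Oz.
have [e1 e2] := E z Oz.
split.
- by have [] := dxu z Oz.
- by have [] := dyu z Oz.
- move=> A; rewrite e1 => /cp pA; have := oO z Oz => Ozn.
  by apply: filterS2 Ozn pA => y /E[/= -> _].
- move=> A; rewrite e2 => /cq pA; have := oO z Oz => Ozn.
  by apply: filterS2 Ozn pA => y /E[/= _ ->].
Qed.

(** With s = sqrt (- z): martin0 and martin0_conj are the real and imaginary parts of
    s, rho is |s|^2, which equals |z|, alpha - i beta is 1 / (2 s), and
    cubeRe - i cubeIm is 2 / (2 s)^3. The closed form of Re s, together with
    Re s * Im s = - Im z / 2, avoids arguments and branches of the square root. *)
Definition martin0 z : R := Num.sqrt ((normc z - Re z) / 2).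
Definition martin0_conj z : R := - Im z / (2 * martin0 z).
Definition rho z : R := martin0 z ^+ 2 + martin0_conj z ^+ 2.
Definition alpha z : R := martin0 z / (2 * rho z).
Definition beta z : R := martin0_conj z / (2 * rho z).
Definition cubeRe z : R := 2 * (alpha z ^+ 3 - 3 * alpha z * beta z ^+ 2).
Definition cubeIm z : R := 2 * (3 * alpha z ^+ 2 * beta z - beta z ^+ 3).

Local Notation cut_plane := [set z : R[i] | 0 < martin0 z].

Lemma martin0_sqr z : martin0 z ^+ 2 = (normc z - Re z) / 2.
Proof.
rewrite sqr_sqrtr// divr_ge0// subr_ge0.
exact: le_trans (ler_norm _) (normc_ge_absRe z).
Qed.

Lemma normc_sqr z : normc z ^+ 2 = Re z ^+ 2 + Im z ^+ 2.
Proof. by case: z => a b /=; rewrite sqr_sqrtr// addr_ge0// sqr_ge0. Qed.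

Lemma rho_normc z : 0 < martin0 z -> rho z = normc z.
Proof.
move=> M0; have M2 := martin0_sqr z; have r2 := normc_sqr z.
rewrite /rho /martin0_conj.
have M20 : 0 < martin0 z ^+ 2 by rewrite exprn_gt0.
apply: (mulfI (x := 4 * martin0 z ^+ 2)); first by rewrite gt_eqF// mulr_gt0.
have -> : 4 * martin0 z ^+ 2 * (martin0 z ^+ 2 + (- Im z / (2 * martin0 z)) ^+ 2) =
  4 * (martin0 z ^+ 2) ^+ 2 + Im z ^+ 2 by field; rewrite gt_eqF.
have -> : Im z ^+ 2 = normc z ^+ 2 - Re z ^+ 2 by rewrite r2; ring.
by rewrite M2; field.
Qed.

Lemma normc_gt0_of z : 0 < martin0 z -> 0 < normc z.
Proof.
move=> M0; rewrite lt_def normc_ge0 andbT; apply/eqP => n0.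
have := normc_ge_absRe z; rewrite n0 normr_le0 => /eqP r0.
by move: M0; rewrite /martin0 n0 r0 subrr mul0r sqrtr0 ltxx.
Qed.

Lemma is_derive_mul (f g : R -> R) (x a b : R) : is_derive x 1 f a -> is_derive x 1 g b ->
  is_derive x 1 (fun t => f t * g t) (a * g x + f x * b).
Proof.
move=> df dg; have -> : a * g x + f x * b = f x *: b + g x *: a.
  by rewrite addrC (mulrC a).
exact: is_deriveM.
Qed.

Lemma is_derive_inv (f : R -> R) (x a : R) : is_derive x 1 f a -> f x != 0 ->
  is_derive x 1 (fun t => (f t)^-1) (- a / f x ^+ 2).
Proof.
move=> df f0; have := is_deriveV f0 df.
by rewrite /GRing.scale/= => h; apply: is_derive_eq h _; rewrite -exprVn; ring.
Qed.

Lemma is_derive_sqrt (f : R -> R) (x a : R) : 0 < f x -> is_derive x 1 f a ->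
  is_derive x 1 (fun t => Num.sqrt (f t)) (a / (2 * Num.sqrt (f x))).
Proof.
move=> f0 df; have := is_derive1_comp (is_derive1_sqrt f0) df.
by move=> h; apply: is_derive_eq h _; rewrite mulrC.
Qed.

Lemma is_derive_const (c x : R) : is_derive x 1 (fun=> c) 0.
Proof. exact: is_derive_cst. Qed.

Lemma is_derive_var (x : R) : is_derive x 1 (fun t => t) 1.
Proof. exact: is_derive_id. Qed.

Lemma is_derive_add (f g : R -> R) (x a b : R) : is_derive x 1 f a -> is_derive x 1 g b ->
  is_derive x 1 (fun t => f t + g t) (a + b).
Proof. by move=> df dg; exact: is_deriveD. Qed.

Lemma is_derive_opp (f : R -> R) (x a : R) : is_derive x 1 f a -> is_derive x 1 (fun t => - f t) (- a).
Proof. by move=> df; exact: is_deriveN. Qed.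

Lemma is_derive_sqr (f : R -> R) (x a : R) : is_derive x 1 f a ->
  is_derive x 1 (fun t => f t ^+ 2) (2 * f x * a).
Proof.
move=> df; have := is_derive_mul df df.
under eq_fun do rewrite -expr2.
by move=> h; apply: is_derive_eq h _; ring.
Qed.

(** The Cauchy-Riemann equations for s, whose complex derivative is
    - (alpha - i beta). *)
Lemma martin0_derive z : 0 < martin0 z ->
  is_derive (Re z) 1 (xslice martin0 z) (- alpha z) /\
  is_derive (Im z) 1 (yslice martin0 z) (- beta z).
Proof.
move=> M0; have rr := rho_normc M0; have r0 := normc_gt0_of M0.
have M2 := martin0_sqr z; have r2 := normc_sqr z.
rewrite /alpha /beta rr /martin0_conj.
have r20 : 0 < Re z ^+ 2 + Im z ^+ 2 by rewrite -r2 exprn_gt0.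
have sq : Num.sqrt (Re z ^+ 2 + Im z ^+ 2) = normc z.
  by rewrite -r2 sqrtr_sqr ger0_norm// ltW.
have pos : 0 < (Num.sqrt (Re z ^+ 2 + Im z ^+ 2) - Re z) / 2.
  by rewrite sq -M2 exprn_gt0.
have sqM : Num.sqrt ((Num.sqrt (Re z ^+ 2 + Im z ^+ 2) - Re z) / 2) = martin0 z.
  by rewrite sq.
have RE : Re z = normc z - 2 * martin0 z ^+ 2 by rewrite M2; field.
split.
  pose f t := t ^+ 2 + Im z ^+ 2; pose g t := (Num.sqrt (f t) - t) * 2^-1.
  have d1 : is_derive (Re z) 1 f (2 * Re z * 1 + 0).
    exact: is_derive_add (is_derive_sqr (is_derive_var _)) (is_derive_const _ _).
  have d2 := is_derive_sqrt (f := f) r20 d1.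
  have d3 : is_derive (Re z) 1 g _ := is_derive_mul (is_derive_add d2 (is_derive_opp (is_derive_var _))) (is_derive_const 2^-1 (Re z)).
  have d4 := is_derive_sqrt (f := g) pos d3.
  apply: is_derive_eq d4 _; rewrite /g /f sqM sq mulr0 addr0.
  by rewrite {1}RE; field; rewrite !gt_eqF.
pose f t := Re z ^+ 2 + t ^+ 2; pose g t := (Num.sqrt (f t) - Re z) * 2^-1.
have d1 : is_derive (Im z) 1 f (0 + 2 * Im z * 1).
  exact: is_derive_add (is_derive_const _ _) (is_derive_sqr (is_derive_var _)).
have d2 := is_derive_sqrt (f := f) r20 d1.
have d3 : is_derive (Im z) 1 g _ := is_derive_mul (is_derive_add d2 (is_derive_const (- Re z) _)) (is_derive_const 2^-1 (Im z)).
have d4 := is_derive_sqrt (f := g) pos d3.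
by apply: is_derive_eq d4 _; rewrite /g /f sqM sq; field; rewrite !gt_eqF.
Qed.

Lemma complex_eta z : (Re z +i* Im z) = z. Proof. by case: z. Qed.

Lemma martin0_conj_derive z : 0 < martin0 z ->
  is_derive (Re z) 1 (xslice martin0_conj z) (beta z) /\
  is_derive (Im z) 1 (yslice martin0_conj z) (- alpha z).
Proof.
move=> M0; have [dMx dMy] := martin0_derive M0.
have rr := rho_normc M0; have r0 := normc_gt0_of M0.
have Mx : xslice martin0 z (Re z) = martin0 z by rewrite /xslice complex_eta.
have My : yslice martin0 z (Im z) = martin0 z by rewrite /yslice complex_eta.
have MC : Im z = - 2 * martin0 z * martin0_conj z by rewrite /martin0_conj; field; rewrite gt_eqF.
have M2x0 : 2 * xslice martin0 z (Re z) != 0 by rewrite Mx gt_eqF// mulr_gt0.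
have M2y0 : 2 * yslice martin0 z (Im z) != 0 by rewrite My gt_eqF// mulr_gt0.
have rho0 : martin0 z ^+ 2 + martin0_conj z ^+ 2 != 0 by rewrite gt_eqF// -/(rho z) rr.
split.
  have d := is_derive_mul (is_derive_const (- Im z) (Re z)) (is_derive_inv (is_derive_mul (is_derive_const 2 _) dMx) M2x0).
  apply: is_derive_eq d _; rewrite /= Mx {1}MC /alpha /beta /rho.
  by move: (martin0 z) (martin0_conj z) M0 rho0 => m c m0 h; field; rewrite h gt_eqF.
have d := is_derive_mul (is_derive_opp (is_derive_var (Im z))) (is_derive_inv (is_derive_mul (is_derive_const 2 _) dMy) M2y0).
apply: is_derive_eq d _; rewrite /= My {1}MC /alpha /beta /rho.
by move: (martin0 z) (martin0_conj z) M0 rho0 => m c m0 h; field; rewrite h gt_eqF.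
Qed.

(** The complex derivative of 1 / (2 s) is 2 / (2 s)^3. *)
Lemma alpha_beta_derive z : 0 < martin0 z ->
  [/\ is_derive (Re z) 1 (xslice alpha z) (cubeRe z),
      is_derive (Im z) 1 (yslice alpha z) (cubeIm z),
      is_derive (Re z) 1 (xslice beta z) (cubeIm z) &
      is_derive (Im z) 1 (yslice beta z) (- cubeRe z)].
Proof.
move=> M0; have [dMx dMy] := martin0_derive M0; have [dCx dCy] := martin0_conj_derive M0.
have rr := rho_normc M0; have r0 := normc_gt0_of M0.
have Mx : xslice martin0 z (Re z) = martin0 z by rewrite /xslice complex_eta.
have My : yslice martin0 z (Im z) = martin0 z by rewrite /yslice complex_eta.
have Cx : xslice martin0_conj z (Re z) = martin0_conj z by rewrite /xslice complex_eta.
have Cy : yslice martin0_conj z (Im z) = martin0_conj z by rewrite /yslice complex_eta.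
have rho0 : martin0 z ^+ 2 + martin0_conj z ^+ 2 != 0 by rewrite gt_eqF// -/(rho z) rr.
have dx_ := is_derive_mul (is_derive_const 2 _) (is_derive_add (is_derive_sqr dMx) (is_derive_sqr dCx)).
have dy_ := is_derive_mul (is_derive_const 2 _) (is_derive_add (is_derive_sqr dMy) (is_derive_sqr dCy)).
have nx : 2 * (xslice martin0 z (Re z) ^+ 2 + xslice martin0_conj z (Re z) ^+ 2) != 0.
  by rewrite Mx Cx mulf_neq0.
have ny : 2 * (yslice martin0 z (Im z) ^+ 2 + yslice martin0_conj z (Im z) ^+ 2) != 0.
  by rewrite My Cy mulf_neq0.
have vx := is_derive_inv dx_ nx; have vy := is_derive_inv dy_ ny.
have fin := (Mx, My, Cx, Cy).
split.
- apply: is_derive_eq (is_derive_mul dMx vx) _; rewrite !fin /cubeRe /alpha /beta /rho.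
  by move: (martin0 z) (martin0_conj z) M0 rho0 => m c m0 h; field; rewrite h.
- apply: is_derive_eq (is_derive_mul dMy vy) _; rewrite !fin /cubeIm /alpha /beta /rho.
  by move: (martin0 z) (martin0_conj z) M0 rho0 => m c m0 h; field; rewrite h.
- apply: is_derive_eq (is_derive_mul dCx vx) _; rewrite !fin /cubeIm /alpha /beta /rho.
  by move: (martin0 z) (martin0_conj z) M0 rho0 => m c m0 h; field; rewrite h.
- apply: is_derive_eq (is_derive_mul dCy vy) _; rewrite !fin /cubeRe /alpha /beta /rho.
  by move: (martin0 z) (martin0_conj z) M0 rho0 => m c m0 h; field; rewrite h.
Qed.

Section PointwiseContinuity.
Context (z : R[i]) (f g : R[i] -> R)
  (cf : {for z, continuous f}) (cg : {for z, continuous g}).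
Let FF : Filter (nbhs z) := nbhs_filter z.

Lemma continuous_add : {for z, continuous (fun w => f w + g w)}.
Proof. exact: (@cvgD _ _ _ _ FF _ _ _ _ cf cg). Qed.

Lemma continuous_opp : {for z, continuous (fun w => - f w)}.
Proof. exact: (@cvgN _ _ _ _ FF _ _ cf). Qed.

Lemma continuous_mul : {for z, continuous (fun w => f w * g w)}.
Proof. exact: (@cvgM _ _ _ FF _ _ _ _ cf cg). Qed.

Lemma continuous_inv : f z != 0 -> {for z, continuous (fun w => (f w)^-1)}.
Proof. by move=> f0; exact: (@cvgV _ _ _ FF _ _ f0 cf). Qed.

Lemma continuous_post (h : R -> R) : {for f z, continuous h} -> {for z, continuous (fun w => h (f w))}.
Proof. by move=> ch A nA; exact: cf (ch _ nA). Qed.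

End PointwiseContinuity.

Lemma continuous_const z (k : R) : {for z, continuous (fun=> k)}.
Proof.
move=> A nA; apply: (@filterE _ _ (nbhs_filter z)) => w.
exact: (nbhs_singleton nA).
Qed.

Lemma continuous_pow z (f : R[i] -> R) n : {for z, continuous f} -> {for z, continuous (fun w => f w ^+ n)}.
Proof.
move=> cf; elim: n => [|n IH].
  by rewrite (_ : (fun w => _) = fun=> 1); [exact: continuous_const|apply/funext => w; rewrite expr0].
rewrite (_ : (fun w => _) = fun w => f w * f w ^+ n); first exact: continuous_mul.
by apply/funext => w; rewrite exprS.
Qed.

Lemma continuous_martinM : continuous martin0.
Proof.
move=> z; have h (t : R) : {for t, continuous (@Num.sqrt R)} by exact: sqrt_continuous.
move: (h ((normc z - Re z) / 2)); apply: continuous_post.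
apply: continuous_mul; last exact: continuous_const.
by apply: continuous_add; [exact: continuous_normc|apply: continuous_opp; exact: continuous_Re].
Qed.

Lemma cut_plane_open z : cut_plane z -> nbhs z cut_plane.
Proof.
by move=> Oz; exact: (@continuous_martinM z _ (lt_nbhsr Oz)).
Qed.

Lemma continuous_alpha_beta z : 0 < martin0 z ->
  [/\ {for z, continuous alpha}, {for z, continuous beta},
      {for z, continuous cubeRe} & {for z, continuous cubeIm}].
Proof.
move=> M0; have cM : {for z, continuous martin0} by exact: continuous_martinM.
have rr := rho_normc M0; have r0 := normc_gt0_of M0.
have k (c : R) : {for z, continuous (fun=> c)} by exact: continuous_const.
have cC : {for z, continuous martin0_conj}.
  apply: continuous_mul; first by apply: continuous_opp; exact: continuous_Im.
  by apply: continuous_inv; [exact: continuous_mul|rewrite gt_eqF// mulr_gt0].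
have cr : {for z, continuous (fun w => (2 * rho w)^-1)}.
  apply: continuous_inv; last by rewrite gt_eqF// mulr_gt0// rr.
  by apply: continuous_mul => //; apply: continuous_add; exact: continuous_pow.
have c1 : {for z, continuous alpha} by exact: continuous_mul.
have c2 : {for z, continuous beta} by exact: continuous_mul.
split=> //.
  apply: continuous_mul => //; apply: continuous_add; first exact: continuous_pow.
  by apply: continuous_opp; apply: continuous_mul; [exact: continuous_mul|exact: continuous_pow].
apply: continuous_mul => //; apply: continuous_add; last by apply: continuous_opp; exact: continuous_pow.
by apply: continuous_mul => //; apply: continuous_mul => //; exact: continuous_pow.
Qed.

Lemma martin0_harmonic : harmonic_on cut_plane martin0.
Proof.
have [h1 e1] : C1_on cut_plane martin0 /\ forall z, cut_plane z ->
    dx martin0 z = - alpha z /\ dy martin0 z = - beta z.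
  apply: (C1_onP (w := martin0)) => [|//|z Oz]; first exact: cut_plane_open.
  have [? ?] := martin0_derive Oz; have [c1 c2 _ _] := continuous_alpha_beta Oz.
  by split=> //; exact: continuous_opp.
have [h2 e2] : C1_on cut_plane (dx martin0) /\ forall z, cut_plane z ->
    dx (dx martin0) z = - cubeRe z /\ dy (dx martin0) z = - cubeIm z.
  apply: (C1_onP (w := fun z => - alpha z)) => [|z /e1[]//|z Oz]; first exact: cut_plane_open.
  have [d1 d2 _ _] := alpha_beta_derive Oz; have [_ _ c1 c2] := continuous_alpha_beta Oz.
  by split; [exact: is_derive_opp d1|exact: is_derive_opp d2|exact: continuous_opp|exact: continuous_opp].
have [h3 e3] : C1_on cut_plane (dy martin0) /\ forall z, cut_plane z ->
    dx (dy martin0) z = - cubeIm z /\ dy (dy martin0) z = - - cubeRe z.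
  apply: (C1_onP (w := fun z => - beta z)) => [|z /e1[]//|z Oz]; first exact: cut_plane_open.
  have [_ _ d1 d2] := alpha_beta_derive Oz; have [_ _ c1 c2] := continuous_alpha_beta Oz.
  by split; [exact: is_derive_opp d1|exact: is_derive_opp d2|exact: continuous_opp|apply: continuous_opp; exact: continuous_opp].
split=> // z Oz; have [-> _] := e2 z Oz; have [_ ->] := e3 z Oz.
by rewrite opprK addNr.
Qed.

Local Notation E := [set x%:C | x in (`[0%R, +oo[%classic : set R)].

Lemma complement_halfline : ~` E = cut_plane.
Proof.
apply/seteqP; split=> [z nE|z /= M0 [x /=]].
  rewrite /= sqrtr_gt0 divr_gt0// subr_gt0 lt_neqAle.
  rewrite (le_trans (ler_norm _) (normc_ge_absRe z)) andbT; apply/eqP => zE.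
  apply: nE; have := normc_sqr z; rewrite -zE => /eqP.
  rewrite -{1}(addr0 (Re z ^+ 2)) (inj_eq (addrI _)) eq_sym sqrf_eq0 => /eqP i0.
  exists (Re z); last by move: i0; case: (z) => a b /= ->.
  by rewrite /= in_itv/= andbT zE normc_ge0.
rewrite in_itv/= andbT => x0 xz; move: M0; rewrite -xz /martin0 /normc/= expr0n/= addr0.
by rewrite sqrtr_sqr ger0_norm// subrr mul0r sqrtr0 ltxx.
Qed.

Lemma martin_function_halfline : martin_function E martin0.
Proof.
split.
- by rewrite complement_halfline; exact: martin0_harmonic.
- by move=> z nE; have : (~` E) z by []; rewrite complement_halfline.
- move=> r; exists (Num.sqrt `|r|) => z _ zr; apply: ler_wsqrtr.
  have := normc_ge_absRe z; rewrite ler_norml => /andP[h1 h2].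
  by have := ler_norm r; lra.
- move=> x [[y /= + <-] _]; rewrite in_itv/= andbT => y0.
  have M0 : martin0 y%:C = 0.
    rewrite /martin0 /normc/= expr0n/= addr0 sqrtr_sqr ger0_norm// subrr mul0r.
    by rewrite sqrtr0.
  rewrite -M0 => A /(@continuous_martinM y%:C) nA.
  have FF : Filter (nbhs y%:C) := nbhs_filter _.
  by apply: (@filterS _ _ FF _ _ _ nA) => w /=.
- apply: (@cvg_trans _ ((fun=> 1 : R) @ +oo%R)); last exact: cvg_cst.
  apply: near_eq_cvg; exists 0; split => // t t0.
  have -> : martin0 (- t)%:C = Num.sqrt t.
    rewrite /martin0 /normc/= expr0n/= addr0 sqrtr_sqr normrN gtr0_norm//.
    by congr Num.sqrt; field.
  rewrite sqrtc_sqrtr; last by rewrite ler0c ltW.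
  by rewrite /= divff// gt_eqF// sqrtr_gt0.
Qed.

Lemma martin0_Re_sqrtc z : complex.Re (sqrtc (- z)) = martin0 z.
Proof. by case: z => a b; rewrite /martin0 /sqrtc /normc/= !sqrrN. Qed.

(** The expansion is exact with a = 0, because the Martin function equals
    Re sqrt (- z). *)
Lemma martin_constant_halfline : martin_constant E 0.
Proof.
exists martin0; first exact: martin_function_halfline.
move=> delta _ eps eps0; exists 0 => z _ _.
rewrite mul0r addr0 martin0_Re_sqrtc subrr normr0.
by rewrite mulr_ge0 ?(ltW eps0)// invr_ge0 sqrtr_ge0.
Qed.

End MartinFunction.

(** * Hypotheses on the potential, and the average of the potential *)

Section UniformlyLocallyIntegrable.
Context {R : realType}.
Local Notation mu := (@lebesgue_measure R).
Local Notation J a b f := (Rintegral mu `[a, b]%classic f).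
Implicit Types V : R -> R.

Local Notation unit_mass V x := (\int[mu]_(t in `[x, (x + 1)%R]) `|V t|%:E)%E.

Lemma lint_of_unit_mass V : measurable_fun (`[0%R, +oo[%classic : set R) V ->
  (forall x, 0 <= x -> (unit_mass V x < +oo)%E) -> lint V.
Proof.
move=> mV unitV.
have mseg (a b : R) (i : bool) : 0 <= a -> measurable_fun [set` Interval (BSide i a) (BRight b)] V.
  move=> a0; apply: measurable_funS mV => // t.
  by rewrite /= !in_itv/= andbT => /andP[at_ _]; case: i at_ => /= [|/ltW]; exact: le_trans.
have mnorm (a b : R) (i : bool) : 0 <= a ->
    measurable_fun [set` Interval (BSide i a) (BRight b)] (fun t => `|V t|%:E).
  by move=> a0; apply/measurable_EFinP/measurableT_comp => //; exact: mseg.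
have finite (n : nat) : (\int[mu]_(t in `[0%R, n%:R]) `|V t|%:E < +oo)%E.
  elim: n => [|n IH]; first by rewrite set_itv1 integral_set1.
  rewrite -natr1 (@itv_bndbnd_setU _ _ _ (BRight n%:R)) ?bnd_simp ?lerDl//.
  rewrite ge0_integral_setU//=; last 2 first.
    - by rewrite -itv_bndbnd_setU ?bnd_simp ?lerDl//; exact: mnorm.
    - apply/disj_set2P/seteqP; split=> // t [] /=; rewrite !in_itv/=.
      by move=> /andP[_ tn] /andP[nt _]; have := le_lt_trans tn nt; rewrite ltxx.
  apply: lte_add_pinfty => //; apply: le_lt_trans (unitV n%:R (ler0n _ _)).
  apply: ge0_subset_integral => //; first exact: mnorm.
  by apply: subset_itvr; rewrite bnd_simp.
move=> b b0; apply/integrableP; split; first by apply/measurable_EFinP; exact: mseg.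
have [n bn] := nat_above b; apply: le_lt_trans (finite n).
apply: ge0_subset_integral => //; first exact: mnorm.
by apply: subset_itvl; rewrite bnd_simp.
Qed.

Lemma uniformly_bounded_by_sup V : lint V ->
  (ereal_sup [set unit_mass V x | x in (`[0%R, +oo[%classic : set R)] < +oo)%E ->
  exists M, uniformly_bounded_by V M.
Proof.
move=> lV; set C := ereal_sup _ => Coo.
have JC x : 0 <= x -> ((J x (x + 1) (fun t => `|V t|))%:E <= C)%E.
  move=> x0; rewrite -J_EFin//; last exact: lint_norm.
  by apply: ereal_sup_ubound; exists x => //=; rewrite in_itv/= x0.
have C0 : (0 <= C)%E.
  apply: le_trans (JC 0 (lexx 0)); rewrite lee_fin; exact: J_ge0.
have Cfin : C \is a fin_num by rewrite ge0_fin_numE.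
exists (fine C); split; first exact: fine_ge0.
by move=> x x0; rewrite -lee_fin (fineK Cfin); exact: JC.
Qed.

Lemma decaying_of_cvg V : lint V ->
  (unit_mass V x @[x --> +oo%R] --> 0)%E -> decaying V.
Proof.
move=> lV /fine_cvgP[_] /cvgrPdist_le h d d0.
have [X [_ XP]] := h d d0.
exists (Num.max 0 (X + 1)); first by rewrite le_max lexx.
move=> x; rewrite ge_max => /andP[x0 Xx].
have /XP /= : X < x by lra.
rewrite J_EFin//=; last exact: lint_norm.
by rewrite sub0r normrN ger0_norm// J_ge0.
Qed.

(** Beyond X the integral of |V| grows by at most e / 2 per unit length. *)
Lemma average_cvg0 V : lint V -> decaying V ->
  x^-1 * J 0 x V @[x --> +oo] --> (0 : R).
Proof.
move=> lV dV; apply/cvgrPdist_le => e e0.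
have e20 : 0 < e / 2 by lra.
have [X X0 XV] := dV _ e20; have lN := lint_norm lV.
pose A := J 0 X (fun t => `|V t|).
have A0 : 0 <= A by exact: J_ge0.
pose Y := Num.max (X + 1) (2 * A / e + 1 + X).
exists Y; split; first exact: num_real.
move=> x Yx; have [Xx Ax] : X + 1 < x /\ 2 * A / e + 1 + X < x.
  by apply/andP; rewrite -gt_max.
have x0 : 0 < x by lra.
rewrite sub0r normrN normrM gtr0_norm ?invr_gt0// ler_pdivrMl//.
pose n := Num.truncn (x - X).
have xX0 : 0 <= x - X by lra.
have /andP[n1 n2] := truncn_itv xX0.
have := J_norm (a := 0) x lV (lexx 0).
have : J 0 x (fun t => `|V t|) <= J 0 (X + n.+1%:R) (fun t => `|V t|).
  by apply: J_mono => //; rewrite ?(ltW x0)//; lra.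
rewrite (J_cat lN (lexx 0) X0 (c := X + n.+1%:R)) ?lerDl//.
have := J_unit_bound n.+1 lN X0 XV; rewrite -/A -natr1 -/n in n1 n2 *.
have : A <= e / 2 * (x - 1 - X).
  by rewrite -ler_pdivrMl// invfM invrK; lra.
move: (n%:R : R) n1 n2 => m; nra.
Qed.

End UniformlyLocallyIntegrable.

Theorem corollary1p9 (R : realType) (V : R -> R)
  (mV : measurable_fun (`[0%R, +oo[%classic : set R) V)
  (supV : (ereal_sup [set \int[@lebesgue_measure R]_(t in `[x, (x + 1)%R])
                            `|V t|%:E | x in (`[0%R, +oo[%classic : set R)] < +oo)%E)
  (limV : (\int[@lebesgue_measure R]_(t in `[x, (x + 1)%R]) `|V t|%:E
             @[x --> +oo%R] --> 0)%E) :
  regular_potential V /\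
  essential_spectrum (schroedinger V) = [set x%:C | x in (`[0%R, +oo[%classic : set R)].
Proof.
have lV : lint V.
  apply: lint_of_unit_mass => // x x0; apply: le_lt_trans supV.
  by apply: ereal_sup_ubound; exists x => //=; rewrite in_itv/= x0.
have [M VM] := uniformly_bounded_by_sup lV supV.
have dV := decaying_of_cvg lV limV.
have essE := essential_spectrum_decaying lV VM dV.
split; last exact: essE.
exists 0; last exact: average_cvg0.
by rewrite essE; exact: martin_constant_halfline.
Qed.
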